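(* Let $\Phi\in\mathcal B_0$ satisfy the following for some $s\in(0,1)$: (a) $\int_{\mathbb R^d}e^{-t\Phi(|\xi|^2)}\,d\xi<\infty$ for every $t>0$; (b) there is a constant $C>0$ such that $j_\Phi(r)\ge C r^{-d-2s}$ for all $r\in(0,1]$. Let $(V_k)_{k\in\mathbb N}\subset\mathcal K^\Phi_{\rm dec}(\mathbb R^d)$ and $V\in\mathcal K^\Phi_{\rm dec}(\mathbb R^d)$ be such that (1) $\max\{\sup_{k\in\mathbb N}\|V_k^-\|_\infty,\|V^-\|_\infty\}<\infty$; (2) $V_k(x)\to V(x)$ as $k\to\infty$ for almost every $x\in\mathbb R^d$; (3) for every $u\in\mathcal D(\mathcal A_{\Phi,V})$, $\limsup_{k\to\infty}\int_{\mathbb R^d}V_k(x)u^2(x)\,dx\le\int_{\mathbb R^d}V(x)u^2(x)\,dx$. Then $\mathcal H_{\Phi,V_k}\to\mathcal H_{\Phi,V}$ in strong resolvent sense as $k\to\infty$.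
   Context: Fix $d\in\mathbb N$. A Bernstein function is a $\Phi\in C^\infty((0,\infty))$ with $\Phi\ge0$ and $(-1)^n\Phi^{(n)}\le0$ for all $n\ge1$. It has a unique representation $\Phi(z)=a_\Phi+b_\Phi z+\int_0^\infty(1-e^{-zt})\mu_\Phi(dt)$ with $a_\Phi,b_\Phi\ge0$ and $\int_{(0,\infty)}(1\wedge t)\mu_\Phi(dt)<\infty$. It is complete if $\mu_\Phi(dt)=m_\Phi(t)dt$ with $m_\Phi$ completely monotone. $\mathcal B_0$ is the set of complete Bernstein functions with $a_\Phi=b_\Phi=0$. The jump kernel is $j_\Phi(r)=\int_0^\infty(4\pi t)^{-d/2}e^{-r^2/(4t)}m_\Phi(t)\,dt$, $r>0$. $H^\Phi(\mathbb R^d)$ is the set of real-valued $u\in L^2(\mathbb R^d)$ with $\sqrt{\Phi(|\cdot|^2)}\,\widehat u\in L^2$; equivalently $u\in L^2$ and $[u]_\Phi^2=\frac12\int\int|u(x+h)-u(x)|^2j_\Phi(|h|)\,dx\,dh<\infty$. On it, $\mathcal E_\Phi(u,w)=\frac12\int\int(u(y)-u(x))(w(y)-w(x))j_\Phi(|x-y|)\,dx\,dy$. Kato class: let $p_t^\Phi(x)=(2\pi)^{-d}\int_{\mathbb R^d}e^{-ix\cdot\xi}e^{-t\Phi(|\xi|^2)}d\xi$ and $G_1^\Phi(x)=\int_0^\infty e^{-t}p_t^\Phi(x)\,dt$. A non-negative $V$ is in $\mathcal K^\Phi(\mathbb R^d)$ if $\lim_{\delta\downarrow0}\sup_{x}\int_{|x-y|<\delta}G_1^\Phi(x-y)V(y)\,dy=0$.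 A function $V:\mathbb R^d\to\overline{\mathbb R}$ is in $\mathcal K^\Phi_{\rm dec}(\mathbb R^d)$ ($\Phi$-Kato decomposable) if $V^-\in\mathcal K^\Phi(\mathbb R^d)$ and $\mathbf 1_KV^+\in\mathcal K^\Phi(\mathbb R^d)$ for every compact $K$, where $V^+=\max\{0,V\}$, $V^-=\max\{0,-V\}$. For $V\in\mathcal K^\Phi_{\rm dec}(\mathbb R^d)$ let $\mathcal A_{\Phi,V}(u,w)=\mathcal E_\Phi(u,w)+\int Vuw\,dx$ on $\mathcal D(\mathcal A_{\Phi,V})=\{u\in H^\Phi(\mathbb R^d):|\int Vu^2dx|<\infty\}$. $\mathcal H_{\Phi,V}=\Phi(-\Delta)+V$, with core $C_c^\infty(\mathbb R^d)$, denotes the self-adjoint realization in $L^2(\mathbb R^d)$, i.e. the self-adjoint operator associated with the form $\mathcal A_{\Phi,V}$. Self-adjoint operators $A_n$ converge to a self-adjoint operator $A$ in strong resolvent sense if there is $\lambda$ in all the resolvent sets $\rho(A)\cap\bigcap_n\rho(A_n)$ with $(\lambda-A_n)^{-1}u\to(\lambda-A)^{-1}u$ in norm for every $u\in\mathcal D(A)$. *)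

(* Defs.v *)
From HB Require Import structures.
From mathcomp Require Import all_boot all_order all_algebra.
From mathcomp Require Import all_classical all_reals all_analysis.
From mathcomp Require Import measurable_realfun.

Set Implicit Arguments.
Unset Strict Implicit.
Unset Printing Implicit Defensive.

Import Order.TTheory GRing.Theory Num.Theory.
Import numFieldNormedType.Exports.

Local Open Scope classical_set_scope.
Local Open Scope ring_scope.

(** * Lebesgue measure on R^d, realised as ['rV[R]_d]

    The norm that the library puts on ['rV[R]_d] is the sup norm; it is used
    only for the topology.  Euclidean lengths are written [enorm]. *)

Section rV_measurable.
Context {R : realType} (n : nat).

Definition rV_coord (i : 'I_n) (v : 'rV[R]_n) : measurableTypeR R := v ord0 i.

Let rV_set0 : g_sigma_preimage rV_coord set0.
Proof. exact: sigma_algebra0. Qed.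

Let rV_setC A : g_sigma_preimage rV_coord A -> g_sigma_preimage rV_coord (~` A).
Proof. exact: sigma_algebraC. Qed.

Let rV_bigcup (F : (set 'rV[R]_n)^nat) :
  (forall i, g_sigma_preimage rV_coord (F i)) ->
  g_sigma_preimage rV_coord (\bigcup_i (F i)).
Proof. exact: sigma_algebra_bigcup. Qed.

HB.instance Definition _ := @isMeasurable.Build default_measure_display
  'rV[R]_n (g_sigma_preimage rV_coord) rV_set0 rV_setC rV_bigcup.

End rV_measurable.

Section rV_measurable_fun.
Context {R : realType} (n : nat).

Lemma measurable_rV_coord (i : 'I_n) :
  measurable_fun [set: 'rV[R]_n] (rV_coord i).
Proof.
move=> _ Y mY; rewrite setTI; apply: sub_sigma_algebra => /=.
rewrite -bigcup_seq/=; exists i => /=; first by rewrite mem_index_enum.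
by exists Y => //; rewrite setTI.
Qed.

Lemma measurable_fun_rV d (T : measurableType d) (f : T -> 'rV[R]_n) :
  (forall i, measurable_fun [set: T] (rV_coord i \o f)) ->
  measurable_fun [set: T] f.
Proof.
move=> mf.
have sub : g_sigma_preimage (fun i => rV_coord i \o f) `<=` measurable.
  apply: smallest_sub; first exact: sigma_algebra_measurable.
  case: n => [|m] in f mf *; first by rewrite big_ord0.
  rewrite -bigcup_mkord_ord; apply: bigcup_sub => i Ii.
  by move=> A [B mB <-]; exact: mf.
move: sub; rewrite g_sigma_preimage_comp => sub.
by move=> _ A mA; apply: sub; exists A.
Qed.

End rV_measurable_fun.

Lemma sigma_finite_prod d1 d2 (T1 : measurableType d1) (T2 : measurableType d2)
    (R : realType) (m1 : {sigma_finite_measure set T1 -> \bar R})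
    (m2 : {sigma_finite_measure set T2 -> \bar R}) :
  sigma_finite setT (m1 \x m2)%E.
Proof.
(* canonical inference on [\x] finds the instance for (sub)probabilities *)
exact: (isSigmaFinite.sigma_finiteT
  (lebesgue_integral_fubini.measure_function_Measure_isSigmaFinite__to__measure_function_isSigmaFinite
     m1 m2)).
Qed.

Section rV_cons.
Context {R : realType} (n : nat).

Definition rV_cons (p : measurableTypeR R * 'rV[R]_n) : 'rV[R]_n.+1 :=
  \row_i (if unlift ord0 i is Some j then p.2 ord0 j else p.1).

Definition rV_uncons (v : 'rV[R]_n.+1) : measurableTypeR R * 'rV[R]_n :=
  (v ord0 ord0, \row_j v ord0 (lift ord0 j)).

Lemma rV_consK : cancel rV_cons rV_uncons.
Proof.
move=> [x v]; rewrite /rV_uncons !mxE unlift_none; congr (_, _).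
by apply/rowP => j; rewrite !mxE liftK.
Qed.

Lemma measurable_rV_cons : measurable_fun setT rV_cons.
Proof.
apply: measurable_fun_rV => i; case: (unliftP ord0 i) => [j ->|->].
  rewrite (_ : _ \o _ = rV_coord j \o snd).
    by apply: measurableT_comp => //; exact: measurable_rV_coord.
  by apply/funext => p; rewrite /rV_coord /= mxE liftK.
rewrite (_ : _ \o _ = fst)//.
by apply/funext => p; rewrite /rV_coord /= mxE unlift_none.
Qed.

Lemma measurable_rV_uncons : measurable_fun setT rV_uncons.
Proof.
apply/measurable_fun_pair => /=; first exact: (measurable_rV_coord ord0).
apply: measurable_fun_rV => i.
rewrite (_ : _ \o _ = rV_coord (lift ord0 i)); first exact: measurable_rV_coord.
by apply/funext => v; rewrite /rV_coord /= mxE.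
Qed.

Definition rV_cons_measure (m : {sigma_finite_measure set 'rV[R]_n -> \bar R}) :=
  pushforward (lebesgue_measure \x m)%E rV_cons.

Variable m : {sigma_finite_measure set 'rV[R]_n -> \bar R}.

Let cons_measure0 : rV_cons_measure m set0 = 0%E.
Proof. by rewrite /rV_cons_measure /pushforward preimage_set0 measure0. Qed.

Let cons_measure_ge0 A : (0 <= rV_cons_measure m A)%E.
Proof.
exact: (measure_ge0 [the {measure set _ -> \bar R} of (lebesgue_measure \x m)%E]).
Qed.

Let cons_measure_sigma_additive : semi_sigma_additive (rV_cons_measure m).
Proof.
pose mu := [the {measure set _ -> \bar R} of (lebesgue_measure \x m)%E].
move=> F mF tF mUF; rewrite /rV_cons_measure /pushforward preimage_bigcup.
apply: (@measure_semi_sigma_additive _ _ _ mu).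
- by move=> k; rewrite -[X in measurable X]setTI; exact: measurable_rV_cons.
- apply/trivIsetP => /= i j _ _ ij; rewrite -preimage_setI.
  by move/trivIsetP : tF => /(_ _ _ _ _ ij) ->//; rewrite preimage_set0.
- rewrite -preimage_bigcup -[X in measurable X]setTI.
  exact: measurable_rV_cons.
Qed.

HB.instance Definition _ := isMeasure.Build _ _ _ (rV_cons_measure m)
  cons_measure0 cons_measure_ge0 cons_measure_sigma_additive.

Let cons_measure_sigma_finite : sigma_finite setT (rV_cons_measure m).
Proof.
have [F TF Foo] := sigma_finite_prod lebesgue_measure m.
exists (fun k => rV_uncons @^-1` F k).
  by rewrite -preimage_bigcup -TF preimage_setT.
move=> k; have [mFk Fkoo] := Foo k; split.
  by rewrite -[X in measurable X]setTI; exact: measurable_rV_uncons.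
rewrite /rV_cons_measure /pushforward -comp_preimage.
rewrite (_ : rV_uncons \o rV_cons = idfun) ?preimage_id//.
by apply/funext => p /=; rewrite rV_consK.
Qed.

HB.instance Definition _ := Measure_isSigmaFinite.Build _ _ _
  (rV_cons_measure m) cons_measure_sigma_finite.

End rV_cons.

Fixpoint lebesgue_rV {R : realType} (n : nat) :
    {sigma_finite_measure set 'rV[R]_n -> \bar R} :=
  if n is n'.+1 then
    [the {sigma_finite_measure set _ -> \bar R} of
       rV_cons_measure (lebesgue_rV n')]
  else [the {sigma_finite_measure set _ -> \bar R} of \d_(0 : 'rV[R]_0)].

Section euclidean.
Context {R : realType} {d : nat}.
Implicit Types x y : 'rV[R]_d.

Definition edot x y : R := \sum_(i < d) x ord0 i * y ord0 i.

Definition enorm x : R := Num.sqrt (edot x x).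

End euclidean.

(** * Bernstein functions

    Functions on the open half-line are represented by functions on [R]; only
    their values on [`]0, +oo[] matter. *)

Section bernstein.
Context {R : realType}.
Implicit Types (f m Phi : R -> R) (a b : R).

Definition smooth_pos f :=
  forall n x, 0 < x -> derivable (f^`(n))%classic x 1.

Definition bernstein Phi :=
  [/\ smooth_pos Phi,
      forall x, 0 < x -> 0 <= Phi x &
      forall n x, (0 < n)%N -> 0 < x -> (-1) ^+ n * (Phi^`(n))%classic x <= 0].

Definition completely_monotone m :=
  smooth_pos m /\ forall n x, 0 < x -> 0 <= (-1) ^+ n * (m^`(n))%classic x.

Definition levy_khintchine Phi a b
    (mu : {measure set (measurableTypeR R) -> \bar R}) :=
  [/\ 0 <= a, 0 <= b,
      (\int[mu]_(t in `]0%R, +oo[) (Num.min 1 t)%:E < +oo)%E &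
      forall z, 0 < z ->
        (Phi z)%:E = ((a + b * z)%:E +
          \int[mu]_(t in `]0%R, +oo[) (1 - expR (- (z * t)))%:E)%E].

Definition complete_bernstein_rep Phi a b m :=
  [/\ bernstein Phi, completely_monotone m &
      exists mu : {measure set (measurableTypeR R) -> \bar R},
        levy_khintchine Phi a b mu /\
        forall A : set (measurableTypeR R), measurable A -> A `<=` `]0, +oo[ ->
          mu A = (\int[lebesgue_measure]_(t in A) (m t)%:E)%E].

Definition B0 : set (R -> R) :=
  [set Phi | exists m, complete_bernstein_rep Phi 0 0 m].

(* By uniqueness of the Lévy measure and continuity of completely monotone
   functions, the density is determined on ]0, +oo[ for Phi in B0. *)
Definition levy_density Phi : R -> R :=
  xget (cst 0) [set m | complete_bernstein_rep Phi 0 0 m].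

Definition jump_kernel (d : nat) Phi (r : R) : \bar R :=
  (\int[lebesgue_measure]_(t in `]0%R, +oo[)
     ((4 * pi * t) `^ (- (d%:R / 2)) * expR (- (r ^+ 2 / (4 * t))) *
      levy_density Phi t)%:E)%E.

End bernstein.

Notation L2 mu := (LfunType mu (lee1n 2)).

(** * Unbounded operators in a real L^2 space

    Elements of [L2 mu] are square-integrable functions, not classes, so an
    operator is given by its graph, closed under a.e. equality, and equality
    of values is a.e. equality. *)

Section operators.
Context {disp : measure_display} {T : measurableType disp} {R : realType}.
Variable mu : {measure set T -> \bar R}.
Implicit Types (A : L2 mu -> L2 mu -> Prop) (u v f g : L2 mu).

Definition L2dot u v : R := \int[mu]_x (u x * v x).

Definition L2norm u : R := fine ('N[mu]_2%:E [EFin \o u]).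

Definition op_dom A : set (L2 mu) := [set u | exists f, A u f].

Definition densely_defined A :=
  forall f (e : R), 0 < e -> exists2 u, op_dom A u & L2norm (f - u) < e.

Definition adjoint A v g := forall u f, A u f -> L2dot f v = L2dot u g.

(* A single-valued: consequence of the two clauses. *)
Definition self_adjoint A :=
  densely_defined A /\ forall v g, A v g <-> adjoint A v g.

(* [B] is the bounded inverse of [lam - A]: [lam *: u - A u = f] has, up to
   a.e. equality, the unique solution [u = B f]. *)
Definition is_resolvent A (lam : R) (B : L2 mu -> L2 mu) :=
  (forall f u, A u (lam *: u - f) <-> u = B f %[ae mu]) /\
  exists C : R, forall f, L2norm (B f) <= C * L2norm f.

Definition strong_resolvent_cvg (A_ : nat -> L2 mu -> L2 mu -> Prop) A :=
  [/\ forall n, self_adjoint (A_ n), self_adjoint A &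
      exists (lam : R) (B_ : nat -> L2 mu -> L2 mu) (B : L2 mu -> L2 mu),
      [/\ forall n, is_resolvent (A_ n) lam (B_ n),
          is_resolvent A lam B &
          forall u, op_dom A u -> L2norm (B_ n u - B u) @[n --> \oo] --> 0]].

Definition form_operator (D : set (L2 mu)) (a : L2 mu -> L2 mu -> R) u f :=
  D u /\ forall w, D w -> a u w = L2dot f w.

End operators.

Section schrodinger.
Context {R : realType} {d : nat}.
Implicit Types (Phi : R -> R) (V : 'rV[R]_d -> \bar R).
Implicit Types (u w : L2 (lebesgue_rV d : {measure set 'rV[R]_d -> \bar R})).

Local Notation mu := (lebesgue_rV d : {measure set 'rV[R]_d -> \bar R}).

Definition seminorm2 Phi u : \bar R :=
  (2^-1%:E * \int[mu]_h \int[mu]_x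
     ((`|u (x + h) - u x| ^+ 2)%:E * jump_kernel d Phi (enorm h)))%E.

Definition H_Phi Phi : set (L2 mu) := [set u | (seminorm2 Phi u < +oo)%E].

Definition energy Phi u w : R :=
  2^-1 * fine (\int[mu]_y \int[mu]_x
     (((u y - u x) * (w y - w x))%:E * jump_kernel d Phi (enorm (x - y))))%E.

(* The Fourier integral of exp (- t Phi(|xi|^2)); the imaginary part
   - sin (x . xi) of the character integrates to 0 by symmetry. *)
Definition heat_kernel Phi (t : R) (x : 'rV[R]_d) : R :=
  (2 * pi) ^- d *
  \int[mu]_xi (cos (edot x xi) * expR (- (t * Phi (enorm xi ^+ 2)))).

Definition green1 Phi (x : 'rV[R]_d) : \bar R :=
  (\int[lebesgue_measure]_(t in `]0%R, +oo[)
     (expR (- t) * heat_kernel Phi t x)%:E)%E.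

Definition kato Phi V :=
  [/\ measurable_fun setT V, forall x, (0 <= V x)%E &
      ereal_sup (range (fun x : 'rV[R]_d =>
        (\int[mu]_(y in [set y | (enorm (x - y)%R < delta)%R])
            (green1 Phi (x - y)%R * V y))%E)) @[delta --> 0^'+] --> 0%E].

Definition kato_dec Phi V :=
  kato Phi (V^\-)%E /\
  forall K : set 'rV[R]_d, compact K ->
    kato Phi (fun x => ((\1_K x)%:E * V^\+ x)%E).

Definition potential_energy V u w : \bar R :=
  (\int[mu]_x (V x * (u x * w x)%:E))%E.

(* When V u^2 has infinite positive and negative parts the library's integral
   is -oo, so the condition always means integrability of V u^2. *)
Definition form_dom Phi V : set (L2 mu) :=
  [set u | H_Phi Phi u /\ (`|potential_energy V u u| < +oo)%E].

Definition schrodinger_form Phi V u w : R :=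
  energy Phi u w + fine (potential_energy V u w).

Definition schrodinger Phi V :=
  form_operator (form_dom Phi V) (schrodinger_form Phi V).

End schrodinger.

(* Main.v *)
From HB Require Import structures.
Require Import Defs.
From mathcomp Require Import all_boot all_order all_algebra.
From mathcomp Require Import all_classical all_reals all_analysis.
From mathcomp Require Import measurable_realfun.
From mathcomp Require Import ring lra zify.

(** Let [c >= 0] bound all negative parts from above. Then [V + c] is almost
    everywhere a non-negative function [W], and the form of [Phi(-Delta) + V],
    shifted by [c], is the closed form [q u = [u]^2 + int W u^2]. For such a form
    the functional [q w + |w|^2 - 2 <f, w>] has a unique minimiser
    ([form_riesz]), the value at [f] of the bounded inverse of the shifted operator
    plus one. Up to sign the resolvents at [- (c + 1)] are thus minimisers
    ([form_operator_resolvent]), and their convergence is a matter of comparing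
    minima.

    Let [u_n] and [u] be the minimisers for [W_n] and [W]. Two bounds are needed.
    From below, the potentials [inf_(m >= n) W_m] increase to [W]; the
    corresponding minima increase, which forces the minimisers [v_n] to form a
    Cauchy sequence, and by Fatou's lemma the limit of the minima is the minimum
    for [W] ([form_solve_energy_cvg]). From above, the limit superior hypothesis
    says that the fixed vector [u] is asymptotically no worse for [W_n] than for
    [W]. Since the excess of [u] in the [n]-th functional is its squared form
    distance to [u_n] ([form_solve_min]), the two bounds give [|u - u_n| -> 0]
    ([form_solve_cvg], [schrodinger_resolvent_cvg]).

    Self-adjointness requires the form domain to be dense in [L2]
    ([form_operator_self_adjoint], [form_domain_dense]). It contains the tents,
    Lipschitz functions of bounded support: their energy is finite because
    [min(1, |h|^2) j(|h|)] is integrable ([jump_kernel_levy]), and their potential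
    energy is finite because [W] is locally integrable. A function orthogonal to
    all tents has vanishing integrals over boxes, hence is 0.

    Local integrability of [W] is where the Kato condition enters. It bounds the
    integral of the positive part of [V], cut off outside a compact set, against
    the Green kernel over small balls, so a positive lower bound of that kernel
    near the origin is enough ([kato_cube],
    [green1_lower]). The Green kernel is a time integral of heat kernels, which
    are positive near the origin for times between 1 and 2 by continuity
    ([heat_kernel_lower]) and non-negative everywhere and at all times
    ([heat_kernel_ge0]). The latter is the positivity of the Fourier integral of
    [exp (- t Phi (|xi|^2))]: truncating the small jumps turns it into a constant
    times the exponential of a mixture [psi] of Gaussians in [xi], and positivity
    of Fourier integrals passes from Gaussians ([wave_gauss_nonneg]) to mixtures,
    powers of [psi], the exponential series and limits
    ([heat_multiplier_wave_nonneg]). *)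

Import Order.TTheory GRing.Theory Num.Theory.
Import numFieldNormedType.Exports.

Local Open Scope classical_set_scope.
Local Open Scope ring_scope.

Set Implicit Arguments.
Unset Strict Implicit.
Unset Printing Implicit Defensive.

(** * Square-integrable functions and lower limits *)

Section liminf.
Local Open Scope ereal_scope.
Context {R : realType}.
Implicit Types (u v : (\bar R)^nat).

Lemma limn_einf_le_cvg u v (l : \bar R) :
  (forall n, u n <= v n) -> v @ \oo --> l -> limn_einf u <= l.
Proof.
move=> uv vl; rewrite limn_einf_lim.
rewrite -(cvg_lim (@ereal_hausdorff R) vl).
apply: lee_lim; [exact: is_cvg_einfs|by apply/cvg_ex; exists l|].
apply: nearW => n; apply: le_trans (uv n).
by apply: ereal_inf_lbound; exists n => /=.
Qed.

Lemma limn_einfD_ge u v : (forall n, 0 <= u n) -> (forall n, 0 <= v n) ->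
  limn_einf u + limn_einf v <= limn_einf (u \+ v).
Proof.
move=> u0 v0; rewrite !limn_einf_lim.
have e0 w : (forall n, 0 <= w n) -> 0 <= limn (einfs w).
  move=> w0; apply: lime_ge; first exact: is_cvg_einfs.
  by apply: nearW => n; apply: le_ereal_inf_tmp => _ [m _ <-].
rewrite -limeD; first last.
- by rewrite ge0_adde_def ?inE ?e0.
- exact: is_cvg_einfs.
- exact: is_cvg_einfs.
apply: lee_lim.
- apply: is_cvgeD; [by rewrite ge0_adde_def ?inE ?e0| |]; exact: is_cvg_einfs.
- exact: is_cvg_einfs.
apply: nearW => n; apply: le_ereal_inf_tmp => _ [m /= nm <-].
by apply: leeD; apply: ereal_inf_lbound; exists m.
Qed.

End liminf.

Section square_integrable.
Context d (Z : measurableType d) {R : realType}.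
Variable nu : {measure set Z -> \bar R}.
Implicit Types f g : Z -> R.

(** Extended-real valued on purpose: membership in a form domain is expressed
    by finiteness of such an integral. *)
Definition sqint f : \bar R := (\int[nu]_z ((f z) ^+ 2)%:E)%E.

Lemma sqint_ge0 f : (0 <= sqint f)%E.
Proof. by apply: integral_ge0 => x _; rewrite lee_fin sqr_ge0. Qed.

Lemma measurable_sqr f : measurable_fun setT f ->
  measurable_fun setT (fun x => ((f x) ^+ 2)%:E).
Proof. by move=> mf; apply/measurable_EFinP; exact: measurable_funX. Qed.

Lemma sqint_integrable f : measurable_fun setT f -> (sqint f < +oo)%E ->
  nu.-integrable setT (fun x => ((f x) ^+ 2)%:E).
Proof.
move=> mf sf; apply/integrableP; split; first exact: measurable_sqr.
rewrite (eq_integral (fun x => ((f x) ^+ 2)%:E))// => x _.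
by rewrite gee0_abs// lee_fin sqr_ge0.
Qed.

Lemma mul_integrable f g : measurable_fun setT f -> measurable_fun setT g ->
  (sqint f < +oo)%E -> (sqint g < +oo)%E ->
  nu.-integrable setT (EFin \o (fun x => f x * g x)).
Proof.
move=> mf mg sf sg.
apply: (@le_integrable _ _ _ nu setT measurableT _
  ((fun x => ((f x) ^+ 2)%:E) \+ (fun x => ((g x) ^+ 2)%:E))%E).
- by apply/measurable_EFinP; apply: measurable_funM.
- move=> x _; rewrite [leRHS](_ : _ = (f x ^+ 2 + g x ^+ 2)%:E); last first.
    by rewrite /= ger0_norm// addr_ge0// sqr_ge0.
  rewrite lee_fin.
  rewrite normrM -(real_normK (num_real (f x))) -(real_normK (num_real (g x))).
  by have := sqr_ge0 (`|f x| - `|g x|); have := sqr_ge0 (`|f x| + `|g x|); nra.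
- by apply: integrableD => //; exact: sqint_integrable.
Qed.

Lemma sqintE f : measurable_fun setT f -> (sqint f < +oo)%E ->
  sqint f = (\int[nu]_z (f z * f z))%:E.
Proof.
move=> mf sf; rewrite /Rintegral fineK; last first.
  apply: integrable_fin_num => //; exact: mul_integrable.
by apply: eq_integral => x _; rewrite expr2.
Qed.

Lemma sqintZ a f : measurable_fun setT f ->
  sqint (fun x => a * f x) = ((a ^+ 2)%:E * sqint f)%E.
Proof.
move=> mf; rewrite /sqint -ge0_integralZl//; first last.
- by rewrite lee_fin sqr_ge0.
- by move=> x _; rewrite lee_fin sqr_ge0.
- exact: measurable_sqr.
by apply: eq_integral => x _; rewrite exprMn EFinM.
Qed.

Lemma sqintD_lty f g : measurable_fun setT f -> measurable_fun setT g ->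
  (sqint f < +oo)%E -> (sqint g < +oo)%E ->
  (sqint (fun x => f x + g x)%R < +oo)%E.
Proof.
move=> mf mg sf sg.
apply: (@le_lt_trans _ _
  (\int[nu]_x ((2 * f x ^+ 2)%R%:E + (2 * g x ^+ 2)%R%:E)))%E; last first.
  rewrite ge0_integralD//.
  - rewrite (eq_integral (fun x => 2%:E * ((f x) ^+ 2)%:E)%E)//.
    rewrite [X in (_ + X)%E](eq_integral (fun x => 2%:E * ((g x) ^+ 2)%:E)%E)//.
    rewrite !ge0_integralZl//; try exact: measurable_sqr.
    + by rewrite lte_add_pinfty// lte_mul_pinfty.
    + by move=> x _; rewrite lee_fin sqr_ge0.
    + by move=> x _; rewrite lee_fin sqr_ge0.
  - by move=> x _; rewrite lee_fin mulr_ge0// sqr_ge0.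
  - by apply/measurable_EFinP; apply: measurable_funM => //; exact: measurable_funX.
  - by move=> x _; rewrite lee_fin mulr_ge0// sqr_ge0.
  - by apply/measurable_EFinP; apply: measurable_funM => //; exact: measurable_funX.
apply: ge0_le_integral => //.
- by move=> x _; rewrite lee_fin sqr_ge0.
- by apply: measurable_sqr; exact: measurable_funD.
- by apply: emeasurable_funD; apply/measurable_EFinP; apply: measurable_funM => //;
    exact: measurable_funX.
- move=> x _; rewrite -EFinD lee_fin.
  by have := sqr_ge0 (f x - g x); nra.
Qed.

(** The pointwise lower limit, to which the integral form of Fatou's lemma
    applies, agrees with [f] almost everywhere. *)
Lemma fatou_ae (f_ : nat -> Z -> \bar R) (f : Z -> \bar R) :
  (forall n, measurable_fun setT (f_ n)) -> measurable_fun setT f ->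
  (forall n x, (0 <= f_ n x)%E) -> (forall x, (0 <= f x)%E) ->
  (\forall x \ae nu, f_ n x @[n --> \oo] --> f x) ->
  (\int[nu]_x f x <= limn_einf (fun n => \int[nu]_x f_ n x))%E.
Proof.
move=> mf_ mf f_0 f0 fcvg.
rewrite (_ : (\int[nu]_x f x = \int[nu]_x limn_einf (f_ ^~ x))%E).
  exact: (fatou nu measurableT mf_ (fun n x _ => f_0 n x)).
apply: ge0_ae_eq_integral => //.
- rewrite (_ : (fun _ => _) = (fun x => limn (einfs (f_ ^~ x)))).
    apply: (emeasurable_fun_cvg (fun n x => einfs (f_ ^~ x) n)).
      by move=> m; exact: measurable_fun_einfs.
    by move=> x _; exact: is_cvg_einfs.
  by apply/funext => x; rewrite limn_einf_lim.
- move=> x _; rewrite limn_einf_lim.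
  apply: lime_ge; first exact: is_cvg_einfs.
  by apply: nearW => n; apply: le_ereal_inf_tmp => _ [m _ <-].
- apply: filterS fcvg => x fx _.
  by rewrite is_cvg_limn_einfE; [rewrite (cvg_lim _ fx)|apply/cvg_ex; exists (f x)].
Qed.

Lemma sqint_fatou (f_ : nat -> Z -> R) f :
  (forall n, measurable_fun setT (f_ n)) -> measurable_fun setT f ->
  (\forall x \ae nu, f_ n x @[n --> \oo] --> f x) ->
  (sqint f <= limn_einf (fun n => sqint (f_ n)))%E.
Proof.
move=> mf_ mf fcvg; apply: fatou_ae.
- by move=> n; exact: measurable_sqr.
- exact: measurable_sqr.
- by move=> n x; rewrite lee_fin sqr_ge0.
- by move=> x; rewrite lee_fin sqr_ge0.
apply: filterS fcvg => x fx; apply: cvg_EFin; first by apply: nearW.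
rewrite [X in X @ _ --> _](_ : _ = (fun n => f_ n x ^+ 2)); last by [].
by under eq_fun do rewrite expr2; rewrite expr2; exact: cvgM.
Qed.

End square_integrable.

Section L2_space.
Context d (T : measurableType d) {R : realType}.
Variable mu : {measure set T -> \bar R}.
Implicit Types u v w : L2 mu.

Lemma L2_measurable u : measurable_fun setT u.
Proof. exact: measurable_funPT. Qed.

Lemma L2_sqint u : (sqint mu u < +oo)%E.
Proof.
have /integrableP[_] := Lfun2_integrable_sqr (LfunP u).
rewrite (eq_integral (fun x => ((u x) ^+ 2)%:E))// => x _ /=.
by rewrite ger0_norm ?sqr_ge0.
Qed.

Lemma sqint_Lfun (f : T -> R) : measurable_fun setT f ->
  (sqint mu f < +oo)%E -> f \in Lfun mu 2%:E.
Proof.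
move=> mf sf; apply/andP; split; rewrite inE//= /finite_norm unlock.
rewrite poweR_lty// (eq_integral (fun x => ((f x) ^+ 2)%:E))// => x _ /=.
by rewrite powR_mulrn// real_normK// num_real.
Qed.

Definition L2_of (f : T -> R) (mf : measurable_fun setT f)
  (sf : (sqint mu f < +oo)%E) : L2 mu :=
  Lfun_Sub (lee1n 2) (sqint_Lfun mf sf).

Lemma L2_addE u v x : (u + v) x = u x + v x. Proof. by []. Qed.
Lemma L2_oppE u x : (- u) x = - u x. Proof. by []. Qed.
Lemma L2_scaleE a u x : (a *: u) x = a * u x. Proof. by []. Qed.

Lemma L2_mul_integrable u v : mu.-integrable setT (EFin \o (fun x => u x * v x)).
Proof.
by apply: mul_integrable; try exact: L2_measurable; exact: L2_sqint.
Qed.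

Lemma L2dotC u v : L2dot u v = L2dot v u.
Proof. by apply: eq_Rintegral => x _; rewrite mulrC. Qed.

Lemma L2dotDl u v w : L2dot (u + v) w = L2dot u w + L2dot v w.
Proof.
rewrite /L2dot -RintegralD//; try exact: L2_mul_integrable.
by apply: eq_Rintegral => x _; rewrite L2_addE mulrDl.
Qed.

Lemma L2dotZl a u w : L2dot (a *: u) w = a * L2dot u w.
Proof.
rewrite /L2dot -RintegralZl//; try exact: L2_mul_integrable.
by apply: eq_Rintegral => x _; rewrite L2_scaleE mulrA.
Qed.

Lemma L2dotNl u w : L2dot (- u) w = - L2dot u w.
Proof. by rewrite -scaleN1r L2dotZl mulN1r. Qed.

Lemma L2dotBl u v w : L2dot (u - v) w = L2dot u w - L2dot v w.
Proof. by rewrite L2dotDl L2dotNl. Qed.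

Lemma L2dotDr u v w : L2dot w (u + v) = L2dot w u + L2dot w v.
Proof. by rewrite L2dotC L2dotDl !(L2dotC w). Qed.

Lemma L2dotZr a u w : L2dot w (a *: u) = a * L2dot w u.
Proof. by rewrite L2dotC L2dotZl (L2dotC w). Qed.

Lemma L2dotNr u w : L2dot w (- u) = - L2dot w u.
Proof. by rewrite L2dotC L2dotNl (L2dotC w). Qed.

Lemma L2dotBr u v w : L2dot w (u - v) = L2dot w u - L2dot w v.
Proof. by rewrite L2dotDr L2dotNr. Qed.

Definition L2dotE :=
  (L2dotDl, L2dotDr, L2dotBl, L2dotBr, L2dotNl, L2dotNr, L2dotZl, L2dotZr).

Lemma L2dot_ge0 u : 0 <= L2dot u u.
Proof. by apply: Rintegral_ge0 => x _; rewrite -expr2 sqr_ge0. Qed.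

Lemma L2_sqintE u : sqint mu u = (L2dot u u)%:E.
Proof. by rewrite sqintE//; exact: L2_sqint. Qed.

Lemma L2normE u : L2norm u = Num.sqrt (L2dot u u).
Proof.
rewrite /L2norm unlock.
rewrite (eq_integral (fun x => ((u x) ^+ 2)%:E)); last first.
  by move=> x _ /=; rewrite powR_mulrn// real_normK// num_real.
by rewrite -[X in (X `^ _)%E]/(sqint mu u) L2_sqintE /= powR12_sqrt// L2dot_ge0.
Qed.

Lemma L2dot_eq0 u : L2dot u u = 0 -> \forall x \ae mu, u x = 0.
Proof.
move=> u0; have : L2norm u = 0 by rewrite L2normE u0 sqrtr0.
by move/fine_Lnormr_eq0; apply: filterS => x /(_ Logic.I).
Qed.

Lemma ae_eq_L2dot u v w : u = v %[ae mu] -> L2dot u w = L2dot v w.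
Proof.
move=> uv; congr fine; apply: ae_eq_integral => //.
- by have /integrableP[] := L2_mul_integrable u w.
- by have /integrableP[] := L2_mul_integrable v w.
by apply: filterS uv => x /(_ Logic.I) /= uvx _; rewrite uvx.
Qed.

Lemma L2dot_lim (f : L2 mu) (u_ : nat -> L2 mu) u :
  (fun n => L2dot (u_ n - u) (u_ n - u)) @ \oo --> 0 ->
  (fun n => L2dot f (u_ n)) @ \oo --> L2dot f u.
Proof.
(* 2 |<f, z>| <= e <f, f> + <z, z> / e *)
move=> uu; apply/cvgrPdist_le => e e0.
pose c := 1 + L2dot f f; have c0 : 0 < c by rewrite ltr_pwDl// L2dot_ge0.
have ec0 : 0 < e / c by rewrite divr_gt0.
near=> n.
have : L2dot (u_ n - u) (u_ n - u) <= e * (e / c).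
  rewrite -[leLHS]ger0_norm ?L2dot_ge0// -[X in `|X|]subr0 distrC.
  by near: n; apply: ((@cvgrPdist_le _ _ _ _ _ _ _).1 uu); rewrite mulr_gt0.
rewrite -[L2dot f u - _]opprB -L2dotBr normrN.
move: (u_ n - u) => z zs.
have P t : 0 <= t ^+ 2 * L2dot f f + 2 * t * L2dot f z + L2dot z z.
  have := L2dot_ge0 (t *: f + z).
  by rewrite !L2dotE (L2dotC z f); lra.
have k1 := P (e / c); have k2 := P (- (e / c)).
have ff : (e / c) * L2dot f f <= e.
  by rewrite mulrAC ler_pdivrMr// ler_pM2l// /c lerDr.
have : (e / c) * (2 * `|L2dot f z|) <= (e / c) * (e + e).
  apply: (@le_trans _ _ ((e / c) * ((e / c) * L2dot f f) + L2dot z z)).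
    by case: (ger0P (L2dot f z)) => _; nra.
  rewrite mulrDr; apply: lerD; last by rewrite mulrC.
  by rewrite ler_pM2l.
by rewrite ler_pM2l//; lra.
Unshelve. all: by end_near. Qed.

Lemma L2normN u : L2norm (- u) = L2norm u.
Proof. by rewrite !L2normE L2dotNl L2dotNr opprK. Qed.

End L2_space.

(** * Almost everywhere limits of fast Cauchy sequences *)

Section fast_cauchy.
Context d (T : measurableType d) {R : realType}.
Variable mu : {measure set T -> \bar R}.

Lemma cvgn_geometric_increments (v : R^nat) (M : R) :
  (forall n, `|v n.+1 - v n| <= M / 2 ^+ n) -> cvgn v.
Proof.
move=> vM.
have cg : cvgn (series (geometric M 2^-1)).
  by apply: is_cvg_geometric_series; rewrite ger0_norm ?invr_ge0// invf_lt1// ltr1n.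
have : cvgn (series (telescope v)).
  apply: (@normed_cvg R R^o); apply: (@series_le_cvg _ _ (geometric M 2^-1)) => //= n.
    rewrite mulr_ge0 ?exprn_ge0 ?invr_ge0//.
    by have := le_trans (normr_ge0 _) (vM 0%N); rewrite expr0 divr1.
  by rewrite /telescope /= exprVn.
move=> /cvg_ex[l vl]; apply/cvg_ex; exists (l + v 0%N).
rewrite [X in X @ _](_ : _ = series (telescope v) \+ cst (v 0%N)); last first.
  by apply/funext => n; rewrite /= telescopeK subrK.
exact: (cvgD vl (cvg_cst _)).
Qed.

(** Completeness of [L2] for sequences whose increments are so small that the
    sequence itself, rather than a subsequence, converges almost everywhere, as
    lower semicontinuity of forms requires. Fatou's lemma bounds the distance to
    the limit. *)
Lemma L2_fast_cauchy (u_ : nat -> L2 mu) (C : R) :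
  (forall n m, (n <= m)%N ->
     L2dot (u_ n - u_ m) (u_ n - u_ m) <= C / 16 ^+ n) ->
  exists u : L2 mu, (\forall x \ae mu, u_ n x @[n --> \oo] --> u x) /\
    (fun n => L2dot (u_ n - u) (u_ n - u)) @ \oo --> 0.
Proof.
move=> uC.
have C0 : 0 <= C.
  by have := le_trans (L2dot_ge0 _) (uC 0%N 0%N (leqnn _)); rewrite expr0 divr1.
(* The weight 4^n is half-way between 1 and 16^n: the integrals of [f n] remain
   summable, while a finite sum of the [f n x] still forces increments of
   size 2^-n at [x]. *)
pose f n x := ((4 ^+ n * (u_ n.+1 x - u_ n x) ^+ 2)%R%:E : \bar R).
have f0 n x : (0 <= f n x)%E.
  by rewrite lee_fin mulr_ge0 ?sqr_ge0 ?exprn_ge0.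
have mf n : measurable_fun setT (f n).
  apply/measurable_EFinP; apply: measurable_funM => //.
  by apply: measurable_funX; apply: measurable_funB; exact: L2_measurable.
have intf n : (\int[mu]_x f n x <= (C / 4 ^+ n)%:E)%E.
  rewrite /f; under eq_integral do rewrite EFinM.
  rewrite ge0_integralZl//; first last.
  - by move=> x _; rewrite lee_fin sqr_ge0.
  - apply: measurable_sqr; apply: measurable_funB; exact: L2_measurable.
  rewrite -[X in (_ * X)%E]/(sqint mu (u_ n.+1 - u_ n)) L2_sqintE -EFinM lee_fin.
  have := uC n n.+1 (leqnSn n).
  rewrite -opprB !L2dotNl !L2dotNr opprK => h.
  apply: (@le_trans _ _ (4 ^+ n * (C / 16 ^+ n))); first by rewrite ler_wpM2l.
  rewrite (_ : 16 = 4 * 4 :> R); last by ring.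
  by rewrite exprMn invfM mulrCA mulVKf// expf_neq0.
have sumf : (\int[mu]_x (\sum_(n <oo) f n x) < +oo)%E.
  rewrite integral_nneseries//.
  have := @cvg_geometric_eseries_half R (C * 2) 0.
  move=> /(cvg_lim (@ereal_hausdorff R)) geo.
  apply: (@le_lt_trans _ _ (C * 2 / 2 ^+ 0)%:E); last exact: ltry.
  rewrite -geo; apply: lee_nneseries => [n _ _|n _]; first exact: integral_ge0.
  apply: le_trans (intf n) _; rewrite lee_fin addn1 natrX exprS invfM mulrA mulfK//.
  rewrite ler_wpM2l// lef_pV2 ?posrE ?exprn_gt0//.
  by rewrite lerXn2r ?nnegrE// ler_nat.
have aefin : \forall x \ae mu, (\sum_(n <oo) f n x < +oo)%E.
  have : mu.-integrable setT (fun x => \sum_(n <oo) f n x)%E.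
    apply/integrableP; split.
      by apply: ge0_emeasurable_sum => //.
    under eq_integral do rewrite gee0_abs ?nneseries_ge0//.
    exact: sumf.
  move/(integrable_ae measurableT); apply: filterS => x /(_ Logic.I).
  by rewrite ge0_fin_numE// nneseries_ge0.
have aecvg : \forall x \ae mu, cvgn (fun n => u_ n x).
  apply: filterS aefin => x fx.
  pose S := fine (\sum_(n <oo) f n x)%E.
  have S0 : (0 <= \sum_(n <oo) f n x)%E by apply: nneseries_ge0.
  apply: (@cvgn_geometric_increments _ (Num.sqrt S)) => n.
  have fS : (f n x <= S%:E)%E.
    rewrite /S fineK ?ge0_fin_numE//.
    apply: le_trans (nneseries_lim_ge n.+1 _); last by [].
    by rewrite big_nat_recr//= leeDr// sume_ge0.
  rewrite -sqrtr_sqr ler_pdivlMr ?exprn_gt0// -[X in _ * X]ger0_norm ?exprn_ge0//.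
  rewrite -[X in _ * X]sqrtr_sqr -sqrtrM ?sqr_ge0// ler_wsqrtr//.
  by rewrite -exprM mulnC exprM -natrX mulrC -lee_fin.
pose u x := fine (limn_esup (fun n => (u_ n x)%:E)).
have uE x : cvgn (fun n => u_ n x) -> u_ n x @[n --> \oo] --> u x.
  move=> cx; rewrite /u is_cvg_limn_esupE.
    by rewrite EFin_lim//.
  have /cvg_ex[l ul] := cx; apply/cvg_ex; exists l%:E.
  by apply: cvg_EFin => //; exact: nearW.
have mu_u : measurable_fun setT u.
  apply: measurableT_comp => //; apply: measurable_fun_limn_esup => n.
  by apply/measurable_EFinP; exact: L2_measurable.
have aeu : \forall x \ae mu, u_ n x @[n --> \oo] --> u x.
  by apply: filterS aecvg => x; exact: uE.
have un n : (sqint mu (fun x => (u_ n x - u x)%R) <= (C / 16 ^+ n)%:E)%E.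
  apply: (@le_trans _ _ (limn_einf (fun m => sqint mu (u_ n - u_ (m + n)%N)))).
    apply: sqint_fatou.
    + by move=> m; exact: L2_measurable.
    + by apply: measurable_funB => //; exact: L2_measurable.
    + apply: filterS aeu => x ux.
      by apply: cvgB; [exact: cvg_cst|move: ux; rewrite -(cvg_shiftn n)].
  apply: limn_einf_le_cvg; last exact: cvg_cst.
  move=> m; have := uC n (m + n)%N (leq_addl _ _).
  by rewrite -lee_fin -L2_sqintE; exact.
have su : (sqint mu u < +oo)%E.
  rewrite (_ : u = fun x => (u_ 0%N x + (- 1) * (u_ 0%N x - u x))%R); last first.
    by apply/funext => x; ring.
  have mB : measurable_fun setT (fun x => u_ 0%N x - u x).
    by apply: measurable_funB => //; exact: L2_measurable.
  apply: sqintD_lty => //.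
  - exact: measurable_funM.
  - exact: L2_sqint.
  - by rewrite sqintZ// sqrrN expr1n mul1e; apply: le_lt_trans (un 0%N) _; rewrite ltry.
exists (L2_of mu_u su); split => //.
have un' n : L2dot (u_ n - L2_of mu_u su) (u_ n - L2_of mu_u su) <= C / 16 ^+ n.
  by rewrite -lee_fin -L2_sqintE; exact: un.
apply: (@squeeze_cvgr _ _ _ _ (cst 0) (fun n => C * (16^-1) ^+ n)).
- by apply: nearW => n; rewrite L2dot_ge0 /= exprVn un'.
- exact: cvg_cst.
- rewrite -(mulr0 C); apply: cvgM; first exact: cvg_cst.
  by apply: cvg_expr; rewrite ger0_norm// invf_lt1// ltr1n.
Qed.

End fast_cauchy.

(** * Closed quadratic forms *)

Section closed_forms.
Context d (T : measurableType d) {R : realType}.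
Variable mu : {measure set T -> \bar R}.

(** A closed non-negative quadratic form [q], with values in [[0, +oo]] and
    domain [q < +oo], together with its polarisation [b], which is meaningful
    on that domain only. Closedness is stated as lower semicontinuity along
    almost everywhere convergent sequences: this is what Fatou's lemma provides
    for integral forms, it is stable under sums, and it suffices for the
    existence of minimisers because fast Cauchy sequences converge almost
    everywhere. *)
Record closed_form (q : L2 mu -> \bar R) (b : L2 mu -> L2 mu -> R) : Prop := {
  cf_ge0 : forall u, (0 <= q u)%E;
  cf_fin : forall u, (q u < +oo)%E -> q u = (b u u)%:E;
  cf_dom0 : (q 0%R < +oo)%E;
  cf_domD : forall u v, (q u < +oo)%E -> (q v < +oo)%E -> (q (u + v)%R < +oo)%E;
  cf_domZ : forall a u, (q u < +oo)%E -> (q (a *: u)%R < +oo)%E;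
  cf_C : forall u v, b u v = b v u;
  cf_Dl : forall u v w, (q u < +oo)%E -> (q v < +oo)%E -> (q w < +oo)%E ->
    b (u + v) w = b u w + b v w;
  cf_Zl : forall a u w, (q u < +oo)%E -> (q w < +oo)%E ->
    b (a *: u) w = a * b u w;
  cf_lsc : forall (u_ : nat -> L2 mu) (u : L2 mu),
    (\forall x \ae mu, u_ n x @[n --> \oo] --> u x) ->
    (q u <= limn_einf (q \o u_))%E }.

Lemma closed_formD q1 b1 q2 b2 : closed_form q1 b1 -> closed_form q2 b2 ->
  closed_form (q1 \+ q2)%E (fun u v => b1 u v + b2 u v).
Proof.
move=> H1 H2.
have dom u : ((q1 \+ q2) u < +oo)%E -> (q1 u < +oo)%E /\ (q2 u < +oo)%E.
  move=> quoo; split; apply: le_lt_trans quoo.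
    by rewrite leeDl// (cf_ge0 H2).
  by rewrite leeDr// (cf_ge0 H1).
split.
- by move=> u; rewrite adde_ge0 ?(cf_ge0 H1) ?(cf_ge0 H2).
- by move=> u /dom[u1 u2]; rewrite EFinD -(cf_fin H1)// -(cf_fin H2).
- by rewrite lte_add_pinfty ?(cf_dom0 H1) ?(cf_dom0 H2).
- move=> u v /dom[? ?] /dom[? ?].
  by rewrite lte_add_pinfty ?(cf_domD H1) ?(cf_domD H2).
- by move=> a u /dom[? ?]; rewrite lte_add_pinfty ?(cf_domZ H1) ?(cf_domZ H2).
- by move=> u v; rewrite (cf_C H1) (cf_C H2).
- by move=> u v w /dom[? ?] /dom[? ?] /dom[? ?]; rewrite (cf_Dl H1)// (cf_Dl H2)//; ring.
- by move=> a u w /dom[? ?] /dom[? ?]; rewrite (cf_Zl H1)// (cf_Zl H2)//; ring.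
- move=> u_ u uu; apply: (@le_trans _ _ (limn_einf (q1 \o u_) + limn_einf (q2 \o u_))%E).
    by apply: leeD; [exact: cf_lsc H1 _ _ uu|exact: cf_lsc H2 _ _ uu].
  apply: limn_einfD_ge => n; [exact: cf_ge0 H1 _|exact: cf_ge0 H2 _].
Qed.

(** Both the energy and the potential term have this shape, with [Z] the
    product space, respectively the space itself. *)
Lemma square_closed_form d' (Z : measurableType d') (nu : {measure set Z -> \bar R})
    (L : (T -> R) -> Z -> R) :
  (forall u, measurable_fun setT u -> measurable_fun setT (L u)) ->
  (forall u v z, L (fun x => u x + v x) z = L u z + L v z) ->
  (forall a u z, L (fun x => a * u x) z = a * L u z) ->
  (forall (u_ : nat -> T -> R) u, (\forall x \ae mu, u_ n x @[n --> \oo] --> u x) ->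
     \forall z \ae nu, L (u_ n) z @[n --> \oo] --> L u z) ->
  closed_form (fun u => sqint nu (L u)) (fun u v => \int[nu]_z (L u z * L v z)).
Proof.
move=> mL LD LZ Lae.
have mLu (u : L2 mu) : measurable_fun setT (L u) by apply: mL; exact: L2_measurable.
have LDE (u v : L2 mu) : L (u + v) = (fun z => L u z + L v z).
  by apply/funext => z; exact: LD.
have LZE a (u : L2 mu) : L (a *: u) = (fun z => a * L u z).
  by apply/funext => z; exact: LZ.
have L2Z (a : R) (u : L2 mu) : (sqint nu (L u) < +oo)%E ->
    (sqint nu (L (a *: u)%R) < +oo)%E.
  by move=> Lu; rewrite LZE sqintZ// sqintE// -EFinM ltry.
split.
- by move=> u; exact: sqint_ge0.
- by move=> u Lu; exact: sqintE.
- rewrite -(scale0r (0 : L2 mu)) LZE sqintZ// expr0n /= mul0e//.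
- by move=> u v Lu Lv; rewrite LDE sqintD_lty.
- exact: L2Z.
- by move=> u v; apply: eq_Rintegral => z _; rewrite mulrC.
- move=> u v w Lu Lv Lw; rewrite -RintegralD//; try exact: mul_integrable.
  by apply: eq_Rintegral => z _; rewrite LDE mulrDl.
- move=> a u w Lu Lw; rewrite -RintegralZl//; try exact: mul_integrable.
  by apply: eq_Rintegral => z _; rewrite LZE mulrA.
- by move=> u_ u uu; apply: sqint_fatou => //; exact: Lae.
Qed.

Section form_theory.
Variables (q : L2 mu -> \bar R) (b : L2 mu -> L2 mu -> R).
Hypothesis H : closed_form q b.
Local Notation D u := (q u%R < +oo)%E.

Lemma cf_b_ge0 u : D u -> 0 <= b u u.
Proof. by move=> Du; rewrite -lee_fin -(cf_fin H)// (cf_ge0 H). Qed.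

Lemma cf_domN u : D u -> D (- u).
Proof. by move=> Du; rewrite -scaleN1r (cf_domZ H). Qed.

Lemma cf_domB u v : D u -> D v -> D (u - v).
Proof. by move=> Du Dv; rewrite (cf_domD H)// cf_domN. Qed.

Lemma cf_Dr u v w : D u -> D v -> D w -> b w (u + v) = b w u + b w v.
Proof. by move=> *; rewrite (cf_C H) (cf_Dl H)// !(cf_C H w). Qed.

Lemma cf_Zr a u w : D u -> D w -> b w (a *: u) = a * b w u.
Proof. by move=> *; rewrite (cf_C H) (cf_Zl H)// !(cf_C H w). Qed.

Lemma cf_sqD u v a : D u -> D v ->
  b (u + a *: v) (u + a *: v) = b u u + 2 * a * b u v + a ^+ 2 * b v v.
Proof.
move=> Du Dv; have Dav : D (a *: v) by exact: (cf_domZ H).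
have Duv : D (u + a *: v) by exact: (cf_domD H).
rewrite (cf_Dl H)// !cf_Dr// !(cf_Zl H)// !cf_Zr// (cf_C H v u); ring.
Qed.

Lemma cf_Bl u v w : D u -> D v -> D w -> b (u - v) w = b u w - b v w.
Proof.
move=> Du Dv Dw; rewrite -scaleN1r (cf_Dl H)//; last exact: (cf_domZ H).
by rewrite (cf_Zl H)// mulN1r.
Qed.

Lemma cf_sqB u v : D u -> D v -> b (u - v) (u - v) = b u u - 2 * b u v + b v v.
Proof. by move=> Du Dv; rewrite -scaleN1r cf_sqD//; ring. Qed.

(** A null function has form value 0 by lower semicontinuity along the constant
    sequence 0, so that forms only depend on classes of functions. *)
Lemma ae_eq_cf (u v : L2 mu) : u = v %[ae mu] -> D u -> D v /\ forall w, D w -> b u w = b v w.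
Proof.
move=> uv Du.
have z0 (z : L2 mu) : (\forall x \ae mu, z x = 0) -> q z = 0%E.
  move=> zx; apply/eqP; rewrite eq_le (cf_ge0 H) andbT.
  have q0 : q 0%R = 0%E.
    rewrite (cf_fin H) ?(cf_dom0 H)// -(scale0r (0 : L2 mu)).
    by rewrite (cf_Zl H) ?(cf_dom0 H) ?scale0r ?(cf_dom0 H)// mul0r.
  apply: le_trans (cf_lsc H (u_ := fun=> 0) _) _.
    by apply: filterS zx => x ->; exact: cvg_cst.
  rewrite (_ : _ \o _ = cst 0%E); last by apply/funext => n /=.
  by apply: (@limn_einf_le_cvg _ _ (cst 0%E)) => //; exact: cvg_cst.
have qvu : q (v - u) = 0%E.
  apply: z0; apply: filterS uv => x /(_ Logic.I) h. by rewrite (_ : (v - u) x = v x - u x)// h subrr.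
have Dvu : D (v - u) by rewrite qvu.
have Dv : D v by rewrite -(subrK u v) (cf_domD H).
split => // w Dw; apply/eqP; rewrite eq_sym -subr_eq0 -cf_Bl//; apply/eqP.
have b0 : b (v - u) (v - u) = 0 by have := cf_fin H Dvu; rewrite qvu => -[].
have P (t : R) : 0 <= b w w + 2 * t * b w (v - u).
  by have := cf_b_ge0 (cf_domD H Dw (cf_domZ H t Dvu)); rewrite cf_sqD// b0 mulr0 addr0.
rewrite (cf_C H); apply/eqP; case: (eqVneq (b w (v - u)) 0) => [//|n0].
have := P (- (b w w + 1) / (2 * b w (v - u))).
rewrite (_ : 2 * _ * _ = - (b w w + 1)); first lra.
by field.
Qed.

(** The first-order condition at a minimiser: test [t := - A / (B + 1)]. *)
Lemma quadratic_ge0_eq0 (A B : R) : 0 <= B ->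
  (forall t, 0 <= 2 * t * A + t ^+ 2 * B) -> A = 0.
Proof.
move=> B0 /(_ (- A / (B + 1))); set t := _ / _.
have tA : t * (B + 1) = - A by rewrite divfK// gt_eqF// ltr_wpDl.
have A2 : A = - t * (B + 1) by rewrite mulNr tA opprK.
rewrite [in X in X -> _]A2 => h; have t2 := sqr_ge0 t.
have : t ^+ 2 = 0 by nra.
by move/eqP; rewrite sqrf_eq0 A2 => /eqP ->; rewrite oppr0 mul0r.
Qed.

(** The solution minimises [J w = q w + |w|^2 - 2 <f, w>]. The parallelogram law
    makes a minimising sequence Cauchy in [L2], and lower semicontinuity of [q]
    shows that its limit is in the domain and is a minimiser; the equation is
    then the first-order condition. *)
Theorem form_riesz (f : L2 mu) :
  exists u, D u /\ forall w, D w -> b u w + L2dot u w = L2dot f w.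
Proof.
pose J w := b w w + L2dot w w - 2 * L2dot f w.
pose S := [set J w | w in [set w | D w]].
have JS w : D w -> S (J w) by move=> Dw; exists w.
have S0 : S !=set0 by exists (J 0); apply: JS; exact: cf_dom0 H.
have Slb : has_lbound S.
  exists (- L2dot f f) => _ [w Dw <-]; rewrite /J.
  have := L2dot_ge0 (w - f); rewrite !L2dotE (L2dotC w f).
  by have := cf_b_ge0 Dw; lra.
pose m := inf S.
have mJ w : D w -> m <= J w by move=> Dw; apply: ge_inf => //; exact: JS.
have /choice[w_ w_P] : forall n, exists w, D w /\ J w <= m + (16^-1) ^+ n.
  move=> n; have e0 : 0 < (16^-1 : R) ^+ n by rewrite exprn_gt0.
  have [_ [w Dw <-] Jw] := inf_adherent e0 (conj S0 Slb).
  by exists w; split => //; exact: ltW.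
have wD n : D (w_ n) by have [] := w_P n.
have cauchy n k : (n <= k)%N -> L2dot (w_ n - w_ k) (w_ n - w_ k) <= 4 / 16 ^+ n.
  move=> nk.
  (* the midpoint of the two quasi-minimisers *)
  have Dm : D (w_ n + 1 *: w_ k) by apply: (cf_domD H) => //; exact: (cf_domZ H).
  have := mJ _ (cf_domZ H 2^-1 Dm).
  have [_ Jn] := w_P n; have [_ Jk] := w_P k.
  have kn : (16^-1 : R) ^+ k <= 16^-1 ^+ n.
    by apply: ler_wiXn2l => //; rewrite invf_le1// ler1n.
  rewrite -exprVn; move: Jn Jk; rewrite /J.
  rewrite (cf_Zl H) ?cf_Zr ?cf_sqD//; try exact: (cf_domZ H).
  have := cf_b_ge0 (cf_domB (wD n) (wD k)); rewrite cf_sqB//.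
  rewrite !L2dotE (L2dotC (w_ k) (w_ n)); nra.
have [u [aeu wu]] := L2_fast_cauchy cauchy.
have fw (g : L2 mu) := L2dot_lim (f := g) wu.
have qu : (q u <= (m + 2 * L2dot f u - L2dot u u)%:E)%E.
  apply: le_trans (cf_lsc H aeu) _.
  apply: (@limn_einf_le_cvg _ _ (fun n =>
    (m + (16^-1) ^+ n + 2 * L2dot f (w_ n) - (L2dot (w_ n - u) (w_ n - u) + 2 * L2dot u (w_ n) - L2dot u u))%:E)).
    move=> n /=; have [Dn Jn] := w_P n; rewrite (cf_fin H)// lee_fin.
    by move: Jn; rewrite /J !L2dotE (L2dotC (w_ n) u); lra.
  apply: cvg_EFin; first exact: nearW.
  rewrite [X in _ --> X](_ : _ = m + 0 + 2 * L2dot f u - (0 + 2 * L2dot u u - L2dot u u)); last ring.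
  apply: cvgB; first apply: cvgD; first apply: cvgD.
  - exact: cvg_cst.
  - by apply: cvg_expr; rewrite ger0_norm// invf_lt1// ltr1n.
  - by apply: cvgM; [exact: cvg_cst|exact: fw].
  apply: cvgB; last exact: cvg_cst.
  by apply: cvgD => //; apply: cvgM; [exact: cvg_cst|exact: fw].
have Du : D u by apply: le_lt_trans qu _; rewrite ltry.
exists u; split => // w Dw.
have Ju : J u <= m by move: qu; rewrite (cf_fin H)// lee_fin /J; lra.
apply/eqP; rewrite -subr_eq0; apply/eqP.
apply: (@quadratic_ge0_eq0 _ (b w w + L2dot w w)).
  by rewrite addr_ge0 ?cf_b_ge0 ?L2dot_ge0.
move=> t; have Dtw : D (u + t *: w) by apply: (cf_domD H) => //; exact: (cf_domZ H).
have := le_trans Ju (mJ _ Dtw).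
rewrite /J cf_sqD// !L2dotE (L2dotC w u); lra.
Qed.

(** The resolvent of the operator of the form, at -1 and up to sign. *)
Definition form_solve (f : L2 mu) : L2 mu := projT1 (cid (form_riesz f)).

Lemma form_solve_dom f : D (form_solve f).
Proof. by rewrite /form_solve; case: cid => u []. Qed.

Lemma form_solveE f w : D w ->
  b (form_solve f) w + L2dot (form_solve f) w = L2dot f w.
Proof. by rewrite /form_solve; case: cid => u [? h] Dw /=; exact: h. Qed.

(** Completing the square: [- <f, form_solve f>] is the minimum of the
    functional, and the excess of [w] is its squared form distance to the
    minimiser. All comparisons between different forms rest on this identity. *)
Lemma form_solve_min f w : D w ->
  b w w + L2dot w w - 2 * L2dot f w =
  b (w - form_solve f) (w - form_solve f) +
  L2dot (w - form_solve f) (w - form_solve f) - L2dot f (form_solve f).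
Proof.
move=> Dw; have Ds := form_solve_dom f.
have h1 := form_solveE f Dw; have h2 := form_solveE f Ds.
rewrite cf_sqB// !L2dotE (cf_C H w) (L2dotC w (form_solve f)); lra.
Qed.

Lemma form_solve_le f : L2dot (form_solve f) (form_solve f) <= L2dot f f.
Proof.
have Ds := form_solve_dom f.
have := form_solveE f Ds; have := cf_b_ge0 Ds.
have := L2dot_ge0 (form_solve f - f).
by rewrite !L2dotE (L2dotC (form_solve f) f); lra.
Qed.

Lemma form_unique (u : L2 mu) : D u -> (b u u + L2dot u u <= 0) -> \forall x \ae mu, u x = 0.
Proof.
move=> Du h; apply: L2dot_eq0; apply/eqP; rewrite eq_le L2dot_ge0 andbT.
by have := cf_b_ge0 Du; lra.
Qed.

End form_theory.

End closed_forms.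

(** * Operators and resolvents of closed forms *)

Section form_operators.
Context d (T : measurableType d) {R : realType}.
Variable mu : {measure set T -> \bar R}.

Lemma L2normD_le (u v : L2 mu) : L2norm (u + v) <= L2norm u + L2norm v.
Proof. exact: ler_LnormD. Qed.

Lemma L2norm_le (u v : L2 mu) : L2dot u u <= L2dot v v -> L2norm u <= L2norm v.
Proof. by move=> uv; rewrite !L2normE ler_wsqrtr. Qed.

Section operator_of_form.
Variables (q : L2 mu -> \bar R) (b : L2 mu -> L2 mu -> R).
Hypothesis H : closed_form q b.
Variables (D : set (L2 mu)) (a : L2 mu -> L2 mu -> R) (c : R).
Hypothesis DE : forall u, D u <-> (q u < +oo)%E.
Hypothesis aE : forall u w, D u -> D w -> a u w = b u w - c * L2dot u w.
Hypothesis D_dense :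
  forall f (e : R), 0 < e -> exists2 u, D u & L2norm (f - u) < e.

Local Notation A := (form_operator D a).
Local Notation G := (form_solve H).

(** Since [a] is [b] minus [c] times the inner product, adding [(c + 1) u] on both
    sides turns the equation of the operator into the one that [form_solve] solves. *)
Lemma form_operatorP u g : A u g <->
  D u /\ forall w, D w -> b u w + L2dot u w = L2dot (g + (c + 1) *: u) w.
Proof.
split=> -[Du h]; split => // w Dw; have := h _ Dw; rewrite aE// !L2dotE; lra.
Qed.

Lemma form_operator_uniq u (f : L2 mu) :
  (D u /\ forall w, D w -> b u w + L2dot u w = L2dot f w) <-> u = G f %[ae mu].
Proof.
have DG : (q (G f) < +oo)%E := form_solve_dom H f.
split=> [[Du h]|uG].
  have Dz : (q (u - G f)%R < +oo)%E by apply: (cf_domB H) => //; exact/DE.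
  have : \forall x \ae mu, (u - G f) x = 0.
    apply: (form_unique H Dz); rewrite (cf_Bl H)//; last exact/DE.
    rewrite L2dotBl; have := h _ ((DE _).2 Dz).
    by have := form_solveE H f Dz; lra.
  apply: filterS => x; rewrite L2_addE L2_oppE => /eqP.
  by rewrite subr_eq0 => /eqP.
have [Du h] := ae_eq_cf H (ae_eq_sym uG) DG.
split; first exact/DE.
move=> w /DE Dw; rewrite -h// (ae_eq_L2dot _ uG).
exact: form_solveE.
Qed.

Lemma form_operator_resolvent :
  is_resolvent A (- (c + 1)) (fun f => - G f).
Proof.
split; last first.
  exists 1 => f; rewrite mul1r; apply: L2norm_le.
  by rewrite L2dotNl L2dotNr opprK form_solve_le.
move=> f u; rewrite form_operatorP.
have -> : - (c + 1) *: u - f + (c + 1) *: u = - f.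
  by rewrite addrAC -scalerDl addNr scale0r add0r.
rewrite form_operator_uniq.
have NG : G (- f) = - G f %[ae mu].
  apply/ae_eq_sym/form_operator_uniq; split.
    by apply/DE; apply: (cf_domN H); exact: (form_solve_dom H).
  move=> w /DE Dw; rewrite -scaleN1r (cf_Zl H)//; last exact: (form_solve_dom H).
  by rewrite L2dotZl L2dotNl -(form_solveE H f Dw); lra.
split => uG; first exact: ae_eq_trans uG NG.
exact: ae_eq_trans uG (ae_eq_sym NG).
Qed.

(** Density of the form domain [D] is upgraded to density of the operator domain
    by replacing [w] in [D] by [u = (n + 1) (n + 1 + A)^-1 w], obtained by solving
    with the form [q + n |.|^2]; the squared distance to [w] is at most
    [q w / (4 (n + 1))]. *)
Lemma form_operator_densely_defined : densely_defined A.
Proof.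
move=> f e e0; have e20 : 0 < e / 2 by rewrite divr_gt0.
have [w /DE Dw fw] := D_dense f e20.
(* the factor 4 comes from b(u, w - u) <= b(w, w) / 4 *)
have [n wn] : exists n : nat, b w w / (4 * (n%:R + 1)) < (e / 2) ^+ 2.
  exists (Num.bound (b w w / (e / 2) ^+ 2)).
  have := unstable.ltr_bound (b w w / (e / 2) ^+ 2).
  move: (_%:R) (ler0n R (Num.bound (b w w / (e / 2) ^+ 2))) => k k0 wk.
  have e2 : 0 < (e / 2) ^+ 2 by rewrite exprn_gt0.
  have {}wk : b w w < k * (e / 2) ^+ 2 by rewrite -ltr_pdivrMr.
  rewrite ltr_pdivrMr ?mulr_gt0 ?ltr_wpDl//.
  by have := cf_b_ge0 H Dw; nra.
have n0 : 0 <= (n%:R : R) by rewrite ler0n.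
have Hs := @square_closed_form _ _ R mu _ _ mu (fun u x => Num.sqrt n%:R * u x).
have {}Hs : closed_form (fun u => sqint mu (fun x => (Num.sqrt n%:R * u x)%R))
    (fun u v : L2 mu => n%:R * L2dot u v).
  have -> : (fun u v : L2 mu => n%:R * L2dot u v) = (fun u v : L2 mu =>
     \int[mu]_z (Num.sqrt n%:R * u z * (Num.sqrt n%:R * v z))).
    apply/funext => u; apply/funext => v.
    rewrite /L2dot -RintegralZl//; last exact: L2_mul_integrable.
    by apply: eq_Rintegral => x _; rewrite mulrACA -expr2 sqr_sqrtr.
  apply: Hs.
  - by move=> u mu_; exact: measurable_funM.
  - by move=> u v z; rewrite mulrDr.
  - by move=> t u z; rewrite mulrCA.
  - move=> u_ u; apply: filterS => x ux.
    by apply: cvgM => //; exact: cvg_cst.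
have [u [Du uE]] := form_riesz (closed_formD H Hs) ((n%:R + 1) *: w).
have {Du} [Du _] : (q u < +oo)%E /\ (sqint mu (fun x => (Num.sqrt n%:R * u x)%R) < +oo)%E.
  split; apply: le_lt_trans Du; first by rewrite leeDl// sqint_ge0.
  by rewrite leeDr// (cf_ge0 H).
have {}uE v : (q v < +oo)%E ->
    b u v + (n%:R + 1) * L2dot u v = (n%:R + 1) * L2dot w v.
  move=> Dv; rewrite -[RHS]L2dotZl -uE; first by lra.
  rewrite lte_add_pinfty// sqintZ; last exact: L2_measurable.
  by rewrite L2_sqintE -EFinM ltry.
exists u.
  exists ((n%:R + 1) *: w - (n%:R + 1 + c) *: u); split; first exact/DE.
  move=> v Dv; rewrite aE//; last exact/DE.
  have := uE v; rewrite !L2dotE => /(_ ((DE v).1 Dv)); lra.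
have Duw : (q (u - w)%R < +oo)%E by exact: (cf_domB H).
have wu : L2norm (w - u) < e / 2.
  rewrite L2normE -[e / 2]ger0_norm ?ltW// -sqrtr_sqr ltr_sqrt ?exprn_gt0//.
  apply: le_lt_trans wn; rewrite ler_pdivlMr ?mulr_gt0 ?ltr_wpDl//.
  have := uE _ Duw; have := cf_b_ge0 H (cf_domD H Du (cf_domZ H (- 2^-1) Dw)).
  have -> : L2dot (w - u) (w - u) = - L2dot (w - u) (u - w).
    by rewrite -[X in _ = - L2dot _ X]opprB L2dotNr opprK.
  rewrite (cf_sqD H)// (cf_C H u (u - w)) (cf_Bl H)// (cf_C H w u) L2dotBl; lra.
rewrite (_ : f - u = (f - w) + (w - u)); last by rewrite addrA subrK.
by apply: le_lt_trans (L2normD_le _ _) _; rewrite [ltRHS]splitr ltrD.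
Qed.

(** If [v] is in the domain of the adjoint with value [g], then [v] agrees with the
    domain element [u0 = G (g + (c + 1) v)]: testing the adjoint relation against
    the elements [G f] gives [<f, v> = <f, u0>] for every [f]. *)
Lemma form_operator_self_adjoint : self_adjoint A.
Proof.
split; first exact: form_operator_densely_defined.
move=> v g; split=> [[Dv vE] u f [Du uE]|adj].
  rewrite -uE// (L2dotC u) -vE// !aE// (cf_C H) (L2dotC u) //.
pose f0 := g + (c + 1) *: v; pose u0 := G f0.
have Du0 : D u0 by apply/DE; exact: (form_solve_dom H).
have Au f : A (G f) (f - (c + 1) *: G f).
  apply/form_operatorP; split; first by apply/DE; exact: (form_solve_dom H).
  by move=> w /DE Dw; rewrite subrK; exact: form_solveE.
have vu0 : v = u0 %[ae mu].
  have : \forall x \ae mu, (v - u0) x = 0.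
    (* [f] is kept opaque while the linear relations are collected *)
    apply: L2dot_eq0; have [f fE] : exists f, f = v - u0 by exists (v - u0).
    have := adj _ _ (Au f).
    have DGf := form_solve_dom H f.
    have := form_solveE H f ((DE u0).1 Du0).
    have := form_solveE H f0 DGf.
    have ff : L2dot f f = L2dot f v - L2dot f u0 by rewrite -L2dotBr -fE.
    rewrite -fE ff -/u0 (cf_C H u0).
    rewrite /f0 !L2dotDl !L2dotNl !L2dotZl (L2dotC u0) (L2dotC g) (L2dotC v).
    move: (b _ _) (L2dot _ u0) (L2dot _ g) (L2dot (G f) v) (L2dot f v) (L2dot f u0) =>  *.
    lra.
  apply: filterS => x; rewrite L2_addE L2_oppE => /eqP.
  by rewrite subr_eq0 => /eqP.
apply/form_operatorP; rewrite form_operator_uniq; exact: vu0.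
Qed.

End operator_of_form.

(** * Convergence of resolvents from convergence of forms *)

Section form_convergence.
Variables (q_ r_ : nat -> L2 mu -> \bar R) (b_ s_ : nat -> L2 mu -> L2 mu -> R).
Variables (q : L2 mu -> \bar R) (b : L2 mu -> L2 mu -> R).
Hypothesis H_ : forall n, closed_form (q_ n) (b_ n).
Hypothesis K_ : forall n, closed_form (r_ n) (s_ n).
Hypothesis H : closed_form q b.
(* [r_ n] is an increasing family of minorants of the forms [q_ n], and [q] is
   its limit in the sense of the lower bound [r_lsc]; the upper bound [q_limsup]
   concerns the [q_ n] themselves and fixed vectors. *)
Hypothesis rq_ : forall n u, (r_ n u <= q_ n u)%E.
Hypothesis r_nd : forall n m u, (n <= m)%N -> (r_ n u <= r_ m u)%E.
Hypothesis rq : forall n u, (r_ n u <= q u)%E.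
Hypothesis r_lsc : forall (N : nat -> nat) (v_ : nat -> L2 mu) (v : L2 mu),
  (forall k, (k <= N k)%N) -> (\forall x \ae mu, v_ k x @[k --> \oo] --> v x) ->
  (q v <= limn_einf (fun k => r_ (N k) (v_ k)))%E.
Hypothesis q_limsup : forall u (e : R), (q u < +oo)%E -> 0 < e ->
  \forall n \near \oo, (q_ n u < q u + e%:E)%E.

Lemma le_form q1 b1 q2 b2 (u : L2 mu) : closed_form q1 b1 -> closed_form q2 b2 ->
  (q1 u <= q2 u)%E -> (q2 u < +oo)%E -> (q1 u < +oo)%E /\ b1 u u <= b2 u u.
Proof.
move=> H1 H2 q12 u2; have u1 := le_lt_trans q12 u2; split => //.
by rewrite -lee_fin -(cf_fin H1)// -(cf_fin H2).
Qed.

(** [<f, form_solve f>] decreases when the form increases, and by how much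
    controls the distance of the two solutions. *)
Lemma le_form_solve q1 b1 q2 b2 (H1 : closed_form q1 b1) (H2 : closed_form q2 b2)
    (f : L2 mu) : (forall u, (q1 u <= q2 u)%E) ->
  L2dot (form_solve H2 f - form_solve H1 f) (form_solve H2 f - form_solve H1 f)
  <= L2dot f (form_solve H1 f) - L2dot f (form_solve H2 f).
Proof.
move=> q12; have D2 := form_solve_dom H2 f.
have [D1 b12] := le_form H1 H2 (q12 _) D2.
have D1s := form_solve_dom H1 f.
have := form_solve_min H1 f D1; have := form_solveE H2 f D2.
by have := cf_b_ge0 H1 (cf_domB H1 D1 D1s); lra.
Qed.

(** The numbers [<f, v_n>] decrease and are bounded below by [<f, u>]; being
    convergent they force [v_n] to be Cauchy. By the lower bound the limit [v]
    satisfies [q v + |v|^2 - 2 <f, v> <= - lim <f, v_n>], so that [v] does at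
    least as well as the minimiser [u], whence [lim <f, v_n> <= <f, u>]. *)
Lemma form_solve_energy_cvg (f : L2 mu) :
  (fun n => L2dot f (form_solve (K_ n) f)) @ \oo --> L2dot f (form_solve H f).
Proof.
pose v_ n := form_solve (K_ n) f; pose al n := L2dot f (v_ n).
pose u := form_solve H f.
have Du : (q u < +oo)%E := form_solve_dom H f.
have al_lb n : L2dot f u <= al n.
  have := le_form_solve (K_ n) H f (rq n).
  by have := L2dot_ge0 (form_solve H f - form_solve (K_ n) f); rewrite /al /v_ /u; lra.
have al_step n m : (n <= m)%N -> L2dot (v_ m - v_ n) (v_ m - v_ n) <= al n - al m.
  by move=> nm; apply: le_form_solve => w; exact: r_nd.
have al_ni : nonincreasing_seq al.
  move=> n m /al_step; have := L2dot_ge0 (v_ m - v_ n); lra.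
have al_cvg : cvgn al.
  by apply: nonincreasing_is_cvgn => //; exists (L2dot f u) => _ [n _ <-].
pose l := limn al.
have al_l : al @ \oo --> l by [].
have l_al n : l <= al n by exact: nonincreasing_cvgn_ge.
have /choice[N NP] k : exists N : nat, (k <= N)%N /\ al N <= l + 1 / 16 ^+ k.
  have e0 : 0 < 1 / 16 ^+ k :> R by rewrite divr_gt0// exprn_gt0.
  have [M _ MP] := (@cvgrPdist_le _ _ _ _ _ _ _).1 al_l _ e0.
  exists (maxn k M); split; first exact: leq_maxl.
  have := MP (maxn k M) (leq_maxr _ _).
  by rewrite ler_norml => /andP[+ _]; lra.
have cauchy k j : (k <= j)%N ->
    L2dot (v_ (N k) - v_ (N j)) (v_ (N k) - v_ (N j)) <= 1 / 16 ^+ k.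
  move=> kj.
  have h : (1 / 16 ^+ j : R) <= 1 / 16 ^+ k.
    by rewrite !div1r lef_pV2 ?posrE ?exprn_gt0// ler_weXn2l// ler1n.
  have [_ Nk] := NP k; have [_ Nj] := NP j.
  have lk := l_al (N k); have lj := l_al (N j).
  case/orP: (leq_total (N k) (N j)) => /al_step; last by lra.
  by rewrite -opprB L2dotNl L2dotNr opprK; lra.
have [v [aev vv]] := L2_fast_cauchy cauchy.
have fv (g : L2 mu) := L2dot_lim (f := g) vv.
have alN : (al \o N) @ \oo --> l.
  apply: (cvg_comp _ _ _ al_l) => A [M _ MA]; exists M => //= n Mn.
  by apply: MA => /=; apply: leq_trans Mn _; have [] := NP n.
have fvl : L2dot f v = l by apply: (cvg_unique (@Rhausdorff R) (fv f) alN).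
have qv : (q v <= (l - L2dot v v)%:E)%E.
  apply: le_trans (r_lsc (fun k => (NP k).1) aev) _.
  apply: (@limn_einf_le_cvg _ _ (fun n =>
    (al (N n) - (L2dot (v_ (N n) - v) (v_ (N n) - v) + 2 * L2dot v (v_ (N n)) - L2dot v v))%:E)).
    move=> n; have Ds := form_solve_dom (K_ (N n)) f.
    rewrite (cf_fin (K_ _) Ds) lee_fin.
    have := form_solveE (K_ (N n)) f Ds; rewrite /al -/(v_ (N n)).
    by rewrite !L2dotE (L2dotC _ v); lra.
  apply: cvg_EFin; first exact: nearW.
  rewrite [X in _ --> X](_ : _ = l - (0 + 2 * L2dot v v - L2dot v v)); last ring.
  apply: cvgB; first exact: alN.
  apply: cvgB; last exact: cvg_cst.
  by apply: cvgD => //; apply: cvgM; [exact: cvg_cst|exact: fv].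
have Dv : (q v < +oo)%E by apply: le_lt_trans qv _; rewrite ltry.
suff -> : L2dot f (form_solve H f) = l by [].
apply/eqP; rewrite eq_le -/u; apply/andP; split.
  by apply: limr_ge => //; exact: nearW.
have := form_solve_min H f Dv; rewrite -/u.
have := cf_b_ge0 H (cf_domB H Dv Du); have := L2dot_ge0 (v - u).
by move: qv; rewrite (cf_fin H)// lee_fin fvl; lra.
Qed.

(** Use the minimiser [u] of the limit functional as a competitor for the [n]-th
    functional: by [form_solve_min] the squared distance of [u] to [u_n] is at most
    [q_n u + |u|^2 - 2 <f, u> + <f, u_n>]. The upper bound replaces [q_n u] by [q u],
    and [<f, u_n> <= <f, v_n>] tends to [<f, u>], so that the right-hand side tends to
    [q u + |u|^2 - <f, u> = 0]. *)
Theorem form_solve_cvg (f : L2 mu) :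
  L2norm (form_solve (H_ n) f - form_solve H f) @[n --> \oo] --> 0.
Proof.
pose u := form_solve H f; pose u_ n := form_solve (H_ n) f.
have Du : (q u < +oo)%E := form_solve_dom H f.
apply/cvgrPdist_le => e e0.
pose e2 := e ^+ 2 / 2; have e20 : 0 < e2 by rewrite divr_gt0// exprn_gt0.
have aln_ := (@cvgrPdist_le _ _ _ _ _ _ _).1 (form_solve_energy_cvg (f := f)) _ e20.
near=> n.
have qn : (q_ n u < q u + e2%:E)%E.
  by near: n; exact: q_limsup.
have aln : L2dot f (form_solve (K_ n) f) <= L2dot f u + e2.
  have : `|L2dot f u - L2dot f (form_solve (K_ n) f)| <= e2.
    by near: n; exact: aln_.
  by rewrite ler_norml; lra.
have Dnu : (q_ n u < +oo)%E.
  by apply: lt_trans qn _; rewrite (cf_fin H)// -EFinD ltry.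
rewrite sub0r normrN ger0_norm; last by rewrite L2normE sqrtr_ge0.
rewrite L2normE; have -> : e = Num.sqrt (e ^+ 2).
  by rewrite sqrtr_sqr ger0_norm// ltW.
apply: ler_wsqrtr; rewrite -/u -/(u_ n).
have Dun : (q_ n (u_ n) < +oo)%E := form_solve_dom (H_ n) f.
move: qn; rewrite (cf_fin H)// (cf_fin (H_ n))// -EFinD lte_fin => bn.
have := le_form_solve (K_ n) (H_ n) f (rq_ n).
have := L2dot_ge0 (form_solve (H_ n) f - form_solve (K_ n) f).
have := form_solve_min (H_ n) f Dnu; have := cf_b_ge0 (H_ n) (cf_domB (H_ n) Dnu Dun).
have := form_solveE H f Du; rewrite -/u -/(u_ n).
rewrite -[u_ n - u]opprB L2dotNl L2dotNr opprK.
have -> : e ^+ 2 = 2 * e2 by rewrite /e2; field.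
lra.
Unshelve. all: by end_near. Qed.

End form_convergence.

End form_operators.

(** * Translation invariance of Lebesgue measure *)

Section lebesgue_line.
Context {R : realType}.
Local Notation leb := (@lebesgue_measure R).

Lemma lebesgue_measure_shift (h : R) (A : set (measurableTypeR R)) :
  measurable A -> leb A = leb ((fun x => x + h) @^-1` A).
Proof.
have mh : measurable_fun [set: measurableTypeR R] (fun x : measurableTypeR R => x + h : measurableTypeR R).
  by apply: measurable_funD.
move: A; apply: (@lebesgue_measure_unique R
  (measure_function_pushforward__canonical__measure_function_Measure leb mh)).
move=> _ [[a b]/= _ <-].
rewrite /pushforward.
rewrite (_ : _ @^-1` _ = `]a - h, b - h]%classic); last first.
  by apply/seteqP; split => x /=; rewrite !in_itv/= ltrBlDr lerBrDr.
rewrite !lebesgue_measure_itv /= !lte_fin ltrBlDr subrK.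
by case: ifPn => // _; rewrite -!EFinB; congr _%:E; ring.
Qed.

Lemma lebesgue_integral_shift (h : R) (f : R -> \bar R) :
  measurable_fun setT f -> (forall x, (0 <= f x)%E) ->
  (\int[leb]_x f (x + h)%R = \int[leb]_x f x)%E.
Proof.
move=> mf f0.
have mh : measurable_fun [set: measurableTypeR R] (fun x : measurableTypeR R => x + h : measurableTypeR R).
  by apply: measurable_funD.
have E := @ge0_integral_pushforward _ _ _ _ R _ mh leb setT f measurableT mf (fun x _ => f0 x).
rewrite preimage_setT in E.
rewrite -[LHS]E; apply: eq_measure_integral => A mA _.
by rewrite [RHS](lebesgue_measure_shift h).
Qed.

End lebesgue_line.

Section lebesgue_space.
Context {R : realType}.

Lemma measurable_rV_add n : measurable_fun setT
  (fun p : 'rV[R]_n * 'rV[R]_n => p.1 + p.2).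
Proof.
apply: measurable_fun_rV => i.
rewrite (_ : _ \o _ = (fun p => rV_coord i p.1 + rV_coord i p.2)); last first.
  by apply/funext => p; rewrite /rV_coord /= mxE.
by apply: measurable_funD; apply: measurableT_comp => //; exact: measurable_rV_coord.
Qed.

Lemma measurable_rV_scale n (a : R) :
  measurable_fun setT (fun p : 'rV[R]_n => a *: p).
Proof.
apply: measurable_fun_rV => i.
rewrite (_ : _ \o _ = (fun p => a * rV_coord i p)); last first.
  by apply/funext => p; rewrite /rV_coord /= mxE.
by apply: measurable_funM => //; exact: measurable_rV_coord.
Qed.

Lemma measurable_rV_fun_add d' (S : measurableType d') n (f g : S -> 'rV[R]_n) :
  measurable_fun setT f -> measurable_fun setT g ->
  measurable_fun setT (fun x => f x + g x).
Proof.
move=> mf mg.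
exact: (measurableT_comp (@measurable_rV_add n) (measurable_fun_pair mf mg)).
Qed.

Lemma measurable_edot d' (S : measurableType d') n (f g : S -> 'rV[R]_n) :
  measurable_fun setT f -> measurable_fun setT g ->
  measurable_fun setT (fun x => edot (f x) (g x)).
Proof.
move=> mf mg; apply: measurable_sum => i; apply: measurable_funM.
  exact: (measurableT_comp (measurable_rV_coord i) mf).
exact: (measurableT_comp (measurable_rV_coord i) mg).
Qed.

Lemma edot_ge0 n (x : 'rV[R]_n) : 0 <= edot x x.
Proof. by apply: sumr_ge0 => i _; rewrite -expr2 sqr_ge0. Qed.

Lemma enorm_sqr n (x : 'rV[R]_n) : enorm x ^+ 2 = edot x x.
Proof. by rewrite sqr_sqrtr// edot_ge0. Qed.

Lemma measurable_sqrt : measurable_fun setT (@Num.sqrt R).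
Proof. by apply: continuous_measurable_fun; exact: sqrt_continuous. Qed.

Lemma measurable_enorm d' (S : measurableType d') n (f : S -> 'rV[R]_n) :
  measurable_fun setT f -> measurable_fun setT (fun x => enorm (f x)).
Proof.
move=> mf; apply: (measurableT_comp measurable_sqrt).
exact: measurable_edot.
Qed.

(** The measure on vectors of size [n.+1] is the image of a product measure. *)
Lemma integral_rVS n (f : 'rV[R]_n.+1 -> \bar R) :
  measurable_fun setT f -> (forall x, (0 <= f x)%E) ->
  (\int[lebesgue_rV n.+1]_x f x =
   \int[lebesgue_measure]_a \int[lebesgue_rV n]_v f (rV_cons (a, v)))%E.
Proof.
move=> mf f0.
have E := @ge0_integral_pushforward _ _ _ _ R _ (@measurable_rV_cons R n)
  (lebesgue_measure \x lebesgue_rV n)%E setT f measurableT mf (fun x _ => f0 x).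
rewrite preimage_setT in E; transitivity (\int[(lebesgue_measure \x lebesgue_rV n)%E]_x (f \o @rV_cons R n) x)%E.
  rewrite -[RHS]E.
  exact: (eq_measure_integral (measure_function_pushforward__canonical__measure_function_Measure
    (lebesgue_measure \x lebesgue_rV n)%E (@measurable_rV_cons R n))).
have mfc := measurableT_comp mf (@measurable_rV_cons R n).
exact: (fubini_tonelli1 _ mfc (fun x => f0 (rV_cons x))).
Qed.

Lemma measurable_rV_shift n (h : 'rV[R]_n) : measurable_fun setT (fun x : 'rV[R]_n => x + h).
Proof. by apply: measurable_rV_fun_add. Qed.

(** By induction on the dimension, peeling off the first coordinate. *)
Theorem integral_rV_shift n (h : 'rV[R]_n) (f : 'rV[R]_n -> \bar R) :
  measurable_fun setT f -> (forall x, (0 <= f x)%E) ->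
  (\int[lebesgue_rV n]_x f (x + h)%R = \int[lebesgue_rV n]_x f x)%E.
Proof.
elim: n h f => [|n IH] h f mf f0.
  apply: eq_integral => x _; congr f.
  by apply/rowP => -[].
have mfh : measurable_fun setT (fun x : 'rV[R]_n.+1 => f (x + h)%R).
  by apply: (measurableT_comp mf); exact: measurable_rV_shift.
rewrite !integral_rVS//.
pose F a := (\int[lebesgue_rV n]_v f (rV_cons (a, v)))%E.
have mfc : measurable_fun setT (f \o @rV_cons R n).
  by apply: (measurableT_comp mf); exact: measurable_rV_cons.
rewrite -(lebesgue_integral_shift (h ord0 ord0) (f := F)); first last.
- by move=> a; apply: integral_ge0.
- exact: (measurable_fun_fubini_tonelli_F (m2 := lebesgue_rV n) _ mfc (fun x => f0 _)).
apply: eq_integral => a _.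
pose h' : 'rV_n := \row_j h ord0 (lift ord0 j).
rewrite /F -[RHS](IH h'); first last.
- by move=> v.
- exact: (measurableT_comp mfc (@pair1_measurable _ _ (measurableTypeR R) 'rV[R]_n ((a + h ord0 ord0 : R) : measurableTypeR R))).
apply: eq_integral => v _; congr f.
apply/rowP => i; rewrite !mxE; case: unliftP => [j ->|->//] /=.
by rewrite !mxE.
Qed.

End lebesgue_space.

(** * Gaussian integrals *)

Section gaussian_integrals.
Context {R : realType}.

Lemma edot_rV_cons n (a : R) (v : 'rV[R]_n) :
  edot (rV_cons (a, v)) (rV_cons (a, v)) = a ^+ 2 + edot v v.
Proof.
rewrite /edot big_ord_recl !mxE unlift_none expr2; congr (_ + _).
by apply: eq_bigr => i _; rewrite !mxE liftK.
Qed.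

(** The normalisation of the normal density of variance [1 / (2 a)]. *)
Lemma integral_gauss_line (a : R) : 0 < a ->
  (\int[lebesgue_measure]_x (expR (- (a * x ^+ 2)))%:E = (Num.sqrt (pi / a))%:E)%E.
Proof.
move=> a0; pose s := Num.sqrt ((2 * a)^-1).
have s2 : s ^+ 2 = (2 * a)^-1 by rewrite sqr_sqrtr// invr_ge0 mulr_ge0// ltW.
have s0 : s != 0 by rewrite gt_eqF// sqrtr_gt0 invr_gt0 mulr_gt0.
have e x : expR (- (a * x ^+ 2)) = Num.sqrt (pi / a) * normal_pdf 0 s x.
  rewrite (normal_pdfE _ s0) /= /normal_peak s2.
  rewrite (_ : (2 * a)^-1 * pi *+ 2 = pi / a); last by field; rewrite gt_eqF.
  rewrite mulVKf; last by rewrite gt_eqF// sqrtr_gt0 divr_gt0// pi_gt0.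
  by rewrite /normal_fun s2 subr0; congr expR; field; rewrite gt_eqF.
under eq_integral do rewrite e EFinM.
rewrite ge0_integralZl//.
- by rewrite integral_normal_pdf mule1.
- by apply/measurable_EFinP; exact: measurable_normal_pdf.
- by move=> x _; rewrite lee_fin normal_pdf_ge0.
Qed.

Lemma measurable_gauss n (a : R) :
  measurable_fun setT (fun x : 'rV[R]_n => expR (- (a * edot x x))).
Proof.
apply: measurableT_comp => //; apply: measurableT_comp => //.
by apply: measurable_funM => //; exact: measurable_edot.
Qed.

Lemma integral_gauss_rV n (a : R) : 0 < a ->
  (\int[lebesgue_rV n]_x (expR (- (a * edot x x)))%:E = (Num.sqrt (pi / a) ^+ n)%:E)%E.
Proof.
move=> a0; elim: n => [|n IH].
  rewrite integral_dirac//.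
    by rewrite diracT mul1e /edot big_ord0 mulr0 oppr0 expR0 expr0.
  by apply/measurable_EFinP; exact: measurable_gauss.
rewrite integral_rVS//; last by apply/measurable_EFinP; exact: measurable_gauss.
rewrite exprS EFinM -IH -integral_gauss_line//.
rewrite -ge0_integralZr//; first last.
- exact: integral_ge0.
- apply/measurable_EFinP; apply: measurableT_comp => //; apply: measurableT_comp => //.
  by apply: measurable_funM => //; exact: measurable_funX.
apply: eq_integral => x _.
rewrite -ge0_integralZl//; last by apply/measurable_EFinP; exact: measurable_gauss.
apply: eq_integral => v _.
by rewrite edot_rV_cons mulrDr opprD expRD EFinM.
Qed.

(** The indicator of [A] is at most [e^(r - |x|^2)]. *)
Lemma lebesgue_rV_bounded n (A : set 'rV[R]_n) (r : R) : measurable A ->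
  (forall x, A x -> edot x x <= r) -> (lebesgue_rV n A < +oo)%E.
Proof.
move=> mA Ar; rewrite -[A]setIT -integral_indic//.
apply: (@le_lt_trans _ _ (\int[lebesgue_rV n]_x (expR r * expR (- (1 * edot x x)))%:E)%E).
  apply: ge0_le_integral => //.
  - by apply/measurable_EFinP; exact: measurable_indic.
  - by apply/measurable_EFinP; apply: measurable_funM => //; exact: measurable_gauss.
  move=> x _; rewrite lee_fin indicE -expRD mul1r.
  case: (boolP (x \in A)) => /= [|_]; last exact: expR_ge0.
  rewrite inE => /Ar h.
  by apply: le_trans (expR_ge1Dx _); rewrite lerDl subr_ge0.
under eq_integral do rewrite EFinM.
rewrite ge0_integralZl//.
- by rewrite integral_gauss_rV// -EFinM ltry.
- by apply/measurable_EFinP; exact: measurable_gauss.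
Qed.

Lemma lebesgue_rV_setT_gt0 n : (0 < lebesgue_rV n [set: 'rV[R]_n])%E.
Proof.
rewrite lt0e measure_ge0 andbT; apply/eqP => m0.
have := @integral_gauss_rV n 1 ltr01.
rewrite null_set_integral//; last first.
  by apply/measurable_EFinP; apply: measurable_funTS; exact: measurable_gauss.
by move=> /eqP; rewrite eqe lt_eqF// exprn_gt0// sqrtr_gt0 divr_gt0// pi_gt0.
Qed.

Lemma lebesgue_rV_coord0 n : lebesgue_rV n.+1 [set x : 'rV[R]_n.+1 | x ord0 ord0 = 0] = 0%E.
Proof.
transitivity ((lebesgue_measure \x lebesgue_rV n)%E ([set 0 : measurableTypeR R] `*` [set: 'rV[R]_n])).
  rewrite /= /rV_cons_measure /pushforward; congr (_ _); apply/seteqP; split=> -[x v] /=.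
    by rewrite mxE unlift_none.
  by rewrite mxE unlift_none => -[].
rewrite product_measure1E//.
by rewrite [X in (X * _)%E](_ : _ = 0%E) ?mul0e//; exact: lebesgue_measure_set1.
Qed.

End gaussian_integrals.

(** * The jump kernel *)

Section density.
Context d (T : measurableType d) {R : realType}.
Variables (nu mu : {measure set T -> \bar R}) (D : set T) (m : T -> R).
Hypothesis mD : measurable D.
Hypothesis mm : measurable_fun D m.
Hypothesis m0 : forall x, D x -> 0 <= m x.
Hypothesis nuE : forall A, measurable A -> A `<=` D ->
  nu A = (\int[mu]_(x in A) (m x)%:E)%E.
Import HBNNSimple.

(** The Levy measure of [Phi] is only known through its values on measurable
    subsets of the half-line; integrals against it are converted into Lebesgue
    integrals by approximation with simple functions. *)
Lemma ge0_integral_density (f : T -> \bar R) : measurable_fun D f ->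
  (forall x, D x -> (0 <= f x)%E) ->
  (\int[nu]_(x in D) f x = \int[mu]_(x in D) (f x * (m x)%:E))%E.
Proof.
move=> mf f0; pose g := nnsfun_approx mD mf.
have mE : measurable_fun D (fun x => (m x)%:E) by exact/measurable_EFinP.
have mg n : measurable_fun D (fun x => (g n x)%:E).
  by apply/measurable_EFinP; apply: measurable_funTS; exact: measurable_funP.
transitivity (limn (fun n => \int[nu]_(x in D) (g n x)%:E))%E.
  rewrite -monotone_convergence//.
  - apply: eq_integral => y /[!inE] yD; apply/esym/cvg_lim => //.
    by apply: cvg_nnsfun_approx.
  - by move=> n y _; rewrite lee_fin.
  - by move=> y _ i j ij; rewrite lee_fin; exact/lefP/nd_nnsfun_approx.
transitivity (limn (fun n => \int[mu]_(x in D) ((g n x)%:E * (m x)%:E)))%E; last first.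
  rewrite -monotone_convergence//.
  - apply: eq_integral => y /[!inE] yD; apply/cvg_lim => //.
    by apply: cvgeZr => //; apply: cvg_nnsfun_approx.
  - by move=> n; exact: emeasurable_funM.
  - by move=> n y Dy; rewrite mule_ge0// lee_fin// m0.
  - move=> y Dy i j ij; rewrite lee_wpmul2r// lee_fin ?m0//.
    exact/lefP/nd_nnsfun_approx.
congr (limn _); apply/funext => n.
under eq_integral do rewrite fimfunE -fsumEFin//.
rewrite ge0_integral_fsum//; last 2 first.
- by move=> y; exact/measurable_EFinP/measurable_funM.
- by move=> y x _; rewrite nnfun_muleindic_ge0.
transitivity (\sum_(k \in range (g n))
    \int[mu]_(x in D) ((k * \1_(g n @^-1` [set k]) x)%:E * (m x)%:E))%E; last first.
  rewrite -ge0_integral_fsum//.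
  - apply: eq_integral => x _; rewrite [in RHS]fimfunE -fsumEFin//.
    rewrite ge0_mule_fsuml// => r; exact: nnfun_muleindic_ge0.
  - by move=> r; apply: emeasurable_funM => //; exact/measurable_EFinP/measurable_funM.
  - by move=> r x Dx; rewrite mule_ge0// ?nnfun_muleindic_ge0// lee_fin m0.
apply: eq_fsbigr => r _.
have mr : measurable (g n @^-1` [set r]) by exact: measurable_sfunP.
rewrite integralZl_indic_nnsfun//.
have [r0|r0] := leP 0 r; last first.
  rewrite preimage_nnfun0// indic0 integral0 mule0.
  by apply/esym/integral0_eq => x _; rewrite mulr0 mul0e.
under [RHS]eq_integral do rewrite EFinM -muleA.
rewrite [RHS]ge0_integralZl//.
- congr (_ * _)%E; rewrite integral_indic// nuE//; last exact: measurableI.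
  rewrite setIC integral_mkcondr; apply: eq_integral => x _.
  by rewrite epatch_indic muleC.
- by apply: emeasurable_funM => //; exact/measurable_EFinP.
- by move=> x Dx; rewrite mule_ge0// lee_fin ?m0.
Qed.

End density.

Section levy_density.
Context {R : realType}.
Variable Phi : R -> R.
Hypothesis Phi_B0 : B0 Phi.
Local Notation leb := (@lebesgue_measure R).

Lemma smooth_pos_measurable (m : R -> R) :
  smooth_pos m -> measurable_fun (`]0, +oo[%classic : set R) m.
Proof.
move=> sm; apply: open_continuous_measurable_fun; first exact: interval_open.
move=> x; rewrite inE /= in_itv/= andbT => x0.
have := sm 0%N x x0; rewrite derive1n0 => /derivable1_diffP.
exact: differentiable_continuous.
Qed.

Lemma levy_densityP : complete_bernstein_rep Phi 0 0 (levy_density Phi).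
Proof. exact: (xgetPex (cst 0) Phi_B0). Qed.

(** The density is meaningful on the open half-line only; extension by 0 gives
    a measurable function on the line, so that integrals over the half-line
    become integrals over [R]. *)
Definition levy0 : R -> R := levy_density Phi \_ (`]0, +oo[%classic : set R).

Lemma levy0E t : levy0 t = if 0 < t then levy_density Phi t else 0.
Proof.
rewrite /levy0 patchE; congr (if _ then _ else _).
by apply/idP/idP; rewrite inE /= in_itv/= andbT.
Qed.

Lemma levy0_ge0 t : 0 <= levy0 t.
Proof.
rewrite levy0E; case: ifPn => // t0.
have [_ [_ cm] _] := levy_densityP.
by have := cm 0%N t t0; rewrite expr0 mul1r derive1n0.
Qed.

Lemma measurable_levy0 : measurable_fun setT levy0.
Proof.
apply/(measurable_restrictT _ _).1; first exact: measurable_itv.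
by apply: smooth_pos_measurable; have [_ []] := levy_densityP.
Qed.

Lemma integral_levy (f : R -> \bar R) :
  (\int[leb]_(t in `]0%R, +oo[) (f t * (levy_density Phi t)%:E) =
   \int[leb]_t (f t * (levy0 t)%:E))%E.
Proof.
rewrite [LHS]integral_mkcond; apply: eq_integral => t _.
rewrite patchE levy0E -(_ : (t \in (`]0, +oo[%classic : set R)) = (0 < t)).
  by case: ifPn => // _; rewrite mule0.
by apply/idP/idP; rewrite inE /= in_itv/= andbT.
Qed.

Lemma levy0_min_lty :
  (\int[leb]_t ((Num.min 1 t)%:E * (levy0 t)%:E) < +oo)%E.
Proof.
have [_ cm [nu [[_ _ nuoo _] nuE]]] := levy_densityP.
rewrite -integral_levy.
rewrite -(@ge0_integral_density _ _ _ nu leb _ _ _ _ _ nuE)//.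
- by apply: smooth_pos_measurable; have [] := cm.
- move=> t; rewrite /= in_itv/= andbT => t0.
  by have [_ cm'] := cm; have := cm' 0%N t t0; rewrite expr0 mul1r derive1n0.
- apply/measurable_EFinP; apply: measurable_funTS.
  by apply: measurable_minr.
- by move=> t; rewrite /= in_itv/= andbT => t0; rewrite lee_fin le_min ler01 ltW.
Qed.

Lemma bernstein_levy z : 0 < z ->
  (Phi z)%:E = (\int[leb]_t ((1 - expR (- (z * t)))%:E * (levy0 t)%:E))%E.
Proof.
have [_ cm [nu [[_ _ nuoo PhiE] nuE]]] := levy_densityP.
move=> z0; rewrite -integral_levy PhiE// mul0r addr0 add0e.
rewrite (@ge0_integral_density _ _ _ nu leb _ _ _ _ _ nuE)//.
- by apply: smooth_pos_measurable; have [] := cm.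
- move=> t; rewrite /= in_itv/= andbT => t0.
  by have [_ cm'] := cm; have := cm' 0%N t t0; rewrite expr0 mul1r derive1n0.
- apply/measurable_EFinP; apply: measurable_funTS; apply: measurable_funB => //.
  apply: measurableT_comp => //; apply: measurableT_comp => //.
- move=> t; rewrite /= in_itv/= andbT => t0.
  by rewrite lee_fin subr_ge0 -expR0 ler_expR oppr_le0 mulr_ge0// ltW.
Qed.

End levy_density.

Section jump_kernel.
Context {R : realType}.
Variables (d : nat) (Phi : R -> R).
Hypothesis Phi_B0 : B0 Phi.
Local Notation leb := (@lebesgue_measure R).
Local Notation jk := (jump_kernel d Phi).

Definition gauss_kernel (t r : R) : R :=
  (4 * pi * t) `^ (- (d%:R / 2)) * expR (- (r ^+ 2 / (4 * t))).

Lemma gauss_kernel_ge0 t r : 0 <= gauss_kernel t r.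
Proof. by rewrite mulr_ge0// ?powR_ge0 ?expR_ge0. Qed.

Lemma jump_kernelE r : jk r = (\int[leb]_t ((gauss_kernel t r)%:E * (levy0 Phi t)%:E))%E.
Proof. by rewrite -integral_levy. Qed.

Lemma jump_kernel_ge0 r : (0 <= jk r)%E.
Proof.
rewrite jump_kernelE integral_ge0// => t _.
by rewrite mule_ge0// lee_fin ?gauss_kernel_ge0 ?levy0_ge0.
Qed.

Lemma measurable_invr : measurable_fun setT (fun x : R => x^-1).
Proof.
rewrite (_ : (fun x : R => x^-1) = (fun x => x * (x ^+ 2) `^ (-1))); last first.
  apply/funext => x; rewrite powR_inv1 ?sqr_ge0//.
  have [->|x0] := eqVneq x 0; first by rewrite invr0 mul0r.
  by field.
apply: measurable_funM => //; apply: (measurableT_comp (measurable_powR _)).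
exact: measurable_funX.
Qed.

Lemma measurable_gauss_kernel :
  measurable_fun setT (fun p : R * R => gauss_kernel p.2 p.1).
Proof.
apply: measurable_funM.
  apply: (measurableT_comp (measurable_powR _)).
  by apply: measurable_funM.
apply: measurableT_comp => //; apply: measurableT_comp => //.
apply: measurable_funM; first exact: measurable_funX.
by apply: (measurableT_comp measurable_invr); apply: measurable_funM.
Qed.

Lemma measurable_jump_kernel : measurable_fun setT jk.
Proof.
rewrite (_ : jk = (fun r => \int[leb]_t ((gauss_kernel t r)%:E * (levy0 Phi t)%:E))%E); last first.
  by apply/funext => r; rewrite jump_kernelE.
apply: (measurable_fun_fubini_tonelli_F (m2 := leb)
  (fun p : R * R => ((gauss_kernel p.2 p.1)%:E * (levy0 Phi p.2)%:E)%E)).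
  apply: emeasurable_funM; first by apply/measurable_EFinP; exact: measurable_gauss_kernel.
  by apply/measurable_EFinP; apply: (measurableT_comp (measurable_levy0 Phi_B0)).
by move=> p; rewrite mule_ge0// lee_fin ?gauss_kernel_ge0 ?levy0_ge0.
Qed.

Lemma gauss_kernelE t r : 0 < t ->
  gauss_kernel t r = (Num.sqrt (4 * pi * t) ^+ d)^-1 * expR (- (r ^+ 2 / (4 * t))).
Proof.
move=> t0; congr (_ * _); rewrite powRN; congr (_^-1).
rewrite [_ / 2]mulrC powRrM powR12_sqrt; last first.
  by rewrite mulr_ge0// ?mulr_ge0// ?pi_ge0// ltW.
by rewrite powR_mulrn// sqrtr_ge0.
Qed.

(** Write [e^-y] as the [N]-th power of [e^(-y/N) <= N / y]. *)
Lemma expRN_le_powN (N : nat) (y : R) : (0 < N)%N -> 0 < y ->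
  expR (- y) <= (N%:R / y) ^+ N.
Proof.
move=> N0 y0; have N0' : 0 < N%:R :> R by rewrite ltr0n.
rewrite expRN -(invrK ((_ / _) ^+ _)) lef_pV2 ?posrE ?expR_gt0 ?invr_gt0 ?exprn_gt0 ?divr_gt0//.
rewrite -exprVn invf_div -[y in leRHS](divfK (lt0r_neq0 N0')) expRM_natr.
rewrite lerXn2r ?nnegrE ?expR_ge0 ?divr_ge0// ?ltW//.
by apply: lt_le_trans (expR_ge1Dx _); rewrite ltrDr.
Qed.

(** Away from the origin the Gaussian kernel vanishes to any order as [t] tends to
    0, and it is bounded for large [t]; hence it is dominated by [min(1, t)], which
    is integrable against the Levy density. *)
Lemma gauss_kernel_le_min (r : R) : 0 < r ->
  exists2 C, 0 <= C & forall t, 0 < t -> gauss_kernel t r <= C * Num.min 1 t.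
Proof.
move=> r0; pose C := (d.+1%:R * 4 / r ^+ 2) ^+ d.+1.
have C0 : 0 <= C by rewrite exprn_ge0// mulr_ge0// ?mulr_ge0// invr_ge0 sqr_ge0.
exists (1 + C); first by rewrite addr_ge0.
move=> t t0; rewrite gauss_kernelE//.
have pi2 : 2 <= pi :> R by exact: pi_ge2.
have st : Num.sqrt t <= Num.sqrt (4 * pi * t) by apply: ler_wsqrtr; nra.
have st0 : 0 < Num.sqrt t by rewrite sqrtr_gt0.
have isd : (Num.sqrt (4 * pi * t) ^+ d)^-1 <= (Num.sqrt t ^+ d)^-1.
  rewrite lef_pV2 ?posrE ?exprn_gt0//; last by apply: lt_le_trans st.
  by rewrite lerXn2r ?nnegrE ?sqrtr_ge0.
have isd0 : 0 <= (Num.sqrt (4 * pi * t) ^+ d)^-1.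
  by rewrite invr_ge0 exprn_ge0 ?sqrtr_ge0.
have [t1|t1] := leP 1 t.
  apply: (@le_trans _ _ (1 * 1)); last by rewrite !mulr1 lerDl.
  apply: ler_pM => //.
    apply: le_trans isd _; rewrite invf_le1 ?exprn_gt0//.
    by rewrite exprn_ege1// -[leLHS]sqrtr1 ler_wsqrtr.
  by rewrite -expR0 ler_expR oppr_le0 mulr_ge0// ?sqr_ge0// invr_ge0 mulr_ge0// ltW.
apply: (@le_trans _ _ ((Num.sqrt t ^+ d)^-1 * (C * t ^+ d.+1))).
  apply: ler_pM => //.
  apply: le_trans (expRN_le_powN (ltn0Sn d) _) _.
    by rewrite divr_gt0 ?exprn_gt0 ?mulr_gt0.
  rewrite /C -exprMn le_eqVlt; apply/orP; left; apply/eqP; congr (_ ^+ _).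
  by field; rewrite !gt_eqF.
rewrite [leRHS]mulrDl mul1r; apply: ler_wpDl; first exact: ltW.
rewrite mulrCA ler_wpM2l//.
have tE : t ^+ d.+1 = Num.sqrt t ^+ d * (Num.sqrt t ^+ d * t).
  by rewrite mulrA -exprMn -expr2 sqr_sqrtr ?ltW// exprSr.
rewrite tE mulKf ?expf_neq0 ?gt_eqF//; apply: ler_piMl; first exact: ltW.
by rewrite exprn_ile1 ?sqrtr_ge0// -[leRHS]sqrtr1 ler_wsqrtr// ltW.
Qed.

Lemma jump_kernel_lty r : 0 < r -> (jk r < +oo)%E.
Proof.
move=> /gauss_kernel_le_min[C C0 gC]; rewrite jump_kernelE.
have mmin : measurable_fun setT (fun t : R => ((Num.min 1 t)%:E * (levy0 Phi t)%:E)%E).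
  apply: emeasurable_funM; apply/measurable_EFinP; last exact: measurable_levy0.
  exact: measurable_minr.
have min0 (t : R) : (0 <= (Num.min 1 `|t|)%:E * (levy0 Phi t)%:E)%E.
  by rewrite mule_ge0// lee_fin ?levy0_ge0// le_min ler01 normr_ge0.
have minE (t : R) : ((Num.min 1 `|t|)%:E * (levy0 Phi t)%:E = (Num.min 1 t)%:E * (levy0 Phi t)%:E)%E.
  rewrite levy0E; case: ifPn => [t0|_]; last by rewrite !mule0.
  by rewrite ger0_norm// ltW.
apply: (@le_lt_trans _ _ (C%:E * \int[leb]_t ((Num.min 1 `|t|)%:E * (levy0 Phi t)%:E))%E).
  rewrite -ge0_integralZl//=; last first.
    by under eq_fun do rewrite minE.
  apply: ge0_le_integral => //.
  - by move=> t _; rewrite mule_ge0// lee_fin ?levy0_ge0 ?gauss_kernel_ge0.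
  - apply: emeasurable_funM; apply/measurable_EFinP; last exact: measurable_levy0.
    exact: (measurableT_comp measurable_gauss_kernel (pair1_measurable r)).
  - by under eq_fun do rewrite minE; exact: measurable_funeM.
  - move=> t _; rewrite muleA; rewrite levy0E; case: ifPn => [t0|_]; last by rewrite !mule0.
    rewrite lee_wpmul2r ?lee_fin//; last by rewrite ger0_norm ?gC// ltW.
    have := levy0_ge0 Phi_B0 t; by rewrite levy0E t0.
rewrite lte_mul_pinfty//.
under eq_integral do rewrite minE.
exact: levy0_min_lty.
Qed.

(** Absorbs the factor [|h|^2] of a second moment into a slightly wider Gaussian. *)
Lemma sqr_expN_le (y : R) : 0 <= y -> y * expR (- (2 * y)) <= expR (- y).
Proof.
move=> y0; rewrite (_ : 2 * y = y + y); last by ring.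
rewrite opprD expRD mulrA ler_piMl ?expR_ge0//.
rewrite expRN ler_pdivrMr ?expR_gt0// mul1r.
by apply: le_trans (expR_ge1Dx _); rewrite lerDr.
Qed.

Lemma measurable_gauss_kernel_rV t :
  measurable_fun setT (fun h : 'rV[R]_d => gauss_kernel t (enorm h)).
Proof.
have := measurableT_comp measurable_gauss_kernel (pair2_measurable t).
by move=> /measurableT_comp; apply; exact: measurable_enorm.
Qed.

(** For [t >= 1] the total mass of the kernel is 1. For [t < 1] the second moment
    is of order [t]: with [y = |h|^2 / (8 t)], the bound [y e^(-2y) <= e^-y] reduces
    it to the mass of the Gaussian at time [2 t]. *)
Lemma gauss_kernel_moment t : 0 < t ->
  (\int[lebesgue_rV d]_h ((Num.min 1 (enorm h ^+ 2) * gauss_kernel t (enorm h))%R%:E)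
   <= (8 * Num.sqrt 2 ^+ d * Num.min 1 t)%:E)%E.
Proof.
move=> t0; have c0 : 0 < 4 * pi * t by rewrite !mulr_gt0// pi_gt0.
have s1 : 1 <= Num.sqrt 2 ^+ d :> R.
  by rewrite exprn_ege1// -[leLHS]sqrtr1 ler_wsqrtr// ler1n.
have [t1|t1] := leP 1 t.
  apply: (@le_trans _ _ 1%E); last first.
    by rewrite lee_fin mulr1 mulr_ege1// ler1n.
  apply: (@le_trans _ _ (\int[lebesgue_rV d]_h ((Num.sqrt (4 * pi * t) ^+ d)^-1%:E *
     (expR (- ((4 * t)^-1 * edot h h)))%:E))%E).
    apply: ge0_le_integral => //.
    - move=> h _; rewrite lee_fin mulr_ge0 ?gauss_kernel_ge0//.
      by rewrite le_min ler01 sqr_ge0.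
    - apply/measurable_EFinP; apply: measurable_funM; last exact: measurable_gauss_kernel_rV.
      by apply: measurable_minr => //; apply: measurable_funX; exact: measurable_enorm.
    - by apply: measurable_funeM; apply/measurable_EFinP; exact: measurable_gauss.
    - move=> h _; rewrite -EFinM lee_fin gauss_kernelE// enorm_sqr -[leRHS]mul1r.
      apply: ler_pM => //.
      + by rewrite le_min ler01 edot_ge0.
      + by rewrite ge_min lexx.
      + by rewrite (mulrC (edot h h)).
  rewrite ge0_integralZl//.
  - rewrite integral_gauss_rV ?invr_gt0 ?mulr_gt0// invrK -EFinM lee_fin.
    rewrite (_ : pi * (4 * t) = 4 * pi * t); last by ring.
    by rewrite mulVf// expf_neq0// gt_eqF// sqrtr_gt0.
  - by apply/measurable_EFinP; exact: measurable_gauss.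
apply: (@le_trans _ _ (\int[lebesgue_rV d]_h ((8 * t * (Num.sqrt (4 * pi * t) ^+ d)^-1)%:E *
     (expR (- ((8 * t)^-1 * edot h h)))%:E))%E).
  apply: ge0_le_integral => //.
  - move=> h _; rewrite lee_fin mulr_ge0 ?gauss_kernel_ge0//.
    by rewrite le_min ler01 sqr_ge0.
  - apply/measurable_EFinP; apply: measurable_funM; last exact: measurable_gauss_kernel_rV.
    by apply: measurable_minr => //; apply: measurable_funX; exact: measurable_enorm.
  - by apply: measurable_funeM; apply/measurable_EFinP; exact: measurable_gauss.
  - move=> h _; rewrite -EFinM lee_fin gauss_kernelE// enorm_sqr.
    set e := edot h h; set s := (_ ^+ d)^-1.
    have s0 : 0 <= s by rewrite invr_ge0 exprn_ge0 ?sqrtr_ge0.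
    have y0 : 0 <= (8 * t)^-1 * e by rewrite mulr_ge0 ?edot_ge0// invr_ge0 mulr_ge0// ltW.
    have := sqr_expN_le y0.
    rewrite (_ : 2 * _ = e / (4 * t)); last by field; rewrite gt_eqF.
    move=> h1; apply: (@le_trans _ _ (e * (s * expR (- (e / (4 * t)))))).
      by rewrite ler_wpM2r ?mulr_ge0 ?expR_ge0// ge_min lexx orbT.
    rewrite (_ : e * _ = 8 * t * s * ((8 * t)^-1 * e * expR (- (e / (4 * t))))).
      by rewrite ler_wpM2l// !mulr_ge0// ltW.
    by field; rewrite gt_eqF.
rewrite ge0_integralZl//.
- rewrite integral_gauss_rV ?invr_gt0 ?mulr_gt0// invrK -EFinM lee_fin.
  rewrite (_ : pi * (8 * t) = 2 * (4 * pi * t)); last by ring.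
  rewrite (sqrtrM (4 * pi * t))// exprMn.
  rewrite (mulrC (Num.sqrt 2 ^+ d)) mulrA -(mulrA (8 * t)) mulVf ?mulr1.
    by rewrite mulrAC.
  by rewrite expf_neq0// gt_eqF// sqrtr_gt0.
- by apply/measurable_EFinP; exact: measurable_gauss.
- by rewrite lee_fin !mulr_ge0// ?invr_ge0 ?exprn_ge0 ?sqrtr_ge0// ltW.
Qed.

(** The jump kernel is the density of a Levy measure on [R^d], by Tonelli's theorem
    and the bound on truncated second moments of the Gaussians that it mixes. *)
Theorem jump_kernel_levy :
  (\int[lebesgue_rV d]_h ((Num.min 1 (enorm h ^+ 2))%:E * jk (enorm h)) < +oo)%E.
Proof.
pose F (p : 'rV[R]_d * measurableTypeR R) :=
  ((Num.min 1 (enorm p.1 ^+ 2) * gauss_kernel p.2 (enorm p.1))%:E * (levy0 Phi p.2)%:E)%E.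
have F0 p : (0 <= F p)%E.
  rewrite mule_ge0// lee_fin ?levy0_ge0// mulr_ge0 ?gauss_kernel_ge0//.
  by rewrite le_min ler01 sqr_ge0.
have mF : measurable_fun setT F.
  have me : measurable_fun setT (fun p : 'rV[R]_d * measurableTypeR R => enorm p.1).
    exact: measurable_enorm.
  apply: emeasurable_funM; apply/measurable_EFinP; last first.
    by apply: (measurableT_comp (measurable_levy0 Phi_B0)).
  apply: measurable_funM; first by apply: measurable_minr => //; exact: measurable_funX.
  exact: (measurableT_comp measurable_gauss_kernel (measurable_fun_pair me measurable_snd)).
have -> : (\int[lebesgue_rV d]_h ((Num.min 1 (enorm h ^+ 2))%:E * jk (enorm h)) =
           \int[lebesgue_rV d]_h \int[leb]_t F (h, t))%E.
  apply: eq_integral => h _; rewrite jump_kernelE -ge0_integralZl//.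
  - by apply: eq_integral => t _; rewrite /F muleA.
  - apply: emeasurable_funM; apply/measurable_EFinP; last exact: measurable_levy0.
    exact: (measurableT_comp measurable_gauss_kernel (pair1_measurable (enorm h))).
  - by move=> t _; rewrite mule_ge0// lee_fin ?levy0_ge0 ?gauss_kernel_ge0.
  - by rewrite lee_fin le_min ler01 sqr_ge0.
rewrite (fubini_tonelli F mF F0).
apply: (@le_lt_trans _ _ ((8 * Num.sqrt 2 ^+ d)%:E * \int[leb]_t (((Num.min 1 `|t|)%:E * (levy0 Phi t)%:E)))%E).
  rewrite -ge0_integralZl//=.
  - apply: ge0_le_integral => //.
    + by move=> t _; exact: integral_ge0.
    + exact: (measurable_fun_fubini_tonelli_G (m1 := lebesgue_rV d) F mF F0).
    + apply: measurable_funeM; apply: emeasurable_funM; apply/measurable_EFinP; last exact: measurable_levy0.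
      by apply: measurable_minr => //; exact: measurableT_comp.
    + move=> t _; rewrite /F /=.
      have l0 := levy0_ge0 Phi_B0 t.
      rewrite ge0_integralZr//.
      * move: l0; rewrite levy0E; case: ifPn => [t0 l0|_ _]; last by rewrite !mule0.
        rewrite muleA lee_wpmul2r ?lee_fin//.
        by rewrite -EFinM ger0_norm ?(ltW t0)//; exact: gauss_kernel_moment.
      * apply/measurable_EFinP; apply: measurable_funM; last exact: measurable_gauss_kernel_rV.
        by apply: measurable_minr => //; apply: measurable_funX; exact: measurable_enorm.
      * move=> h _; rewrite lee_fin mulr_ge0 ?gauss_kernel_ge0//.
        by rewrite le_min ler01 sqr_ge0.
  - apply: emeasurable_funM; apply/measurable_EFinP; last exact: measurable_levy0.
    by apply: measurable_minr => //; exact: measurableT_comp.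
  - by move=> t _; rewrite mule_ge0// lee_fin ?levy0_ge0// le_min ler01 normr_ge0.
rewrite lte_mul_pinfty//.
have minE (t : R) : ((Num.min 1 `|t|)%:E * (levy0 Phi t)%:E = (Num.min 1 t)%:E * (levy0 Phi t)%:E)%E.
  rewrite levy0E; case: ifPn => [t0|_]; last by rewrite !mule0.
  by rewrite ger0_norm// ltW.
under eq_integral do rewrite minE.
exact: levy0_min_lty.
Qed.

End jump_kernel.

(** * The energy form *)

Section product_null.
Context d1 d2 (T1 : measurableType d1) (T2 : measurableType d2) {R : realType}.
Variables (m1 : {sigma_finite_measure set T1 -> \bar R})
          (m2 : {sigma_finite_measure set T2 -> \bar R}).

Lemma ae_prod_fst (P : T1 -> Prop) : (\forall x \ae m1, P x) ->
  \forall z \ae (m1 \x m2)%E, P z.1.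
Proof.
move=> [N [mN N0 PN]]; exists (N `*` setT); split.
- exact: measurableX.
- by rewrite [LHS]product_measure1E// [X in (X * _)%E]N0 mul0e.
- by move=> [x y] /= h; split => //; exact: PN.
Qed.

Lemma ae_prod_snd (P : T2 -> Prop) : (\forall x \ae m2, P x) ->
  \forall z \ae (m1 \x m2)%E, P z.2.
Proof.
move=> [N [mN N0 PN]]; exists (setT `*` N); split.
- exact: measurableX.
- by rewrite [LHS]product_measure1E// [X in (_ * X)%E]N0 mule0.
- by move=> [x y] /= h; split => //; exact: PN.
Qed.

End product_null.

Lemma integral_fin_integrable d (T : measurableType d) (R : realType)
    (mu : {measure set T -> \bar R}) (f : T -> \bar R) :
  measurable_fun setT f -> (`|\int[mu]_x f x| < +oo)%E -> mu.-integrable setT f.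
Proof.
move=> mf foo; apply/integrableP; split => //.
rewrite integralE in foo.
have P0 : (0 <= \int[mu]_x f^\+ x)%E by exact: integral_ge0.
have N0 : (0 <= \int[mu]_x f^\- x)%E by exact: integral_ge0.
under eq_integral do rewrite -/((abse \o f) _) fune_abse.
rewrite ge0_integralD//; [|exact: measurable_funepos|exact: measurable_funeneg].
move: foo P0 N0.
case: (\int[mu]_x f^\+ x)%E => [p| |] //; case: (\int[mu]_x f^\- x)%E => [n| |] //=.
by move=> _ _ _; rewrite ltry.
Qed.

Section energy.
Context {R : realType} (d : nat) (Phi : R -> R).
Hypothesis Phi_B0 : B0 Phi.
Local Notation mu := (lebesgue_rV d).
Local Notation mu2 := (lebesgue_rV d \x lebesgue_rV d)%E.
Local Notation T := 'rV[R]_d.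
Local Notation jk := (jump_kernel d Phi).

Lemma enorm_gt0 (x : T) : x != 0 -> 0 < enorm x.
Proof.
move=> x0; rewrite sqrtr_gt0 lt0r edot_ge0 andbT; apply: contra x0.
rewrite /edot psumr_eq0; last by move=> i _; rewrite -expr2 sqr_ge0.
move=> /allP xi; apply/eqP/rowP => i; rewrite mxE.
by have := xi i (mem_index_enum i); rewrite /= mulf_eq0 orbb => /eqP.
Qed.

Definition jump_density (h : T) : R := fine (jk (enorm h)).

Lemma jump_density_ge0 h : 0 <= jump_density h.
Proof. by rewrite fine_ge0// jump_kernel_ge0. Qed.

Lemma measurable_jump_density : measurable_fun setT jump_density.
Proof.
apply: measurableT_comp => //.
by apply: (measurableT_comp (measurable_jump_kernel d Phi_B0)); exact: measurable_enorm.
Qed.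

(** [jk] may be infinite at the origin, where the increments vanish. *)
Lemma jump_densityE (h : T) (a : R) : (h = 0 -> a = 0) ->
  (a%:E * jk (enorm h) = (a * jump_density h)%:E)%E.
Proof.
have [->|h0] := eqVneq h 0 => ha; first by rewrite ha// mul0e mul0r.
rewrite EFinM fineK// ge0_fin_numE ?jump_kernel_ge0//.
by apply: jump_kernel_lty => //; exact: enorm_gt0.
Qed.

(** The energy is the squared [L2] norm of this function on the product space,
    which makes it a closed form without further work. *)
Definition increment (u : T -> R) (z : T * T) : R :=
  (u z.1 - u z.2) * Num.sqrt (jump_density (z.2 - z.1) / 2).

Lemma measurable_rV_sub : measurable_fun setT (fun z : T * T => z.2 - z.1).
Proof.
rewrite (_ : (fun _ => _) = (fun z : T * T => z.2 + (- 1) *: z.1)); last first.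
  by apply/funext => z; rewrite scaleN1r.
apply: measurable_rV_fun_add => //.
by apply: (measurableT_comp (@measurable_rV_scale R d (-1))).
Qed.

Lemma measurable_increment (u : T -> R) :
  measurable_fun setT u -> measurable_fun setT (increment u).
Proof.
move=> mu_; apply: measurable_funM.
  by apply: measurable_funB; exact: measurableT_comp.
apply: (measurableT_comp measurable_sqrt); apply: measurable_funM => //.
by apply: (measurableT_comp measurable_jump_density); exact: measurable_rV_sub.
Qed.

Lemma incrementM (u w : T -> R) z : increment u z * increment w z =
  2^-1 * ((u z.1 - u z.2) * (w z.1 - w z.2) * jump_density (z.2 - z.1)).
Proof.
rewrite /increment mulrACA -expr2 sqr_sqrtr; first ring.
by rewrite divr_ge0 ?jump_density_ge0.
Qed.

Definition energy_form (u w : T -> R) : R :=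
  \int[mu2]_z (increment u z * increment w z).

Lemma energy_closed_form :
  closed_form (fun u : L2 mu => sqint mu2 (increment u)) energy_form.
Proof.
apply: (@square_closed_form _ _ R mu _ _ mu2 increment).
- exact: measurable_increment.
- by move=> u v z; rewrite /increment; ring.
- by move=> a u z; rewrite /increment; ring.
- move=> u_ u uu.
  have h1 := ae_prod_fst mu uu; have h2 := ae_prod_snd mu uu.
  apply: filterS2 h1 h2 => z z1 z2.
  by apply: cvgM; [exact: cvgB|exact: cvg_cst].
Qed.

(** Substituting [h = x - y], for fixed [y], and exchanging the integrals. *)
Lemma seminorm2E (u : L2 mu) : seminorm2 Phi u = sqint mu2 (increment u).
Proof.
have mu_ : measurable_fun setT u := L2_measurable u.
pose g (z : T * T) : R := 2^-1 * ((u z.1 - u (z.2 + z.1)) ^+ 2 * jump_density z.2).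
have g0 z : 0 <= g z.
  by rewrite mulr_ge0// mulr_ge0 ?sqr_ge0 ?jump_density_ge0.
have mg : measurable_fun setT g.
  apply: measurable_funM => //; apply: measurable_funM; last first.
    by apply: (measurableT_comp measurable_jump_density).
  apply: measurable_funX; apply: measurable_funB; first exact: measurableT_comp.
  by apply: measurableT_comp => //; apply: measurable_rV_fun_add.
have mi := measurable_increment mu_.
rewrite /sqint fubini_tonelli1; first last.
- by move=> z; rewrite lee_fin sqr_ge0.
- exact: measurable_sqr.
transitivity (\int[mu]_y \int[mu]_h (g (y, h))%:E)%E; last first.
  apply: eq_integral => y _; rewrite /fubini_F.
  rewrite -[RHS](integral_rV_shift y).
  - apply: eq_integral => h _; congr (_%:E).
    by rewrite expr2 incrementM /g /= addrK expr2.
  - apply: (measurableT_comp (measurable_sqr mi)); exact: pair1_measurable.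
  - by move=> x; rewrite lee_fin sqr_ge0.
rewrite (fubini_tonelli (fun z => (g z)%:E)); first last.
- by move=> z; rewrite lee_fin.
- exact/measurable_EFinP.
have E h x : ((`|u (x + h)%R - u x| ^+ 2)%:E * jk (enorm h) = 2%:E * (g (x, h))%:E)%E.
  rewrite jump_densityE; last by move=> ->; rewrite addr0 subrr normr0 expr0n.
  rewrite -EFinM /g /= real_normK ?num_real// (addrC h) -(sqrrN (u x - _)) opprB.
  by rewrite mulrA mulfV// mul1r.
have mgh h : measurable_fun setT (fun x => (g (x, h))%:E).
  by apply/measurable_EFinP; exact: (measurableT_comp mg (pair2_measurable h)).
rewrite /seminorm2.
under eq_integral => h _.
  under eq_integral => x _ do rewrite E.
  rewrite ge0_integralZl//; last by move=> x _; rewrite lee_fin.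
  over.
rewrite ge0_integralZl//.
- by rewrite muleA -EFinM mulVf// mul1e.
- apply: (measurable_fun_fubini_tonelli_G (m1 := mu) (fun z => (g z)%:E)).
    exact/measurable_EFinP.
  by move=> z; rewrite lee_fin.
- by move=> h _; apply: integral_ge0 => x _; rewrite lee_fin.
Qed.

Lemma energyE (u w : L2 mu) :
  (seminorm2 Phi u < +oo)%E -> (seminorm2 Phi w < +oo)%E ->
  energy Phi u w = energy_form u w.
Proof.
rewrite !seminorm2E => su sw.
have mi (v : L2 mu) := measurable_increment (L2_measurable v).
have I := mul_integrable (mi u) (mi w) su sw.
rewrite /energy /energy_form /Rintegral.
transitivity (2^-1 * fine (2%:E * \int[mu2]_z (increment u z * increment w z)%:E)%E); last first.
  rewrite fineM//; last exact: integrable_fin_num.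
  by rewrite mulrA mulVf ?mul1r.
congr (_ * fine _).
rewrite -integralZl//.
rewrite -(integral12_prod_meas1 (m1 := mu) (m2 := mu)); last exact: integrableZl.
apply: eq_integral => y _; apply: eq_integral => x _.
rewrite jump_densityE; last by move=> /eqP; rewrite subr_eq0 => /eqP ->; rewrite subrr mul0r.
by rewrite incrementM -EFinM mulrA mulfV ?mul1r.
Qed.

End energy.

(** * Schrodinger forms *)

Lemma limn_esup_lt_near {R : realType} (u : (\bar R)^nat) (l : \bar R) :
  (limn_esup u < l)%E -> \forall n \near \oo, (u n < l)%E.
Proof.
rewrite limn_esup_lim (cvg_lim (@ereal_hausdorff R) (@cvg_esups_inf _ u)).
move=> /ereal_inf_lt[_ [N _ <-]] uN; exists N => // n /= Nn.
by apply: le_lt_trans uN; apply: ereal_sup_ubound; exists n.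
Qed.

Section shifted_integral.
Context d (T : measurableType d) {R : realType}.
Variable mu : {measure set T -> \bar R}.
Variables (f g : T -> R).
Hypothesis mf : measurable_fun setT f.
Hypothesis f0 : forall x, 0 <= f x.
Hypothesis ig : mu.-integrable setT (EFin \o g).

(** When the integral of [f] is infinite both sides are [+oo], because the negative
    part of [f - g] is controlled by [g]. With [f = W u^2] and [g = c u^2] this is how
    a potential bounded below is replaced by a non-negative one. *)
Lemma integral_shiftE : (\int[mu]_x (f x - g x)%:E + \int[mu]_x (g x)%:E =
  \int[mu]_x (f x)%:E)%E.
Proof.
have mg : measurable_fun setT g by have /integrableP[/measurable_EFinP] := ig.
have mfg : measurable_fun setT (fun x => (f x - g x)%:E).
  by apply/measurable_EFinP; exact: measurable_funB.
have gfin : (\int[mu]_x (g x)%:E \is a fin_num)%E by exact: integrable_fin_num.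
have [foo|foo] := ltP (\int[mu]_x (f x)%:E)%E +oo%E.
  have If : mu.-integrable setT (EFin \o f).
    apply/integrableP; split; first exact/measurable_EFinP.
    by under eq_integral do rewrite /= ger0_norm//.
  by rewrite integralB_EFin// subeK.
have nfoo : (\int[mu]_x (f x)%:E = +oo)%E by apply/eqP; rewrite -leye_eq.
have negfin : (\int[mu]_x ((fun x => (f x - g x)%:E)^\- x) < +oo)%E.
  have /integrableP[_] := ig; apply: le_lt_trans.
  apply: ge0_le_integral => //.
  - exact: measurable_funeneg.
  - by apply: measurableT_comp => //; exact/measurable_EFinP.
  move=> x _; rewrite funenegE -EFinN -EFin_max lee_fin ge_max normr_ge0 andbT.
  by rewrite opprB; apply: le_trans (ler_norm _); rewrite lerBlDr lerDl.
have posinf : (\int[mu]_x ((fun x => (f x - g x)%:E)^\+ x) = +oo)%E.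
  apply/eqP; rewrite -leye_eq leNgt; apply/negP => pfin.
  have I : mu.-integrable setT (EFin \o (fun x => f x - g x)).
    apply: integral_fin_integrable => //; rewrite integralE.
    move: pfin negfin.
    have : (0 <= \int[mu]_x ((fun x => (f x - g x)%:E)^\+ x))%E by exact: integral_ge0.
    have : (0 <= \int[mu]_x ((fun x => (f x - g x)%:E)^\- x))%E by exact: integral_ge0.
    rewrite /comp.
    case: (\int[mu]_x _)%E => [p| |] //; case: (\int[mu]_x _)%E => [n| |] //= _ _ _ _.
    by rewrite ltry.
  have := integrableD measurableT I ig.
  move=> /integrable_fin_num => /(_ measurableT).
  rewrite (eq_integral (fun x => (f x)%:E)); last first.
    by move=> x _ /=; rewrite -EFinD subrK.
  by rewrite nfoo.
rewrite [X in (X + _)%E]integralE posinf nfoo.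
move: negfin gfin; have : (0 <= \int[mu]_x ((fun x => (f x - g x)%:E)^\- x))%E by exact: integral_ge0.
case: (\int[mu]_x _^\- x)%E => [p| |] //= _ _.
by case: (\int[mu]_x _)%E => [n| |] //.
Qed.

End shifted_integral.

Section schrodinger_form.
Context {R : realType} (d : nat) (Phi : R -> R).
Hypothesis Phi_B0 : B0 Phi.
Local Notation mu := (lebesgue_rV d : {measure set 'rV[R]_d -> \bar R}).
Local Notation mu2 := (lebesgue_rV d \x lebesgue_rV d)%E.
Local Notation T := 'rV[R]_d.
Implicit Types (W : T -> R) (V : T -> \bar R) (u w : L2 mu).

(** The potential term is the squared norm of [sqrt W u]. *)
Definition weight W (u : T -> R) (x : T) : R := Num.sqrt (W x) * u x.

Lemma measurable_weight W (u : T -> R) : measurable_fun setT W ->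
  measurable_fun setT u -> measurable_fun setT (weight W u).
Proof.
by move=> mW mu_; apply: measurable_funM => //; exact: (measurableT_comp measurable_sqrt).
Qed.

Definition form_value W u : \bar R :=
  (sqint mu2 (increment Phi u) + sqint mu (weight W u))%E.

Definition form_polar W u w : R :=
  energy_form Phi u w + \int[mu]_x (weight W u x * weight W w x).

Lemma form_closed W : measurable_fun setT W ->
  closed_form (form_value W) (form_polar W).
Proof.
move=> mW; apply: closed_formD; first exact: energy_closed_form.
apply: (@square_closed_form _ _ R mu _ _ mu (weight W)).
- by move=> u; exact: measurable_weight.
- by move=> u v z; rewrite /weight mulrDr.
- by move=> t u z; rewrite /weight mulrCA.
- move=> u_ u; apply: filterS => x ux.
  by apply: cvgM => //; exact: cvg_cst.
Qed.

Lemma sqint_weight W (u : T -> R) : (forall x, 0 <= W x) ->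
  sqint mu (weight W u) = (\int[mu]_x (W x * u x ^+ 2)%:E)%E.
Proof.
by move=> W0; apply: eq_integral => x _; rewrite /weight exprMn sqr_sqrtr.
Qed.

(** In the sections below [V] is a potential with [V >= - c] and [W = V + c] a
    non-negative finite version of the shifted potential. *)
Section shifted_potential.
Variables (W : T -> R) (V : T -> \bar R) (c : R).
Hypothesis mW : measurable_fun setT W.
Hypothesis W0 : forall x, 0 <= W x.
Hypothesis mV : measurable_fun setT V.
Hypothesis VE : \forall x \ae mu, V x = (W x - c)%:E.

Lemma potential_energyE (a : T -> R) : measurable_fun setT a ->
  (\int[mu]_x (V x * (a x)%:E) = \int[mu]_x (W x * a x - c * a x)%:E)%E.
Proof.
move=> ma; apply: ae_eq_integral => //.
- by apply: emeasurable_funM => //; exact/measurable_EFinP.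
- by apply/measurable_EFinP; apply: measurable_funB; exact: measurable_funM.
by apply: filterS VE => x -> _; rewrite -EFinM mulrBl.
Qed.

Lemma potential_shift u :
  (\int[mu]_x (V x * (u x ^+ 2)%:E) + (c * L2dot u u)%:E = sqint mu (weight W u))%E.
Proof.
have mu2_ : measurable_fun setT (fun x => u x ^+ 2).
  by apply: measurable_funX; exact: L2_measurable.
have Ic : mu.-integrable setT (EFin \o (fun x => c * u x ^+ 2)).
  rewrite (_ : EFin \o _ = (fun x => c%:E * (u x ^+ 2)%:E)%E); last first.
    by apply/funext => x /=; rewrite EFinM.
  by apply: integrableZl => //; apply: sqint_integrable; [exact: L2_measurable|exact: L2_sqint].
rewrite sqint_weight// potential_energyE//.
rewrite -[RHS](integral_shiftE (g := fun x => c * u x ^+ 2))//; last 2 first.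
- by apply: measurable_funM.
- by move=> x; rewrite mulr_ge0// sqr_ge0.
congr (_ + _)%E; under eq_integral do rewrite EFinM.
rewrite integralZl//; first by rewrite -[X in (_ * X)%E]/(sqint mu u) L2_sqintE EFinM.
by apply: sqint_integrable; [exact: L2_measurable|exact: L2_sqint].
Qed.

Lemma form_domE u : form_dom Phi V u <-> (form_value W u < +oo)%E.
Proof.
have PE : potential_energy V u u = (\int[mu]_x (V x * (u x ^+ 2)%:E))%E.
  by apply: eq_integral => x _; rewrite expr2.
rewrite /form_dom /= /H_Phi /= PE /form_value seminorm2E//.
have PS := potential_shift u; have P0 := sqint_ge0 mu (weight W u).
have Q0 := sqint_ge0 mu2 (increment Phi u).
rewrite -fin_num_abs; split=> [[Qoo Afin]|QP].
  by rewrite lte_add_pinfty// -ge0_fin_numE// -PS fin_numD Afin.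
split; first by apply: le_lt_trans QP; rewrite leeDl.
have : (sqint mu (weight W u) \is a fin_num)%E.
  by rewrite ge0_fin_numE//; apply: le_lt_trans QP; rewrite leeDr.
by rewrite -PS fin_numD => /andP[].
Qed.

Lemma schrodinger_formE u w : form_dom Phi V u -> form_dom Phi V w ->
  schrodinger_form Phi V u w = form_polar W u w - c * L2dot u w.
Proof.
move=> /form_domE Du /form_domE Dw.
have sp (v : L2 mu) : (form_value W v < +oo)%E ->
    (seminorm2 Phi v < +oo)%E /\ (sqint mu (weight W v) < +oo)%E.
  move=> Dv; rewrite seminorm2E//; split; apply: le_lt_trans Dv.
    by rewrite leeDl// sqint_ge0.
  by rewrite leeDr// sqint_ge0.
have [su pu] := sp u Du; have [sw pw] := sp w Dw.
rewrite /schrodinger_form /form_polar energyE// -addrA; congr (_ + _).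
have mw (v : L2 mu) := measurable_weight mW (L2_measurable v).
have I := mul_integrable (mw u) (mw w) pu pw.
have uwI := L2_mul_integrable u w.
rewrite /potential_energy potential_energyE; last first.
  by apply: measurable_funM; exact: L2_measurable.
rewrite /L2dot -RintegralZl// -RintegralB//.
  congr fine; apply: eq_integral => x _; congr (_%:E).
  by rewrite /weight mulrACA -expr2 sqr_sqrtr.
rewrite (_ : EFin \o _ = (fun x => c%:E * (u x * w x)%:E)%E); last first.
  by apply/funext => x /=; rewrite EFinM.
exact: integrableZl.
Qed.

Hypothesis W_dense : forall (f : L2 mu) (e : R), 0 < e ->
  exists2 u : L2 mu, (form_value W u < +oo)%E & L2norm (f - u) < e.

Let W_dense' (f : L2 mu) (e : R) : 0 < e ->
  exists2 u : L2 mu, form_dom Phi V u & L2norm (f - u) < e.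
Proof. by move=> /(W_dense f)[u Du fu]; exists u => //; exact/form_domE. Qed.

Lemma schrodinger_self_adjoint : self_adjoint (schrodinger Phi V).
Proof.
exact: (form_operator_self_adjoint (form_closed mW) form_domE schrodinger_formE W_dense').
Qed.

Lemma schrodinger_resolvent :
  is_resolvent (schrodinger Phi V) (- (c + 1)) (fun f => - form_solve (form_closed mW) f).
Proof.
exact: (form_operator_resolvent (form_closed mW) form_domE schrodinger_formE).
Qed.

End shifted_potential.

Section resolvent_convergence.
Variables (V_ : nat -> T -> \bar R) (W_ : nat -> T -> R) (c : R).
Variables (V : T -> \bar R) (W : T -> R).
Hypothesis mW_ : forall n, measurable_fun setT (W_ n).
Hypothesis W0_ : forall n x, 0 <= W_ n x.
Hypothesis mV_ : forall n, measurable_fun setT (V_ n).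
Hypothesis VE_ : forall n, \forall x \ae mu, V_ n x = (W_ n x - c)%:E.
Hypothesis mW : measurable_fun setT W.
Hypothesis W0 : forall x, 0 <= W x.
Hypothesis mV : measurable_fun setT V.
Hypothesis VE : \forall x \ae mu, V x = (W x - c)%:E.
Hypothesis W_cvg : \forall x \ae mu, W_ n x @[n --> \oo] --> W x.
Hypothesis V_limsup : forall u, form_dom Phi V u ->
  (limn_esup (fun k => \int[mu]_x (V_ k x * (u x ^+ 2)%:E)) <=
     \int[mu]_x (V x * (u x ^+ 2)%:E))%E.

Let U n x := infs (W_ ^~ x) n.

Let W_lb x : has_lbound (range (W_ ^~ x)).
Proof. by exists 0 => _ [n _ <-]. Qed.

Let sdrop_lb x n : has_lbound (sdrop (W_ ^~ x) n).
Proof. by exists 0 => _ [m _ <-]. Qed.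

Let mU n : measurable_fun setT (U n).
Proof. exact: measurable_fun_infs. Qed.

Let U0 n x : 0 <= U n x.
Proof.
apply: lb_le_inf; first by exists (W_ n x); exists n => /=.
by move=> _ [m _ <-].
Qed.

Let UW n m x : (n <= m)%N -> U n x <= W_ m x.
Proof. by move=> nm; apply: ge_inf => //; exists m. Qed.

Let UU n m x : (n <= m)%N -> U n x <= U m x.
Proof.
move=> nm; apply: lb_le_inf; first by exists (W_ m x); exists m => /=.
by move=> _ [k /= mk <-]; apply: UW; exact: leq_trans mk.
Qed.

Let le_form_value (W1 W2 : T -> R) u : measurable_fun setT W1 -> measurable_fun setT W2 ->
  (forall x, 0 <= W1 x) -> (forall x, 0 <= W2 x) ->
  (\forall x \ae mu, W1 x <= W2 x) -> (form_value W1 u <= form_value W2 u)%E.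
Proof.
move=> m1 m2 p1 p2 W12; apply: leeD => //; rewrite !sqint_weight//.
have mm (W' : T -> R) : measurable_fun setT W' ->
    measurable_fun setT (fun x => (W' x * u x ^+ 2)%:E).
  move=> mW'; apply/measurable_EFinP; apply: measurable_funM => //.
  by apply: measurable_funX; exact: L2_measurable.
apply: ae_ge0_le_integral => //; try exact: mm.
- by move=> x _; rewrite lee_fin mulr_ge0 ?sqr_ge0.
- by move=> x _; rewrite lee_fin mulr_ge0 ?sqr_ge0.
by apply: filterS W12 => x h _; rewrite lee_fin ler_wpM2r ?sqr_ge0.
Qed.

(** The minorants demanded by [form_solve_cvg] are the forms with potential
    [U n = inf_(m >= n) W_ m], which increase to [W] almost everywhere; their lower
    bound is Fatou's lemma, and the upper bound is the hypothesis on the upper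
    limits of the potential energies. *)
Theorem schrodinger_resolvent_cvg (f : L2 mu) :
  L2norm (form_solve (form_closed (mW_ n)) f - form_solve (form_closed mW) f)
    @[n --> \oo] --> 0.
Proof.
apply: (@form_solve_cvg _ _ R mu (fun n => form_value (W_ n)) (fun n => form_value (U n))
  (fun n => form_polar (W_ n)) (fun n => form_polar (U n)) (form_value W) (form_polar W)
  (fun n => form_closed (mW_ n)) (fun n => form_closed (mU n)) (form_closed mW)).
- by move=> n u; apply: le_form_value => //; apply: aeW => x; exact: UW.
- by move=> n m u nm; apply: le_form_value => //; apply: aeW => x; exact: UU.
- move=> n u; apply: le_form_value => //; apply: filterS W_cvg => x Wx.
  rewrite -(cvg_lim (@Rhausdorff R) Wx); apply: limr_ge; first by apply/cvg_ex; exists (W x).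
  by exists n => // m /= nm; exact: UW.
- move=> N v_ v kN vv.
  apply: (@le_trans _ _ (limn_einf (fun k => sqint mu2 (increment Phi (v_ k))) +
      limn_einf (fun k => sqint mu (weight (U (N k)) (v_ k))))%E).
    apply: leeD; first exact: (cf_lsc (energy_closed_form d Phi_B0) vv).
    apply: sqint_fatou.
    + by move=> k; apply: measurable_weight => //; exact: L2_measurable.
    + by apply: measurable_weight => //; exact: L2_measurable.
    apply: filterS2 W_cvg vv => x Wx vx.
    have Ux := cvg_infs Wx.
    have UNx : (fun k => U (N k) x) @ \oo --> W x.
      apply: (cvg_comp N (fun k => U k x) _ Ux) => A [M _ MA]; exists M => //= n Mn.
      by apply: MA => /=; apply: leq_trans Mn _.
    exact: (cvgM (cvg_comp _ _ UNx (@sqrt_continuous R (W x))) vx).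
  by apply: limn_einfD_ge => n; exact: sqint_ge0.
- move=> u e Du e0.
  have Dom : form_dom Phi V u by apply/(form_domE mW W0 mV VE).
  have h : \forall n \near \oo, (\int[mu]_x (V_ n x * (u x ^+ 2)%:E) <
      \int[mu]_x (V x * (u x ^+ 2)%:E) + e%:E)%E.
    apply: limn_esup_lt_near; apply: le_lt_trans (V_limsup Dom) _.
    rewrite lteDl ?lte_fin//; move: Dom => [_].
    rewrite (_ : potential_energy V u u = \int[mu]_x (V x * (u x ^+ 2)%:E))%E.
      by rewrite fin_num_abs.
    by apply: eq_integral => x _; rewrite expr2.
  apply: filterS h => n h.
  have Efin : (sqint mu2 (increment Phi u) \is a fin_num)%E.
    rewrite ge0_fin_numE ?sqint_ge0//; apply: le_lt_trans Du.
    by rewrite leeDl// sqint_ge0.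
  rewrite /form_value -(potential_shift (mW_ n) (W0_ n) (mV_ n) (VE_ n)).
  rewrite -(potential_shift mW W0 mV VE) -[ltRHS]addeA lteD2lE//.
  by rewrite [ltRHS]addeAC lteD2rE.
Qed.

End resolvent_convergence.

End schrodinger_form.

(** * Density by orthogonality *)

(** Minimising the distance from [f] to [D] produces an element [g] of the closure
    such that [f - g] is orthogonal to [D], hence 0. *)
Lemma dense_of_orthogonal d (T : measurableType d) (R : realType)
    (mu : {measure set T -> \bar R}) (D : set (L2 mu)) :
  D 0 -> (forall u v, D u -> D v -> D (u + v)) -> (forall a u, D u -> D (a *: u)) ->
  (forall r : L2 mu, (forall w, D w -> L2dot r w = 0) -> \forall x \ae mu, r x = 0) ->
  forall (f : L2 mu) (e : R), 0 < e -> exists2 u, D u & L2norm (f - u) < e.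
Proof.
move=> D0 DD DZ orth f e e0.
pose S := [set L2dot (f - w) (f - w) | w in D].
have S0 : S !=set0 by exists (L2dot (f - 0) (f - 0)); exists 0.
have Slb : has_lbound S by exists 0 => _ [w _ <-]; exact: L2dot_ge0.
pose m := inf S.
have mS w : D w -> m <= L2dot (f - w) (f - w) by move=> Dw; apply: ge_inf => //; exists w.
have /choice[w_ w_P] : forall n, exists w, D w /\ L2dot (f - w) (f - w) <= m + (16^-1) ^+ n.
  move=> n; have e1 : 0 < (16^-1 : R) ^+ n by rewrite exprn_gt0.
  have [_ [w Dw <-] Jw] := inf_adherent e1 (conj S0 Slb).
  by exists w; split => //; exact: ltW.
have cauchy n k : (n <= k)%N -> L2dot (w_ n - w_ k) (w_ n - w_ k) <= 4 / 16 ^+ n.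
  move=> nk; have [Dn Jn] := w_P n; have [Dk Jk] := w_P k.
  have := mS _ (DZ 2^-1 _ (DD _ _ Dn Dk)).
  have kn : (16^-1 : R) ^+ k <= 16^-1 ^+ n.
    by apply: ler_wiXn2l => //; rewrite invf_le1// ler1n.
  rewrite -exprVn; move: Jn Jk.
  rewrite !L2dotE (L2dotC (w_ k) (w_ n)) !(L2dotC _ f); nra.
have [g [_ wg]] := L2_fast_cauchy cauchy.
have gw (h : L2 mu) := L2dot_lim (f := h) wg.
have r0 : \forall x \ae mu, (f - g) x = 0.
  apply: orth => w Dw; apply: (@quadratic_ge0_eq0 _ _ (L2dot w w)); first exact: L2dot_ge0.
  move=> t; rewrite -oppr_le0.
  pose v n := - (2 * t * (L2dot w f - L2dot w (w_ n))) - t ^+ 2 * L2dot w w.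
  have vl : v @ \oo --> - (2 * t * L2dot (f - g) w + t ^+ 2 * L2dot w w).
    rewrite L2dotBl (L2dotC f) (L2dotC g) opprD.
    apply: cvgB; last exact: cvg_cst.
    apply: cvgN; apply: cvgM; first exact: cvg_cst.
    by apply: cvgB; [exact: cvg_cst|exact: gw].
  have v16 : (fun n => (16^-1 : R) ^+ n) @ \oo --> (0 : R).
    by apply: cvg_expr; rewrite ger0_norm// invf_lt1// ltr1n.
  rewrite -(cvg_lim (@Rhausdorff R) vl) -(cvg_lim (@Rhausdorff R) v16).
  apply: ler_lim; [by apply/cvg_ex; eexists; exact: vl|by apply/cvg_ex; exists 0|].
  apply: nearW => n; have [Dn Jn] := w_P n.
  have := mS _ (DD _ _ Dn (DZ (- t) _ Dw)); move: Jn; rewrite /v.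
  rewrite !L2dotE !(L2dotC _ f) (L2dotC w (w_ n)); nra.
have : L2norm (f - w_ n) @[n --> \oo] --> 0.
  have -> : (fun n => L2norm (f - w_ n)) = (fun n => L2norm (w_ n - g)).
    apply/funext => n; rewrite !L2normE; congr Num.sqrt.
    have fg : f - w_ n = g - w_ n %[ae mu].
      by apply: filterS r0 => x /eqP; rewrite L2_addE L2_oppE subr_eq0 !L2_addE => /eqP ->.
    rewrite (ae_eq_L2dot _ fg) L2dotC (ae_eq_L2dot _ fg).
    by rewrite -opprB L2dotNl L2dotNr opprK.
  have -> : (fun n => L2norm (w_ n - g)) =
      Num.sqrt \o (fun n => L2dot (w_ n - g) (w_ n - g)).
    by apply/funext => n; exact: L2normE.
  by have := cvg_comp _ _ wg (@sqrt_continuous R 0); rewrite sqrtr0; exact.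
move=> /cvgrPdist_lt /(_ _ e0)[M _ /(_ M (leqnn _))] /=.
rewrite sub0r normrN => h; exists (w_ M); first by have [] := w_P M.
exact: le_lt_trans (ler_norm _) h.
Qed.

Section density_measure.
Context d (T : measurableType d) {R : realType}.
Variable mu : {measure set T -> \bar R}.
Variable p : T -> \bar R.
Hypothesis mp : measurable_fun setT p.
Hypothesis p0 : forall x, (0 <= p x)%E.

Definition density_measure (A : set T) : \bar R := (\int[mu]_(x in A) p x)%E.

Let dm0 : density_measure set0 = 0%E.
Proof. by rewrite /density_measure integral_set0. Qed.

Let dm_ge0 A : (0 <= density_measure A)%E.
Proof. exact: integral_ge0. Qed.

Let dm_sigma_additive : semi_sigma_additive density_measure.
Proof.
move=> F mF tF mUF; rewrite /density_measure ge0_integral_bigcup//.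
  by apply: is_cvg_ereal_nneg_natsum_cond => n _ _; exact: integral_ge0.
exact: measurable_funTS.
Qed.

HB.instance Definition _ := isMeasure.Build _ _ _
  density_measure dm0 dm_ge0 dm_sigma_additive.

Definition density_measureT := [the {measure set T -> \bar R} of density_measure].
End density_measure.

Section orthants.
Context {R : realType} (n : nat).
Local Notation T := 'rV[R]_n.

Definition orthant (b : T) : set T := [set x | forall i, b ord0 i <= x ord0 i].

Definition orthants : set (set T) := [set A | exists b, A = orthant b].

Lemma measurable_orthant b : measurable (orthant b).
Proof.
rewrite (_ : orthant b = \bigcap_(i : 'I_n) [set x | b ord0 i <= x ord0 i]); last first.
  by apply/seteqP; split => x h // i; [move=> _|]; exact: h.
apply: fin_bigcap_measurable => // i _.
suff : measurable [set x : T | b ord0 i <= x ord0 i] by [].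
have -> : [set x : T | b ord0 i <= x ord0 i] =
    setT `&` (rV_coord i @^-1` `[b ord0 i, +oo[%classic).
  by apply/seteqP; split => x /=; rewrite in_itv/= andbT => // -[].
by apply: measurable_rV_coord => //; exact: measurable_itv.
Qed.

Lemma orthants_setI : setI_closed orthants.
Proof.
move=> _ _ [a ->] [b ->]; exists (\row_i Num.max (a ord0 i) (b ord0 i)).
apply/seteqP; split => x /=.
  by move=> [ax bx] i; rewrite mxE ge_max ax bx.
by move=> h; split => i; have := h i; rewrite mxE ge_max => /andP[].
Qed.

Lemma orthants_cover : \bigcup_k orthant (const_mx (- k%:R)) = [set: T].
Proof.
apply/seteqP; split => // x _.
pose k := Num.bound (\sum_i `|x ord0 i|).
exists k => // i; rewrite mxE lerNl.
apply: le_trans (_ : \sum_i `|x ord0 i| <= _); last by apply/ltW/unstable.ltr_bound.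
rewrite (bigD1 i)//= -normrN; apply: le_trans (ler_norm _) _.
by rewrite lerDl sumr_ge0.
Qed.

Lemma orthants_generate : @measurable _ T = <<s orthants >>.
Proof.
apply/seteqP; split => A; last first.
  move=> sA; apply: sA; split; first exact: sigma_algebra_measurable.
  by move=> _ [b ->]; exact: measurable_orthant.
move=> mA.
have mid : measurable_fun [set: g_sigma_algebraType orthants]
    (idfun : g_sigma_algebraType orthants -> T).
  apply: measurable_fun_rV => i.
  apply: (measurability (@RGenCInfty.G R)) => [|_ [_ [r ->] <-]].
    exact: RGenCInfty.measurableE.
  rewrite setTI (_ : _ @^-1` _ = \bigcup_k orthant (\row_j if j == i then r else - k%:R)).
    apply: bigcupT_measurable => k; apply: sub_sigma_algebra.
    by eexists; reflexivity.
  apply/seteqP; split => x /=; rewrite /rV_coord /= in_itv/= andbT.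
    move=> rx; have : [set: T] x by [].
    rewrite -orthants_cover => -[k _ kx]; exists k => // j; rewrite mxE.
    by case: eqP => [->//|_]; have := kx j; rewrite mxE.
  by move=> [k _ /(_ i)]; rewrite mxE eqxx.
have := mid measurableT A mA.
by rewrite setTI preimage_id.
Qed.

(** Orthants form a pi-system that generates the Borel sets, so the measures with
    densities the positive and the negative part of [g] coincide; these parts have
    disjoint supports. *)
Lemma integral_orthants_eq0 (g : T -> R) :
  (lebesgue_rV n).-integrable setT (EFin \o g) ->
  (forall b, \int[lebesgue_rV n]_(x in orthant b) (g x)%:E = 0)%E ->
  \forall x \ae lebesgue_rV n, g x = 0.
Proof.
move=> ig g0; set mu := lebesgue_rV n in ig g0 *.
have mg : measurable_fun setT (EFin \o g) by have /integrableP[] := ig.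
have mp : measurable_fun setT ((EFin \o g)^\+)%E by exact: measurable_funepos.
have mn : measurable_fun setT ((EFin \o g)^\-)%E by exact: measurable_funeneg.
pose nup := density_measureT mu mp (funepos_ge0 _).
pose nun := density_measureT mu mn (funeneg_ge0 _).
have fin (A : set T) (h : T -> \bar R) : measurable A -> mu.-integrable setT h ->
    (forall x, (0 <= h x)%E) -> (\int[mu]_(x in A) h x < +oo)%E.
  move=> mA ih h0; have /integrableP[_] := integrableS measurableT mA (subsetT _) ih.
  by under eq_integral do rewrite gee0_abs//.
have E A : measurable A -> nup A = nun A.
  move=> mA; apply: (measure_unique orthants (fun k => orthant (const_mx (- k%:R)))) => //.
  - exact: orthants_generate.
  - exact: orthants_setI.
  - by move=> k; eexists; reflexivity.
  - exact: orthants_cover.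
  - move=> _ [b ->]; have := g0 b; rewrite integralE /nup /nun /= /density_measure.
    have mb := measurable_orthant b.
    have := fin _ _ mb (integrable_funepos measurableT ig) (funepos_ge0 _).
    have := fin _ _ mb (integrable_funeneg measurableT ig) (funeneg_ge0 _).
    have P0 : (0 <= \int[mu]_(x in orthant b) ((EFin \o g)^\+)%E x)%E by exact: integral_ge0.
    have N0 : (0 <= \int[mu]_(x in orthant b) ((EFin \o g)^\-)%E x)%E by exact: integral_ge0.
    set P := (\int[mu]_(x in _) _)%E in P0 *; set N := (\int[mu]_(x in _) _)%E in N0 *.
    by move=> Noo Poo PN; rewrite -[LHS](@subeK _ _ N) ?PN ?add0e// ge0_fin_numE.
  - move=> k; apply: fin; [exact: measurable_orthant|exact: integrable_funepos|].
    exact: funepos_ge0.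
have mP : measurable [set x | 0 < g x].
  rewrite -[X in measurable X]setTI; apply: measurable_fun_ltr => //.
  exact/measurable_EFinP.
have nunP : nun [set x | 0 < g x] = 0%E.
  apply: integral0_eq => x /= gx; rewrite funenegE /=.
  by apply/max_idPr; rewrite lee_fin oppr_le0 ltW.
have nupC : nup (~` [set x | 0 < g x]) = 0%E.
  apply: integral0_eq => x /= gx; rewrite funeposE /=.
  by apply/max_idPr; rewrite lee_fin leNgt; apply/negP.
have nupT : nup setT = 0%E.
  rewrite -(setUv [set x | 0 < g x]) measureU//; [|exact: measurableC|exact: setICr].
  rewrite [X in (X + _)%E](_ : _ = 0%E) ?add0e; first exact: nupC.
  by rewrite -nunP; exact: E.
have nunT : nun setT = 0%E by rewrite -E.
have : (\int[mu]_x `|(g x)%:E| = 0)%E.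
  under eq_integral do rewrite -/((abse \o (EFin \o g)) _) fune_abse.
  rewrite ge0_integralD// -[X in (X + _)%E]/(nup setT) -[X in (_ + X)%E]/(nun setT).
  by rewrite nupT nunT adde0.
move/(ae_eq_integral_abs _ measurableT mg); apply: filterS => x /(_ Logic.I) /=.
by move=> [].
Qed.

End orthants.

(** * Density of the form domain *)

Section monotone_integral.
Context d (T : measurableType d) {R : realType}.
Variable mu : {measure set T -> \bar R}.

(** The integral of a non-negative function is a supremum over simple functions
    below it, hence monotone for arbitrary functions. This matters for the Green
    kernel, whose measurability would need a separate argument. *)
Lemma le_ge0_integral (D : set T) (f g : T -> \bar R) :
  (forall x, D x -> (0 <= f x)%E) -> (forall x, D x -> (f x <= g x)%E) ->
  (\int[mu]_(x in D) f x <= \int[mu]_(x in D) g x)%E.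
Proof.
move=> f0 fg; have g0 x : D x -> (0 <= g x)%E by move=> Dx; exact: le_trans (f0 x Dx) (fg x Dx).
rewrite !(integral_mkcond D) !ge0_integralTE; first last.
- by move=> x; rewrite patchE; case: ifPn => // /[!inE]; exact: f0.
- by move=> x; rewrite patchE; case: ifPn => // /[!inE]; exact: g0.
apply: ge_ereal_sup => _ [h hf <-]; apply: ereal_sup_ubound; exists h => // x.
apply: le_trans (hf x) _; rewrite !patchE; case: ifPn => // /[!inE]; exact: fg.
Qed.

End monotone_integral.

Section tents.
Context {R : realType} (d : nat).
Local Notation T := 'rV[R]_d.
Local Notation mu := (lebesgue_rV d : {measure set 'rV[R]_d -> \bar R}).
Local Notation mu2 := (lebesgue_rV d \x lebesgue_rV d)%E.

Definition cube (r : R) : set T := [set x | forall i, `|x ord0 i| <= r].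

Lemma measurable_cube r : measurable (cube r).
Proof.
rewrite (_ : cube r = \bigcap_(i : 'I_d) [set x : T | `|x ord0 i| <= r]); last first.
  by apply/seteqP; split => x h // i; [move=> _|]; exact: h.
apply: fin_bigcap_measurable => // i _.
suff : measurable [set x : T | `|x ord0 i| <= r] by [].
rewrite -[X in measurable X]setTI; apply: measurable_fun_ler => //.
by apply: measurableT_comp => //; exact: (measurable_rV_coord i).
Qed.

Lemma cube_edot r x : cube r x -> edot x x <= d%:R * r ^+ 2.
Proof.
move=> xr; rewrite (_ : d%:R * r ^+ 2 = \sum_(i < d) r ^+ 2); last first.
  by rewrite sumr_const card_ord mulr_natl.
by apply: ler_sum => i _; have := xr i; rewrite ler_norml => /andP[]; nra.
Qed.

Lemma cube_lty r : (mu (cube r) < +oo)%E.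
Proof. exact: (lebesgue_rV_bounded (measurable_cube r) (@cube_edot r)). Qed.

Lemma coord_le_enorm (h : T) i : `|h ord0 i| <= enorm h.
Proof.
rewrite -sqrtr_sqr ler_wsqrtr// /edot (bigD1 i)//= -expr2 lerDl.
by apply: sumr_ge0 => j _; rewrite -expr2 sqr_ge0.
Qed.

Lemma max0_lipschitz (a b : R) : `|Num.max 0 a - Num.max 0 b| <= `|a - b|.
Proof.
have h1 := ler_norm (a - b); have h2 := ler_norm (- (a - b)); rewrite normrN in h2.
by rewrite ler_norml; case: (leP 0 a) => ha; case: (leP 0 b) => hb; lra.
Qed.

Section tent.
Variables (b : T) (N k : nat).

(** The sum-distance to the box of the [x] with [max(b_i, -N) <= x_i <= N]. *)
Definition box_excess (x : T) : R :=
  \sum_(i < d) (Num.max 0 (Num.max (b ord0 i) (- N%:R) - x ord0 i) +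
                Num.max 0 (x ord0 i - N%:R)).

(** Lipschitz functions that decrease to the indicator of the box as [k] grows, and
    are supported in a fixed cube because [box_excess < 1] on their support. *)
Definition tent (x : T) : R := Num.max 0 (1 - k.+1%:R * box_excess x).

Lemma box_excess_ge0 x : 0 <= box_excess x.
Proof. by apply: sumr_ge0 => i _; rewrite addr_ge0// le_max lexx. Qed.

Lemma box_excess_lipschitz (x h : T) :
  `|box_excess (x + h) - box_excess x| <= 2 * d%:R * enorm h.
Proof.
rewrite /box_excess -sumrB; apply: le_trans (ler_norm_sum _ _ _) _.
rewrite (_ : 2 * d%:R * enorm h = \sum_(i < d) 2 * enorm h); last first.
  by rewrite sumr_const card_ord -[RHS]mulr_natl; ring.
apply: ler_sum => i _; rewrite opprD addrACA; apply: le_trans (ler_normD _ _) _.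
have hi := coord_le_enorm h i.
rewrite mulr_natl mulr2n; apply: lerD; apply: le_trans (max0_lipschitz _ _) _; rewrite mxE.
  by rewrite (_ : _ - _ = - h ord0 i) ?normrN//; ring.
by rewrite (_ : _ - _ = h ord0 i)//; ring.
Qed.

Lemma measurable_box_excess : measurable_fun setT box_excess.
Proof.
apply: measurable_sum => i; apply: measurable_funD; apply: measurable_maxr => //;
  apply: measurable_funB => //; exact: (measurable_rV_coord i).
Qed.

Lemma measurable_tent : measurable_fun setT tent.
Proof.
apply: measurable_maxr => //; apply: measurable_funB => //; apply: measurable_funM => //.
exact: measurable_box_excess.
Qed.

Lemma tent_ge0 x : 0 <= tent x. Proof. by rewrite le_max lexx. Qed.

Lemma tent_le1 x : tent x <= 1.
Proof. by rewrite ge_max ler01 gerBl mulr_ge0// box_excess_ge0. Qed.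

Lemma tent_lipschitz (x h : T) :
  `|tent (x + h) - tent x| <= k.+1%:R * (2 * d%:R) * enorm h.
Proof.
apply: le_trans (max0_lipschitz _ _) _.
rewrite (_ : _ - _ = - (k.+1%:R * (box_excess (x + h) - box_excess x))); last by ring.
by rewrite normrN normrM ger0_norm// -mulrA ler_wpM2l// box_excess_lipschitz.
Qed.

Lemma tent_support x : ~ cube N.+1%:R x -> tent x = 0.
Proof.
apply: contra_notP => /eqP t0 i.
have e1 : box_excess x < 1.
  have tp : 0 < tent x by rewrite lt0r t0 tent_ge0.
  move: tp; rewrite /tent lt_max ltxx /= subr_gt0; apply: le_lt_trans.
  by rewrite ler_peMl ?box_excess_ge0// ler1n.
move: e1; rewrite /box_excess (bigD1 i)//=; set S := (\sum_(j < d | _) _).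
have S0 : 0 <= S by apply: sumr_ge0 => j _; rewrite addr_ge0// le_max lexx.
have h1 : Num.max (b ord0 i) (- N%:R) - x ord0 i <=
  Num.max 0 (Num.max (b ord0 i) (- N%:R) - x ord0 i) by rewrite le_max lexx orbT.
have h2 : x ord0 i - N%:R <= Num.max 0 (x ord0 i - N%:R) by rewrite le_max lexx orbT.
have h3 : - N%:R <= Num.max (b ord0 i) (- N%:R) by rewrite le_max lexx orbT.
have h4 : 0 <= Num.max 0 (Num.max (b ord0 i) (- N%:R) - x ord0 i) by rewrite le_max lexx.
have h5 : 0 <= Num.max 0 (x ord0 i - N%:R) by rewrite le_max lexx.
rewrite ler_norml -natr1 => e1; apply/andP; split; lra.
Qed.

End tent.

Lemma tent_cvg (b : T) (N : nat) x :
  tent b N k x @[k --> \oo] --> (\1_(orthant b `&` cube N%:R) x : R).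
Proof.
rewrite indicE; case: (boolP (x \in _)) => [|].
  rewrite inE => -[bx Nx].
  have e0 : box_excess b N x = 0.
    apply: big1 => i _; have := bx i; have := Nx i; rewrite ler_norml => /andP[n1 n2] bi.
    have -> : Num.max 0 (Num.max (b ord0 i) (- N%:R) - x ord0 i) = 0.
      by apply/max_l; rewrite subr_le0 ge_max bi.
    by rewrite add0r; apply/max_l; rewrite subr_le0.
  rewrite /tent e0 (_ : (fun _ => _) = cst 1); first exact: cvg_cst.
  by apply/funext => k /=; rewrite mulr0 subr0 max_r.
move=> xb.
have e0 : 0 < box_excess b N x.
  rewrite lt0r box_excess_ge0 andbT; apply: contra xb => /eqP.
  move=> /psumr_eq0P ex; rewrite inE.
  have {}ex i : Num.max 0 (Num.max (b ord0 i) (- N%:R) - x ord0 i) +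
                Num.max 0 (x ord0 i - N%:R) = 0.
    by apply: ex => // j _; rewrite addr_ge0// le_max lexx.
  have bd i : Num.max (b ord0 i) (- N%:R) <= x ord0 i <= N%:R.
    have := ex i; move/eqP; rewrite paddr_eq0 ?le_max ?lexx//.
    by rewrite !eq_maxl !subr_le0.
  split => i; have := bd i; rewrite ge_max; first by move=> /andP[/andP[]].
  by rewrite ler_norml => /andP[/andP[_ ->] ->].
apply: cvg_near_cst; exists (Num.bound (box_excess b N x)^-1) => // k /= nk.
apply/max_l; rewrite subr_le0.
have ek : (box_excess b N x)^-1 <= k.+1%:R.
  apply: le_trans (ltW (unstable.ltr_bound _)) _; rewrite ler_nat.
  exact: leq_trans nk _.
by rewrite -(ler_pM2r e0) mulVf ?gt_eqF in ek.
Qed.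

Section form_domain.
Variable Phi : R -> R.
Hypothesis Phi_B0 : B0 Phi.
Variable W : T -> R.
Hypothesis mW : measurable_fun setT W.
Hypothesis W0 : forall x, 0 <= W x.

Section lipschitz.
Variables (u : T -> R) (B : set T) (L : R).
Hypothesis mu_u : measurable_fun setT u.
Hypothesis u0 : forall x, 0 <= u x.
Hypothesis u1 : forall x, u x <= 1.
Hypothesis uL : forall x h : T, `|u (x + h) - u x| <= L * enorm h.
Hypothesis uB : forall x, ~ B x -> u x = 0.
Hypothesis mB : measurable B.
Hypothesis Boo : (mu B < +oo)%E.
Hypothesis WB : (\int[mu]_(x in B) (W x)%:E < +oo)%E.

Let usq x : u x ^+ 2 <= \1_B x.
Proof.
rewrite indicE; case: (boolP (x \in B)) => [_|xB]; last first.
  by have /uB -> : ~ B x; [rewrite -notin_setE|rewrite expr0n].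
by rewrite exprn_ile1.
Qed.

Lemma lipschitz_sqint : (sqint mu u < +oo)%E.
Proof.
apply: le_lt_trans Boo; rewrite -[B]setIT -integral_indic//.
by apply: le_ge0_integral => x _; rewrite lee_fin ?sqr_ge0// usq.
Qed.

Lemma lipschitz_weight : (sqint mu (weight W u) < +oo)%E.
Proof.
apply: le_lt_trans WB; rewrite sqint_weight// [leRHS]integral_mkcond.
apply: le_ge0_integral => x _; first by rewrite lee_fin mulr_ge0 ?sqr_ge0.
have := usq x; rewrite patchE indicE; case: ifPn => _ /= h; rewrite lee_fin.
  by rewrite ler_piMr.
by rewrite mulr_ge0_le0.
Qed.

(** The squared increment of [u] along [h] is at most [(1 + L^2) min(1, |h|^2)] and
    vanishes unless [x] or [x + h] is in [B]; the Levy integrability of the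
    jump kernel concludes. *)
Lemma lipschitz_energy : (sqint mu2 (increment Phi u) < +oo)%E.
Proof.
rewrite -[u in increment Phi u]/(L2_of mu_u lipschitz_sqint : T -> R) -seminorm2E//.
rewrite /seminorm2 /=.
pose K := 1 + L ^+ 2.
have K0 : 0 <= K by rewrite addr_ge0// sqr_ge0.
pose c (h : T) := ((K * Num.min 1 (enorm h ^+ 2))%:E * jump_kernel d Phi (enorm h))%E.
have min0 (h : T) : 0 <= Num.min 1 (enorm h ^+ 2) by rewrite le_min ler01 sqr_ge0.
have c0 h : (0 <= c h)%E by rewrite mule_ge0 ?jump_kernel_ge0// lee_fin mulr_ge0.
have diff (x h : T) : `|u (x + h) - u x| ^+ 2 <= K * Num.min 1 (enorm h ^+ 2) * (\1_B (x + h) + \1_B x).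
  have d1 : `|u (x + h) - u x| ^+ 2 <= 1.
    rewrite exprn_ile1// ler_norml; have := u0 (x + h); have := u1 (x + h).
    by have := u0 x; have := u1 x; lra.
  have d2 : `|u (x + h) - u x| ^+ 2 <= L ^+ 2 * enorm h ^+ 2.
    by rewrite -exprMn lerXn2r ?nnegrE//; apply: le_trans (uL x h).
  have d3 : `|u (x + h) - u x| ^+ 2 <= K * Num.min 1 (enorm h ^+ 2).
    rewrite /K; have L2 := sqr_ge0 L; have e2 := sqr_ge0 (enorm h).
    by case: (leP 1 (enorm h ^+ 2)) => _; nra.
  have K1 : 0 <= K * Num.min 1 (enorm h ^+ 2) by rewrite mulr_ge0.
  rewrite !indicE; case: (boolP (x \in B)) => xB; case: (boolP (x + h \in B)) => xhB /=;
    rewrite ?addr0 ?add0r ?mulr1//; first by rewrite mulrDr mulr1; lra.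
  move: xB xhB; rewrite !notin_setE => /uB -> /uB ->.
  by rewrite subrr normr0 expr0n mulr0.
have m1 : measurable_fun setT (fun x : T => (\1_B x)%:E : \bar R).
  by apply/measurable_EFinP; exact: measurable_indic.
have inner (h : T) : (\int[mu]_x ((`|u (x + h)%R - u x| ^+ 2)%:E * jump_kernel d Phi (enorm h)) <=
    c h * (mu B + mu B))%E.
  apply: (@le_trans _ _ (\int[mu]_x (c h * ((\1_B (x + h)%R)%:E + (\1_B x)%:E)))%E).
    apply: le_ge0_integral => x _; first by rewrite mule_ge0 ?jump_kernel_ge0// lee_fin exprn_ge0.
    rewrite /c muleAC lee_wpmul2r ?jump_kernel_ge0// -EFinD -EFinM lee_fin.
    exact: diff.
  have ms : measurable_fun setT (fun x : T => (\1_B (x + h)%R)%:E : \bar R).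
    by apply: (measurableT_comp m1); exact: measurable_rV_shift.
  rewrite ge0_integralZl//; last 2 first.
  - exact: emeasurable_funD.
  - by move=> x _; rewrite adde_ge0// lee_fin.
  rewrite ge0_integralD// (integral_rV_shift h (f := fun x => (\1_B x)%:E))//.
  by rewrite integral_indic// setIT.
apply: (@le_lt_trans _ _ (2^-1%:E * \int[mu]_h (c h * (mu B + mu B)))%E).
  rewrite lee_wpmul2l//; apply: le_ge0_integral => h _; last exact: inner.
  by apply: integral_ge0 => x _; rewrite mule_ge0 ?jump_kernel_ge0// lee_fin exprn_ge0.
have mc : measurable_fun setT (fun h : T => (Num.min 1 (enorm h ^+ 2))%:E * jump_kernel d Phi (enorm h))%E.
  apply: emeasurable_funM.
    apply/measurable_EFinP; apply: measurable_minr => //; apply: measurable_funX.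
    exact: measurable_enorm.
  by apply: (measurableT_comp (measurable_jump_kernel d Phi_B0)); exact: measurable_enorm.
have Bfin : (mu B \is a fin_num)%E by rewrite ge0_fin_numE.
have cE h : (c h * (mu B + mu B) = (K * (fine (mu B) + fine (mu B)))%:E *
    ((Num.min 1 (enorm h ^+ 2))%:E * jump_kernel d Phi (enorm h)))%E.
  by rewrite -{1 2}(fineK Bfin) -EFinD muleC /c muleA -EFinM muleA -EFinM; congr (_%:E * _)%E; ring.
under eq_integral do rewrite cE.
rewrite ge0_integralZl//; last 2 first.
- by move=> h _; rewrite mule_ge0 ?jump_kernel_ge0// lee_fin.
- by rewrite lee_fin mulr_ge0// addr_ge0// fine_ge0.
rewrite muleA -EFinM; apply: lte_mul_pinfty => //; last exact: jump_kernel_levy.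
by rewrite lee_fin !mulr_ge0// addr_ge0// fine_ge0.
Qed.

End lipschitz.

Hypothesis W_loc : forall N : nat, (\int[mu]_(x in cube N%:R) (W x)%:E < +oo)%E.

Lemma tent_form_dom (b : T) (N k : nat) :
  exists2 u : L2 mu, (form_value Phi W u < +oo)%E & u = tent b N k :> (T -> R).
Proof.
have mt := @measurable_tent b N k; have mB := @measurable_cube N.+1%:R.
have Boo := cube_lty N.+1%:R.
have st := lipschitz_sqint (@tent_ge0 b N k) (@tent_le1 b N k) (@tent_support b N k) mB Boo.
exists (L2_of mt st) => //.
rewrite lte_add_pinfty//.
  exact: (lipschitz_energy mt (@tent_ge0 b N k) (@tent_le1 b N k)
    (@tent_lipschitz b N k) (@tent_support b N k) mB Boo).
exact: (lipschitz_weight (@tent_ge0 b N k) (@tent_le1 b N k) (@tent_support b N k) (W_loc N.+1)).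
Qed.

(** Tents approximate indicators of boxes, so the integrals of [r] over boxes
    vanish; inside a cube, boxes are orthants, which determine an integrable
    function. *)
Lemma orthogonal_form_dom_eq0 (r : L2 mu) :
  (forall w : L2 mu, (form_value Phi W w < +oo)%E -> L2dot r w = 0) ->
  \forall x \ae mu, r x = 0.
Proof.
move=> orth.
have mr : measurable_fun setT r := L2_measurable r.
(* cutting off by the cube makes [r], which is only square-integrable, integrable *)
have zero N : \forall x \ae mu, r x * \1_(cube N%:R) x = 0.
  have mB := @measurable_cube N%:R; have mB1 := @measurable_cube N.+1%:R.
  have m1 : measurable_fun setT (\1_(cube N.+1%:R) : T -> R) by exact: measurable_indic.
  have s1 : (sqint mu (\1_(cube N.+1%:R) : T -> R) < +oo)%E.
    apply: le_lt_trans (cube_lty N.+1%:R); rewrite -[cube _ in leRHS]setIT -integral_indic//.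
    apply: le_ge0_integral => x _; rewrite lee_fin ?sqr_ge0// indicE.
    by case: (_ \in _); rewrite ?expr1n ?expr0n.
  have I1 := L2_mul_integrable r (L2_of m1 s1).
  have mrB : measurable_fun setT (fun x => r x * \1_(cube N%:R) x).
    by apply: measurable_funM => //; exact: measurable_indic.
  have cube1 x : (\1_(cube N%:R) x : R) <= \1_(cube N.+1%:R) x.
    rewrite !indicE ler_nat; case: (boolP (x \in cube N%:R)) => // /[!inE] h.
    rewrite mem_set// => i; apply: le_trans (h i) _; by rewrite ler_nat.
  apply: integral_orthants_eq0.
    apply: (le_integrable measurableT _ _ I1); first exact/measurable_EFinP.
    move=> x _ /=; rewrite lee_fin !normrM ler_wpM2l//.
    by rewrite !ger0_norm ?cube1// indicE.
  move=> b; have mb := measurable_orthant b.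
  pose f_ k x := (r x * tent b N k x)%:E.
  have mf k : measurable_fun setT (f_ k).
    by apply/measurable_EFinP; apply: measurable_funM => //; exact: measurable_tent.
  have I0 k : (\int[mu]_x f_ k x = 0)%E.
    have [w Dw wE] := tent_form_dom b N k.
    have := orth w Dw; rewrite /L2dot /Rintegral => h.
    have := integrable_fin_num measurableT (L2_mul_integrable r w).
    rewrite (eq_integral (f_ k)); last by move=> x _; rewrite /f_ /= wE.
    move: h; rewrite (eq_integral (f_ k)); last by move=> x _; rewrite /f_ /= wE.
    by move=> h /fineK <-; rewrite h.
  have [_ _ lim0] : [/\ mu.-integrable setT (fun x => (r x * \1_(orthant b `&` cube N%:R) x)%:E),
      [sequence \int[mu]_x `|f_ k x - (r x * \1_(orthant b `&` cube N%:R) x)%:E|]_k @ \oo --> 0 &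
      [sequence \int[mu]_x f_ k x]_k @ \oo --> \int[mu]_x (r x * \1_(orthant b `&` cube N%:R) x)%:E]%E.
    apply: (@dominated_convergence _ _ _ mu setT measurableT f_ _
      (fun x => `|(r x * \1_(cube N.+1%:R) x)%:E|%E)) => //.
    - apply/measurable_EFinP; apply: measurable_funM => //.
      by apply: measurable_indic; exact: measurableI.
    - apply: aeW => x _; apply: cvg_EFin; first exact: nearW.
      by apply: cvgM; [exact: cvg_cst|exact: tent_cvg].
    - exact: (integrable_abse I1).
    - apply: aeW => x k _; rewrite /f_ lee_fin !normrM ler_wpM2l//.
      rewrite ger0_norm ?tent_ge0// indicE.
      case: (boolP (x \in _)) => [_|xB]; first by rewrite normr1 tent_le1.
      by rewrite tent_support ?normr0// -notin_setE.
  rewrite integral_mkcond.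
  transitivity (\int[mu]_x (r x * \1_(orthant b `&` cube N%:R) x)%:E)%E.
    apply: eq_integral => x _; rewrite patchE !indicE in_setI.
    by case: (x \in orthant b); rewrite ?mulr0.
  apply: (cvg_unique (@ereal_hausdorff R) lim0).
  rewrite (_ : [sequence _]_k = cst 0%E); first exact: cvg_cst.
  by apply/funext => k /=; exact: I0.
have : \forall x \ae mu, forall N : nat, r x * \1_(cube N%:R) x = 0 by exact: ae_foralln.
apply: filterS => x rx.
have := rx (Num.bound (\sum_i `|x ord0 i|)); rewrite indicE mem_set ?mulr1// => i.
apply: le_trans (_ : \sum_i `|x ord0 i| <= _); last by apply/ltW/unstable.ltr_bound.
by rewrite (bigD1 i)//= lerDl sumr_ge0.
Qed.

Theorem form_domain_dense (f : L2 mu) (e : R) : 0 < e ->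
  exists2 u : L2 mu, (form_value Phi W u < +oo)%E & L2norm (f - u) < e.
Proof.
move: f e; have H := form_closed Phi_B0 mW.
apply: (@dense_of_orthogonal _ _ _ mu [set u | (form_value Phi W u < +oo)%E]).
- exact: (cf_dom0 H).
- exact: (cf_domD H).
- exact: (cf_domZ H).
- exact: orthogonal_form_dom_eq0.
Qed.

End form_domain.
End tents.

(** * Positive Fourier integrals: Gaussians *)

Section dot_product.
Context {R : realType} {d : nat}.
Implicit Types u v w : 'rV[R]_d.

Lemma edotC u v : edot u v = edot v u.
Proof. by apply: eq_bigr => i _; rewrite mulrC. Qed.

Lemma edotDl u v w : edot (u + v) w = edot u w + edot v w.
Proof. by rewrite /edot -big_split /=; apply: eq_bigr => i _; rewrite mxE mulrDl. Qed.

Lemma edotDr u v w : edot w (u + v) = edot w u + edot w v.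
Proof. by rewrite edotC edotDl !(edotC w). Qed.

Lemma edotZl a u w : edot (a *: u) w = a * edot u w.
Proof. by rewrite /edot big_distrr /=; apply: eq_bigr => i _; rewrite mxE mulrA. Qed.

Lemma edotZr a u w : edot w (a *: u) = a * edot w u.
Proof. by rewrite edotC edotZl edotC. Qed.

End dot_product.

Section gaussian_transform.
Context {R : realType} {d : nat}.
Local Notation T := 'rV[R]_d.
Local Notation mu := (lebesgue_rV d : {measure set 'rV[R]_d -> \bar R}).

Lemma measurable_cos : measurable_fun setT (@cos R).
Proof. by apply: continuous_measurable_fun; exact: continuous_cos. Qed.

Lemma measurable_sin : measurable_fun setT (@sin R).
Proof. by apply: continuous_measurable_fun; exact: continuous_sin. Qed.

Lemma measurable_cos_edot (x : T) : measurable_fun setT (fun xi : T => cos (edot x xi)).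
Proof. by apply: (measurableT_comp measurable_cos); exact: measurable_edot. Qed.

Lemma measurable_sin_edot (x : T) : measurable_fun setT (fun xi : T => sin (edot x xi)).
Proof. by apply: (measurableT_comp measurable_sin); exact: measurable_edot. Qed.

Lemma integral_rV_shift_signed (h : T) (f : T -> \bar R) : measurable_fun setT f ->
  (\int[mu]_x f (x + h)%R = \int[mu]_x f x)%E.
Proof.
move=> mf; rewrite integralE [RHS]integralE.
rewrite -(integral_rV_shift h (measurable_funepos mf) (funepos_ge0 f)).
rewrite -(integral_rV_shift h (measurable_funeneg mf) (funeneg_ge0 f)).
by congr (_ - _)%E; apply: eq_integral => x _; rewrite ?funeposE ?funenegE.
Qed.

Lemma integrable_dominated (f g : T -> R) : measurable_fun setT f ->
  mu.-integrable setT (EFin \o g) -> (forall x, `|f x| <= g x) ->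
  mu.-integrable setT (EFin \o f).
Proof.
move=> mf ig fg; apply: (le_integrable measurableT _ _ ig); first exact/measurable_EFinP.
by move=> x _ /=; rewrite lee_fin; apply: le_trans (fg x) (ler_norm _).
Qed.

Lemma gauss_integrable (a : R) : 0 < a ->
  mu.-integrable setT (EFin \o (fun xi : T => expR (- (a * edot xi xi)))).
Proof.
move=> a0; apply/integrableP; split; first by apply/measurable_EFinP; exact: measurable_gauss.
under eq_integral do rewrite /= ger0_norm ?expR_ge0//.
by rewrite integral_gauss_rV// ltry.
Qed.

Lemma bounded_gauss_integrable (a C : R) (F : T -> R) : 0 < a -> measurable_fun setT F ->
  (forall xi, `|F xi| <= C) ->
  mu.-integrable setT (EFin \o (fun xi => F xi * expR (- (a * edot xi xi)))).
Proof.
move=> a0 mF FC.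
apply: (@integrable_dominated _ (fun xi => C * expR (- (a * edot xi xi)))).
- by apply: measurable_funM => //; exact: measurable_gauss.
- rewrite (_ : EFin \o _ = (fun xi => C%:E * (expR (- (a * edot xi xi)))%:E)%E); last first.
    by apply/funext => xi /=; rewrite EFinM.
  by apply: integrableZl => //; exact: gauss_integrable.
- by move=> xi; rewrite normrM [X in _ * X]ger0_norm ?expR_ge0// ler_wpM2r ?expR_ge0.
Qed.

Variable x : T.

(** The Fourier integral of [F] at [x], damped by a Gaussian so that every bounded
    [F] qualifies; the damping is removed at the end by letting [a] tend to 0. *)
Definition wave (a : R) (F : T -> R) : \bar R :=
  (\int[mu]_xi (cos (edot x xi) * F xi * expR (- (a * edot xi xi)))%:E)%E.

(** Requiring positivity for every [a > 0] makes the class of such [F] stable under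
    multiplication by Gaussians, and therefore by mixtures of Gaussians. *)
Definition wave_nonneg (F : T -> R) := forall a, 0 < a -> (0 <= wave a F)%E.

Lemma wave_integrable (a C : R) (F : T -> R) : 0 < a -> measurable_fun setT F ->
  (forall xi, `|F xi| <= C) ->
  mu.-integrable setT (EFin \o (fun xi => cos (edot x xi) * F xi * expR (- (a * edot xi xi)))).
Proof.
move=> a0 mF FC; apply: (@bounded_gauss_integrable a C (fun xi => cos (edot x xi) * F xi)) => //.
  by apply: measurable_funM => //; exact: measurable_cos_edot.
move=> xi; rewrite normrM -[leRHS]mul1r; apply: ler_pM => //; exact: cos_max.
Qed.

(** The parallelogram law, in the centre [e + z / 2]. *)
Lemma gauss_autocorrelation (a : R) (z e : T) :
  expR (- (2 * a * edot (z + e) (z + e))) * expR (- (2 * a * edot e e)) =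
  expR (- (a * edot z z)) * expR (- (4 * a * edot (e + 2^-1 *: z) (e + 2^-1 *: z))).
Proof.
rewrite -!expRD !edotDl !edotDr !edotZl !edotZr (edotC e z); congr expR; by field.
Qed.

(** A Gaussian is, up to a constant, the autocorrelation of a narrower Gaussian
    [g], and the Fourier integral of an autocorrelation is the squared modulus of
    the Fourier integral of [g], that is [A^2 + B^2] below. *)
Lemma wave_gauss_nonneg : wave_nonneg (cst 1).
Proof.
move=> a a0; have a20 : 0 < 2 * a by rewrite mulr_gt0.
have a40 : 0 < 4 * a by rewrite mulr_gt0.
pose g (xi : T) := expR (- (2 * a * edot xi xi)).
have mg : measurable_fun setT g := measurable_gauss (n := d) (2 * a).
have g0 xi : 0 <= g xi by exact: expR_ge0.
have Ig : mu.-integrable setT (EFin \o g) := gauss_integrable a20.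
pose f (p : T * T) := cos (edot x p.2) * (g (p.2 + p.1) * g p.1).
have mgs : measurable_fun setT (fun p : T * T => g (p.2 + p.1)).
  by apply: (measurableT_comp mg); exact: measurable_rV_fun_add.
have mg1 : measurable_fun setT (fun p : T * T => g p.1) by exact: measurableT_comp.
have mf : measurable_fun setT (EFin \o f).
  apply/measurable_EFinP; apply: measurable_funM; last exact: measurable_funM.
  by apply: (measurableT_comp (measurable_cos_edot x)).
pose Gv := (\int[mu]_xi (g xi)%:E)%E.
have Gfin : (Gv \is a fin_num)%E by exact: integrable_fin_num.
have If : (lebesgue_rV d \x lebesgue_rV d)%E.-integrable setT (EFin \o f).
  apply/integrable12ltyP => //.
  apply: (@le_lt_trans _ _ (\int[mu]_e (Gv * (g e)%:E))%E).
    apply: le_ge0_integral => e _; first by exact: integral_ge0.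
    apply: (@le_trans _ _ (\int[mu]_z ((g (z + e)%R)%:E * (g e)%:E))%E).
      apply: le_ge0_integral => z _; first by rewrite lee_fin.
      rewrite -EFinM lee_fin /f /= normrM -[leRHS]mul1r.
      by apply: ler_pM => //; [exact: cos_max|rewrite ger0_norm// mulr_ge0].
    rewrite ge0_integralZr//.
    - by rewrite (integral_rV_shift e (f := fun z => (g z)%:E))//; exact/measurable_EFinP.
    - by apply/measurable_EFinP; apply: (measurableT_comp mg); exact: measurable_rV_shift.
    - by move=> z _; rewrite lee_fin.
    - by rewrite lee_fin.
  rewrite ge0_integralZl//.
  - by rewrite -/Gv -(fineK Gfin) -EFinM ltry.
  - exact/measurable_EFinP.
  - by move=> z _; rewrite lee_fin.
  - by apply: integral_ge0 => z _; rewrite lee_fin.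
have := Fubini If.
have mc := measurable_cos_edot x; have ms := measurable_sin_edot x.
have Ic : mu.-integrable setT (EFin \o (fun xi => cos (edot x xi) * g xi)).
  by apply: (bounded_gauss_integrable (C := 1)) => // xi; exact: cos_max.
have Is : mu.-integrable setT (EFin \o (fun xi => sin (edot x xi) * g xi)).
  by apply: (bounded_gauss_integrable (C := 1)) => // xi; exact: sin_max.
pose A := fine (\int[mu]_xi (cos (edot x xi) * g xi)%:E)%E.
pose B := fine (\int[mu]_xi (sin (edot x xi) * g xi)%:E)%E.
have AE : (\int[mu]_xi (cos (edot x xi) * g xi)%:E = A%:E)%E.
  by rewrite fineK//; exact: (integrable_fin_num measurableT Ic).
have BE : (\int[mu]_xi (sin (edot x xi) * g xi)%:E = B%:E)%E.
  by rewrite fineK//; exact: (integrable_fin_num measurableT Is).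
have IZ (h : T -> R) (r : R) : mu.-integrable setT (EFin \o h) ->
    mu.-integrable setT (EFin \o (fun xi => r * h xi)).
  move=> Ih; rewrite (_ : EFin \o _ = (fun xi => r%:E * (h xi)%:E)%E).
    exact: integrableZl.
  by apply/funext => xi /=; rewrite EFinM.
have lin (h1 h2 : T -> R) (r1 r2 : R) : mu.-integrable setT (EFin \o h1) ->
    mu.-integrable setT (EFin \o h2) ->
    (\int[mu]_xi (r1 * h1 xi + r2 * h2 xi)%:E =
     r1%:E * \int[mu]_xi (h1 xi)%:E + r2%:E * \int[mu]_xi (h2 xi)%:E)%E.
  move=> I1 I2; rewrite integralD_EFin//; [|exact: IZ|exact: IZ].
  by congr (_ + _)%E; rewrite -integralZl//; apply: eq_integral => xi _; rewrite EFinM.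
have inner1 e : (\int[mu]_z (f (e, z))%:E =
    (A * (cos (edot x e) * g e) + B * (sin (edot x e) * g e))%:E)%E.
  transitivity (\int[mu]_xi (cos (edot x e) * g e * (cos (edot x xi) * g xi) +
      sin (edot x e) * g e * (sin (edot x xi) * g xi))%:E)%E; last first.
    by rewrite lin// AE BE -!EFinM -EFinD; congr (_%:E); ring.
  rewrite -[RHS](integral_rV_shift_signed e); last first.
    apply/measurable_EFinP; apply: measurable_funD; apply: measurable_funM => //;
      exact: measurable_funM.
  apply: eq_integral => z _; congr (_%:E); rewrite /f /=.
  have -> : edot x z = edot x (z + e) - edot x e by rewrite edotDr addrK.
  by rewrite cosB; ring.
have outer1 : (\int[mu]_e \int[mu]_z (f (e, z))%:E = (A ^+ 2 + B ^+ 2)%:E)%E.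
  by under eq_integral do rewrite inner1; rewrite lin// AE BE -!EFinM -EFinD.
pose C := fine (\int[mu]_e (expR (- (4 * a * edot e e)))%:E)%E.
have CE : (\int[mu]_e (expR (- (4 * a * edot e e)))%:E = C%:E)%E.
  by rewrite fineK//; exact: (integrable_fin_num measurableT (gauss_integrable a40)).
have inner2 z : (\int[mu]_e (f (e, z))%:E =
    C%:E * (cos (edot x z) * cst 1 z * expR (- (a * edot z z)))%:E)%E.
  under eq_integral => e _.
    rewrite /f /= gauss_autocorrelation mulrA EFinM; over.
  rewrite integralZl//.
    rewrite (integral_rV_shift (2^-1 *: z) (f := fun e => (expR (- (4 * a * edot e e)))%:E))//.
      by rewrite CE muleC; congr (_ * _%:E)%E; rewrite /cst mulr1.
    by apply/measurable_EFinP; exact: measurable_gauss.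
  apply/integrableP; split.
    apply/measurable_EFinP.
    by apply: (measurableT_comp (@measurable_gauss R d (4 * a))); exact: measurable_rV_shift.
  under eq_integral do rewrite /= ger0_norm ?expR_ge0//.
  rewrite (integral_rV_shift (2^-1 *: z) (f := fun e => (expR (- (4 * a * edot e e)))%:E))//.
    by rewrite CE ltry.
  by apply/measurable_EFinP; exact: measurable_gauss.
rewrite /= outer1.
under eq_integral do rewrite inner2.
rewrite integralZl//; last first.
  by apply: (wave_integrable (C := 1)) => // xi; rewrite normr1.
move=> E; have C0 : 0 < C.
  by rewrite -lte_fin -CE integral_gauss_rV// lte_fin exprn_gt0// sqrtr_gt0 divr_gt0// pi_gt0.
rewrite -(@pmule_rge0 _ C%:E) ?lte_fin// /wave -E lee_fin.
by rewrite addr_ge0 ?sqr_ge0.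
Qed.

End gaussian_transform.

(** * Positive Fourier integrals: mixtures and exponentials *)

Section mixtures.
Context {R : realType} {d : nat}.
Local Notation T := 'rV[R]_d.
Local Notation mu := (lebesgue_rV d : {measure set 'rV[R]_d -> \bar R}).
Local Notation leb := (@lebesgue_measure R).
Variable x : T.

Lemma wave_nonneg_addM (F G : T -> R) (C c : R) :
  measurable_fun setT F -> measurable_fun setT G ->
  (forall xi, `|F xi| <= C) -> (forall xi, `|G xi| <= C) -> 0 <= c ->
  wave_nonneg x F -> wave_nonneg x G -> wave_nonneg x (fun xi => F xi + c * G xi).
Proof.
move=> mF mG FC GC c0 pF pG a a0.
have IF := wave_integrable x a0 mF FC; have IG := wave_integrable x a0 mG GC.
have IcG : mu.-integrable setT (fun xi =>
    (c%:E * (cos (edot x xi) * G xi * expR (- (a * edot xi xi)))%:E)%E).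
  exact: integrableZl.
rewrite /wave.
have -> : (\int[mu]_xi (cos (edot x xi) * (F xi + c * G xi) * expR (- (a * edot xi xi)))%:E =
    wave x a F + c%:E * wave x a G)%E.
  rewrite /wave -integralZl// -integralD//.
  by apply: eq_integral => xi _; rewrite -EFinM -EFinD; congr (_%:E); ring.
by rewrite adde_ge0 ?mule_ge0 ?lee_fin// ?pF ?pG.
Qed.

Lemma wave_nonneg_lim (F_ : nat -> T -> R) (F : T -> R) (C : R) :
  (forall k, measurable_fun setT (F_ k)) -> measurable_fun setT F ->
  (forall k xi, `|F_ k xi| <= C) ->
  (\forall xi \ae mu, F_ k xi @[k --> \oo] --> F xi) ->
  (forall k, wave_nonneg x (F_ k)) -> wave_nonneg x F.
Proof.
move=> mF_ mF FC Fcvg pF a a0.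
have C0 : 0 <= C by apply: le_trans (FC 0%N 0).
pose w (G : T -> R) xi := (cos (edot x xi) * G xi * expR (- (a * edot xi xi)))%:E : \bar R.
have mw G : measurable_fun setT G -> measurable_fun setT (w G).
  move=> mG; apply/measurable_EFinP; apply: measurable_funM; last exact: measurable_gauss.
  by apply: measurable_funM => //; exact: measurable_cos_edot.
have [_ _ lim] : [/\ mu.-integrable setT (w F),
    [sequence \int[mu]_xi `|w (F_ k) xi - w F xi|]_k @ \oo --> 0 &
    [sequence \int[mu]_xi w (F_ k) xi]_k @ \oo --> \int[mu]_xi w F xi]%E.
  apply: (@dominated_convergence _ _ _ mu setT measurableT (fun k => w (F_ k)) (w F)
    (fun xi => (C * expR (- (a * edot xi xi)))%:E)) => //.
  - by move=> k; exact: mw.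
  - exact: mw.
  - apply: filterS Fcvg => xi Fx _; apply: cvg_EFin; first exact: nearW.
    by apply: cvgM; [apply: cvgM => //; exact: cvg_cst|exact: cvg_cst].
  - by apply: (@bounded_gauss_integrable _ _ a C (cst C)) => // xi; rewrite ger0_norm.
  - apply: aeW => xi k _; rewrite /w lee_fin normrM [X in _ * X <= _]ger0_norm ?expR_ge0//.
    rewrite ler_wpM2r ?expR_ge0// normrM -[leRHS]mul1r; apply: ler_pM => //.
    exact: cos_max.
rewrite /wave -/(w F) -(cvg_lim (@ereal_hausdorff R) lim).
apply: lime_ge; first by apply/cvg_ex; eexists; exact: lim.
by apply: nearW => k; exact: pF.
Qed.

Section laplace.
Variable n : R -> R.
Hypothesis mn : measurable_fun setT n.
Hypothesis n0 : forall t, 0 <= n t.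
Hypothesis n_pos : forall t, t <= 0 -> n t = 0.
Hypothesis n_fin : (\int[leb]_t (n t)%:E < +oo)%E.

(** The Laplace transform of the finite measure with density [n], at [|xi|^2]: a
    mixture of Gaussians in [xi]. *)
Definition laplace_sq (xi : T) : R :=
  fine (\int[leb]_t (expR (- (t * edot xi xi)) * n t)%:E)%E.

Definition mass : R := fine (\int[leb]_t (n t)%:E)%E.

Let kern_le (xi : T) t : expR (- (t * edot xi xi)) * n t <= n t.
Proof.
have [t0|t0] := leP t 0; first by rewrite n_pos// mulr0.
by rewrite ler_piMl// -expR0 ler_expR oppr_le0 mulr_ge0 ?edot_ge0// ltW.
Qed.

Let kern_ge0 (xi : T) t : 0 <= expR (- (t * edot xi xi)) * n t.
Proof. by rewrite mulr_ge0// expR_ge0. Qed.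

Let mkern : measurable_fun setT (fun p : T * measurableTypeR R =>
  expR (- (p.2 * edot p.1 p.1)) * n p.2).
Proof.
apply: measurable_funM; last exact: measurableT_comp.
apply: measurableT_comp => //; apply: measurableT_comp => //.
by apply: measurable_funM => //; exact: measurable_edot.
Qed.

Lemma laplace_integrable (xi : T) :
  leb.-integrable setT (EFin \o (fun t => expR (- (t * edot xi xi)) * n t)).
Proof.
apply/integrableP; split.
  by apply/measurable_EFinP; exact: (measurableT_comp mkern (pair1_measurable xi)).
apply: le_lt_trans n_fin; apply: le_ge0_integral => t _; first exact: abse_ge0.
by rewrite /= lee_fin ger0_norm ?kern_ge0// kern_le.
Qed.

Lemma laplace_sqE xi :
  (\int[leb]_t (expR (- (t * edot xi xi)) * n t)%:E = (laplace_sq xi)%:E)%E.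
Proof. by rewrite fineK//; exact: (integrable_fin_num measurableT (laplace_integrable xi)). Qed.

Lemma laplace_sq_ge0 xi : 0 <= laplace_sq xi.
Proof. by rewrite fine_ge0// integral_ge0// => t _; rewrite lee_fin kern_ge0. Qed.

Lemma mass_ge0 : 0 <= mass.
Proof. by rewrite fine_ge0// integral_ge0// => t _; rewrite lee_fin. Qed.

Lemma massE : (\int[leb]_t (n t)%:E = mass%:E)%E.
Proof. by rewrite fineK// ge0_fin_numE// integral_ge0// => t _; rewrite lee_fin. Qed.

Lemma laplace_sq_le xi : laplace_sq xi <= mass.
Proof.
rewrite -lee_fin -laplace_sqE -massE; apply: le_ge0_integral => t _; rewrite lee_fin.
  exact: kern_ge0.
exact: kern_le.
Qed.

Lemma measurable_laplace_sq : measurable_fun setT laplace_sq.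
Proof.
apply: measurableT_comp => //.
apply: (measurable_fun_fubini_tonelli_F (m2 := leb)
  (fun p : T * R => (expR (- (p.2 * edot p.1 p.1)) * n p.2)%:E)).
  by apply/measurable_EFinP; exact: mkern.
by move=> p; rewrite lee_fin kern_ge0.
Qed.

(** Under the mixing integral the damping [a] becomes [a + t]. *)
Lemma wave_nonneg_laplace (F : T -> R) (C : R) : measurable_fun setT F ->
  (forall xi, `|F xi| <= C) -> wave_nonneg x F ->
  wave_nonneg x (fun xi => F xi * laplace_sq xi).
Proof.
move=> mF FC pF a a0.
have C0 : 0 <= C by apply: le_trans (FC 0).
pose c xi := cos (edot x xi) * F xi * expR (- (a * edot xi xi)).
have mc : measurable_fun setT c.
  apply: measurable_funM; last exact: measurable_gauss.
  by apply: measurable_funM => //; exact: measurable_cos_edot.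
have cC xi : `|c xi| <= C * expR (- (a * edot xi xi)).
  rewrite normrM [X in _ * X <= _]ger0_norm ?expR_ge0//.
  rewrite ler_wpM2r ?expR_ge0// normrM -[leRHS]mul1r; apply: ler_pM => //.
  exact: cos_max.
pose f (p : T * measurableTypeR R) := (c p.1 * (expR (- (p.2 * edot p.1 p.1)) * n p.2))%:E : \bar R.
have mf : measurable_fun setT f.
  apply/measurable_EFinP; apply: measurable_funM; last exact: mkern.
  exact: measurableT_comp.
have If : (lebesgue_rV d \x leb)%E.-integrable setT f.
  apply/(integrable12ltyP (lebesgue_rV d) leb mf).
  apply: (@le_lt_trans _ _ (\int[mu]_xi (mass%:E * (C * expR (- (a * edot xi xi)))%:E))%E).
    apply: le_ge0_integral => xi _; first by apply: integral_ge0.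
    rewrite -massE -ge0_integralZr//.
    - apply: le_ge0_integral => t _; first exact: abse_ge0.
      rewrite /f /= lee_fin normrM mulrC; apply: ler_pM => //.
      by rewrite ger0_norm ?kern_ge0// kern_le.
    - exact/measurable_EFinP.
    - by move=> t _; rewrite lee_fin.
    - by rewrite lee_fin mulr_ge0// expR_ge0.
  rewrite ge0_integralZl//.
  - under eq_integral do rewrite EFinM.
    rewrite ge0_integralZl//.
    + by rewrite integral_gauss_rV// -!EFinM ltry.
    + by apply/measurable_EFinP; exact: measurable_gauss.
  - apply/measurable_EFinP; apply: measurable_funM => //; exact: measurable_gauss.
  - by move=> xi _; rewrite lee_fin mulr_ge0// expR_ge0.
  - by rewrite lee_fin mass_ge0.
have E : wave x a (fun xi => F xi * laplace_sq xi) = (\int[mu]_xi \int[leb]_t f (xi, t))%E.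
  apply: eq_integral => xi _; rewrite /f /=.
  under [RHS]eq_integral do rewrite EFinM.
  rewrite integralZl//; last exact: laplace_integrable.
  by rewrite laplace_sqE -EFinM /c; congr (_%:E); ring.
rewrite E (Fubini If); apply: integral_ge0 => t _.
have [t0|t0] := leP t 0.
  rewrite /f /= n_pos//.
  by under eq_integral do rewrite !mulr0; rewrite integral0.
have at0 : 0 < a + t by rewrite addr_gt0.
rewrite (_ : (\int[mu]_xi f (xi, t) = (n t)%:E * wave x (a + t) F)%E).
  by rewrite mule_ge0 ?lee_fin ?pF.
rewrite /wave -integralZl//; last exact: (wave_integrable x at0 mF FC).
apply: eq_integral => xi _; rewrite /f /c /= -EFinM mulrDl opprD expRD; congr (_%:E); ring.
Qed.

Lemma wave_nonneg_laplaceX k : wave_nonneg x (fun xi => laplace_sq xi ^+ k).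
Proof.
elim: k => [|k IH]; first exact: wave_gauss_nonneg.
rewrite (_ : (fun _ => _) = (fun xi => laplace_sq xi ^+ k * laplace_sq xi)); last first.
  by apply/funext => xi; rewrite exprSr.
apply: (wave_nonneg_laplace (C := mass ^+ k)) => //.
  by apply: measurable_funX; exact: measurable_laplace_sq.
move=> xi; rewrite ger0_norm ?exprn_ge0 ?laplace_sq_ge0//.
by rewrite lerXn2r ?nnegrE ?laplace_sq_ge0 ?mass_ge0 ?laplace_sq_le.
Qed.

Lemma exp_partial_le (y : R) k : 0 <= y -> series (exp_coeff y) k <= expR y.
Proof.
move=> y0; rewrite /expR; apply: nondecreasing_cvgn_le; last exact: is_cvg_series_exp_coeff.
by apply: nondecreasing_series => i *; exact: exp_coeff_ge0.
Qed.

(** Through the exponential series, whose partial sums are bounded by the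
    exponential of the total mass. *)
Lemma wave_nonneg_exp_laplace s : 0 <= s ->
  wave_nonneg x (fun xi => expR (s * laplace_sq xi)).
Proof.
move=> s0.
have y0 xi : 0 <= s * laplace_sq xi by rewrite mulr_ge0 ?laplace_sq_ge0.
have S0 k xi : 0 <= series (exp_coeff (s * laplace_sq xi)) k.
  by rewrite /series sumr_ge0// => i _; exact: exp_coeff_ge0.
have Sb k xi : `|series (exp_coeff (s * laplace_sq xi)) k| <= expR (s * mass).
  rewrite ger0_norm//; apply: le_trans (exp_partial_le _ (y0 xi)) _.
  by rewrite ler_expR ler_wpM2l// laplace_sq_le.
have mpow k : measurable_fun setT (fun xi => laplace_sq xi ^+ k).
  by apply: measurable_funX; exact: measurable_laplace_sq.
have mS k : measurable_fun setT (fun xi => series (exp_coeff (s * laplace_sq xi)) k).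
  apply: measurable_sum => i; apply: measurable_funM => //; apply: measurable_funX.
  by apply: measurable_funM => //; exact: measurable_laplace_sq.
apply: (@wave_nonneg_lim (fun k xi => series (exp_coeff (s * laplace_sq xi)) k) _
  (expR (s * mass))) => //.
- apply: measurableT_comp => //; apply: measurable_funM => //.
  exact: measurable_laplace_sq.
- by apply: aeW => xi; exact: is_cvg_series_exp_coeff.
elim=> [|k IH].
  move=> a a0; rewrite /wave.
  under eq_integral do rewrite /series /= big_geq// mulr0 mul0r.
  by rewrite integral0.
rewrite (_ : (fun _ => _) = (fun xi => series (exp_coeff (s * laplace_sq xi)) k +
    s ^+ k / k`!%:R * laplace_sq xi ^+ k)); last first.
  apply/funext => xi; rewrite /series /= big_nat_recr//=; congr (_ + _).
  by rewrite /exp_coeff /= exprMn; ring.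
apply: (wave_nonneg_addM (C := Num.max (expR (s * mass)) (mass ^+ k))) => //.
- by move=> xi; rewrite le_max Sb.
- move=> xi; rewrite le_max ger0_norm ?exprn_ge0 ?laplace_sq_ge0//.
  by rewrite lerXn2r ?nnegrE ?laplace_sq_ge0 ?mass_ge0 ?laplace_sq_le ?orbT.
- by rewrite divr_ge0 ?exprn_ge0.
- exact: wave_nonneg_laplaceX.
Qed.

Lemma wave_nonneg_exp_truncated s : 0 <= s ->
  wave_nonneg x (fun xi => expR (- (s * (mass - laplace_sq xi)))).
Proof.
move=> s0 a a0; have := wave_nonneg_exp_laplace s0 a0.
have I : mu.-integrable setT (EFin \o (fun xi => cos (edot x xi) *
    expR (s * laplace_sq xi) * expR (- (a * edot xi xi)))).
  apply: (@wave_integrable _ _ x a (expR (s * mass))) => //.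
    apply: measurableT_comp => //; apply: measurable_funM => //.
    exact: measurable_laplace_sq.
  move=> xi; rewrite ger0_norm ?expR_ge0// ler_expR ler_wpM2l//.
  exact: laplace_sq_le.
move=> h; rewrite (_ : wave _ _ _ = (expR (- (s * mass)))%:E *
    wave x a (fun xi => expR (s * laplace_sq xi)))%E.
  by rewrite mule_ge0.
rewrite /wave -integralZl//; apply: eq_integral => xi _.
rewrite mulrBr opprB expRD -EFinM; congr (_%:E); ring.
Qed.

End laplace.
End mixtures.

(** * The heat multiplier *)

Section symbol.
Context {R : realType} {d : nat}.
Hypothesis d_gt0 : (0 < d)%N.
Variable Phi : R -> R.
Hypothesis Phi_B0 : B0 Phi.
Local Notation T := 'rV[R]_d.
Local Notation mu := (lebesgue_rV d : {measure set 'rV[R]_d -> \bar R}).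
Local Notation leb := (@lebesgue_measure R).

Lemma ae_edot_gt0 : \forall xi \ae mu, 0 < edot xi xi.
Proof.
case: d d_gt0 => // n _.
exists [set x : 'rV[R]_n.+1 | x ord0 ord0 = 0]; split.
- rewrite (_ : [set _ | _] = setT `&` (rV_coord (R := R) ord0 @^-1` [set 0])); last first.
    by apply/seteqP; split => x /=; [move=> h; split|case].
  by apply: measurable_rV_coord => //; exact: measurable_set1.
- exact: lebesgue_rV_coord0.
- move=> x /= x0; apply/eqP; apply: contra_notT x0 => x0.
  rewrite lt0r edot_ge0 andbT /edot; apply: contra x0.
  rewrite psumr_eq0; last by move=> i _; rewrite -expr2 sqr_ge0.
  by move=> /allP /(_ ord0 (mem_index_enum _)); rewrite /= mulf_eq0 orbb.
Qed.

(** [Phi (|xi|^2)], with the value 0 instead of [Phi 0] at the origin, where nothing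
    is known about [Phi]; this keeps the function measurable and non-negative. *)
Definition symbol (xi : T) : R := (Phi \_ (`]0, +oo[%classic : set R)) (edot xi xi).

Lemma symbolE xi : symbol xi = if 0 < edot xi xi then Phi (edot xi xi) else 0.
Proof.
rewrite /symbol patchE; congr (if _ then _ else _).
by apply/idP/idP; rewrite inE /= in_itv/= andbT.
Qed.

Lemma symbol_ge0 xi : 0 <= symbol xi.
Proof.
rewrite symbolE; case: ifPn => // x0; have [[_ + _] _ _] := levy_densityP Phi_B0.
exact.
Qed.

Lemma measurable_symbol : measurable_fun setT symbol.
Proof.
apply: (@measurableT_comp _ _ _ _ _ _ (Phi \_ (`]0, +oo[%classic : set R)) setT (fun xi : T => edot xi xi)).
  apply/(measurable_restrictT _ _).1; first exact: measurable_itv.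
  by apply: smooth_pos_measurable; have [[]] := levy_densityP Phi_B0.
exact: measurable_edot.
Qed.

Definition heat_multiplier (s : R) (xi : T) : R := expR (- (s * symbol xi)).

Lemma measurable_heat_multiplier s : measurable_fun setT (heat_multiplier s).
Proof.
apply: measurableT_comp => //; apply: measurableT_comp => //.
by apply: measurable_funM => //; exact: measurable_symbol.
Qed.

Lemma heat_multiplier_ae s :
  \forall xi \ae mu, heat_multiplier s xi = expR (- (s * Phi (enorm xi ^+ 2))).
Proof.
by apply: filterS ae_edot_gt0 => xi x0; rewrite /heat_multiplier symbolE x0 enorm_sqr.
Qed.

(** Removing the small jumps makes the Levy measure finite. *)
Definition truncated_levy (k : nat) (t : R) : R :=
  if k.+1%:R^-1 <= t then levy0 Phi t else 0.

Lemma measurable_truncated_levy k : measurable_fun setT (truncated_levy k).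
Proof.
apply: measurable_fun_ifT => //; last exact: measurable_levy0.
exact: measurable_fun_ler.
Qed.

Lemma truncated_levy_ge0 k t : 0 <= truncated_levy k t.
Proof. by rewrite /truncated_levy; case: ifPn => // _; exact: levy0_ge0. Qed.

Lemma truncated_levy_neg k t : t <= 0 -> truncated_levy k t = 0.
Proof.
move=> t0; rewrite /truncated_levy leNgt (le_lt_trans t0)// invr_gt0//.
Qed.

Lemma truncated_levy_lty k : (\int[leb]_t (truncated_levy k t)%:E < +oo)%E.
Proof.
apply: (@le_lt_trans _ _ (\int[leb]_t ((k.+1%:R : R)%:E * ((Num.min 1 `|t : R|)%:E * (levy0 Phi t)%:E)))%E).
  apply: le_ge0_integral => t _; first by rewrite lee_fin truncated_levy_ge0.
  rewrite -!EFinM lee_fin /truncated_levy.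
  have m0 : 0 <= Num.min 1 `|t| by rewrite le_min ler01 normr_ge0.
  case: ifPn => [kt|_]; last by rewrite !mulr_ge0// levy0_ge0.
  rewrite mulrA ler_peMl ?levy0_ge0//.
  have k1 : 1 <= k.+1%:R :> R by rewrite ler1n.
  have kt1 : 1 <= k.+1%:R * t by rewrite mulrC -ler_pdivrMr// div1r.
  have t0 : 0 <= t by apply: le_trans kt; rewrite invr_ge0.
  by rewrite ger0_norm//; case: (leP 1 t) => _; rewrite ?mulr1.
rewrite ge0_integralZl//.
- rewrite lte_mul_pinfty//.
  apply: le_lt_trans (levy0_min_lty Phi_B0); apply: le_ge0_integral => t _.
    by rewrite mule_ge0// lee_fin ?levy0_ge0// le_min ler01 normr_ge0.
  rewrite levy0E; case: ifPn => [t0|_]; last by rewrite !mule0.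
  by rewrite ger0_norm// ltW.
- apply: emeasurable_funM; apply/measurable_EFinP; last exact: measurable_levy0.
  by apply: measurable_minr => //; exact: measurableT_comp.
- by move=> t _; rewrite mule_ge0// lee_fin ?levy0_ge0// le_min ler01 normr_ge0.
Qed.

Let lap k := @laplace_sq R d (truncated_levy k).
Let mss k := mass (truncated_levy k).

(** By monotone convergence in the Levy-Khintchine formula. *)
Lemma truncated_exponent_cvg xi : 0 < edot xi xi ->
  mss k - lap k xi @[k --> \oo] --> symbol xi.
Proof.
move=> x0; set z := edot xi xi.
pose g k t := ((1 - expR (- (z * t))) * truncated_levy k t)%:E : \bar R.
have e1 t : 0 < t -> 0 <= 1 - expR (- (z * t)).
  by move=> t0; rewrite subr_ge0 -expR0 ler_expR oppr_le0 mulr_ge0// ?edot_ge0// ltW.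
have g0 k t : (0 <= g k t)%E.
  rewrite lee_fin; have [t0|t0] := leP t 0; first by rewrite truncated_levy_neg// mulr0.
  by rewrite mulr_ge0 ?truncated_levy_ge0 ?e1.
have mg k : measurable_fun setT (g k).
  apply/measurable_EFinP; apply: measurable_funM; last exact: measurable_truncated_levy.
  apply: measurable_funB => //; apply: measurableT_comp => //; apply: measurableT_comp => //.
have gE k : (\int[leb]_t g k t = (mss k - lap k xi)%:E)%E.
  rewrite EFinB -massE//; [|exact: truncated_levy_ge0|exact: truncated_levy_lty].
  rewrite -laplace_sqE; [|exact: measurable_truncated_levy|exact: truncated_levy_ge0|
    exact: truncated_levy_neg|exact: truncated_levy_lty].
  rewrite -integralB_EFin//.
  - by apply: eq_integral => t _; rewrite /g -/z (mulrC z); congr (_%:E); ring.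
  - apply/integrableP; split; first by apply/measurable_EFinP; exact: measurable_truncated_levy.
    apply: le_lt_trans (truncated_levy_lty k); apply: le_ge0_integral => t _; first exact: abse_ge0.
    by rewrite /= lee_fin ger0_norm ?truncated_levy_ge0.
  - apply: laplace_integrable; [exact: measurable_truncated_levy|exact: truncated_levy_ge0|
    exact: truncated_levy_neg|exact: truncated_levy_lty].
have lim : (\int[leb]_t g k t @[k --> \oo] --> \int[leb]_t ((1 - expR (- (z * t)))%:E * (levy0 Phi t)%:E))%E.
  have gl t : g k t @[k --> \oo] --> ((1 - expR (- (z * t)))%:E * (levy0 Phi t)%:E)%E.
    have [t0|t0] := leP t 0.
      rewrite levy0E ltNge t0 /= mule0 (_ : (fun _ => _) = cst 0%E); first exact: cvg_cst.
      by apply/funext => k; rewrite /g truncated_levy_neg// mulr0.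
    apply: cvg_near_cst; exists (Num.bound t^-1) => // k /= kt.
    rewrite /g /truncated_levy ifT ?EFinM// -[t in leRHS]invrK lef_pV2 ?posrE ?invr_gt0//.
    apply: le_trans (ltW (unstable.ltr_bound _)) _; rewrite ler_nat.
    exact: leq_trans kt _.
  under [X in _ --> X]eq_integral => t _ do rewrite -(cvg_lim _ (gl t))//.
  apply: (@cvg_monotone_convergence _ _ _ leb setT measurableT g) => //.
  move=> t _ k l kl; rewrite lee_fin; have [t0|t0] := leP t 0.
      by rewrite !truncated_levy_neg// !mulr0.
    rewrite ler_wpM2l ?e1// /truncated_levy; case: ifPn => [kt|_]; last first.
      by case: ifPn => // _; exact: levy0_ge0.
    by rewrite (le_trans _ kt)// lef_pV2 ?posrE// ler_nat.
move: lim; rewrite -bernstein_levy// symbolE x0 => /fine_cvg.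
by rewrite (_ : fine \o _ = (fun k => mss k - lap k xi))//; apply/funext => k /=; rewrite gE.
Qed.

(** For a finite Levy measure of mass [m] and Laplace transform [psi] the multiplier is
    [e^(-s m) e^(s psi)], which is covered by the exponential of a mixture of
    Gaussians; the general case follows in the limit of vanishing truncation. *)
Lemma heat_multiplier_wave_nonneg (x : T) s : 0 < s -> wave_nonneg x (heat_multiplier s).
Proof.
move=> s0.
apply: (@wave_nonneg_lim _ _ x (fun k xi => expR (- (s * (mss k - lap k xi)))) _ 1).
- move=> k; apply: measurableT_comp => //; apply: measurableT_comp => //.
  apply: measurable_funM => //; apply: measurable_funB => //.
  apply: measurable_laplace_sq; [exact: measurable_truncated_levy|exact: truncated_levy_ge0].
- exact: measurable_heat_multiplier.
- move=> k xi; rewrite ger0_norm ?expR_ge0// -expR0 ler_expR oppr_le0.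
  apply: mulr_ge0; first exact: ltW.
  rewrite subr_ge0; apply: laplace_sq_le;
    [exact: measurable_truncated_levy|exact: truncated_levy_ge0|
    exact: truncated_levy_neg|exact: truncated_levy_lty].
- apply: filterS ae_edot_gt0 => xi x0.
  apply: (cvg_comp (fun k => - (s * (mss k - lap k xi))) expR _ (@continuous_expR R _)).
  by apply: cvgN; apply: cvgM; [exact: cvg_cst|exact: truncated_exponent_cvg].
- move=> k; apply: wave_nonneg_exp_truncated; [exact: measurable_truncated_levy|
    exact: truncated_levy_ge0|exact: truncated_levy_neg|exact: truncated_levy_lty|exact: ltW].
Qed.

End symbol.

(** * The heat kernel near the origin *)

Section heat_kernel_near_zero.
Context {R : realType} {d : nat}.
Hypothesis d_gt0 : (0 < d)%N.
Variable Phi : R -> R.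
Hypothesis Phi_B0 : B0 Phi.
Local Notation T := 'rV[R]_d.
Local Notation mu := (lebesgue_rV d : {measure set 'rV[R]_d -> \bar R}).
Local Notation leb := (@lebesgue_measure R).
Local Notation heat_multiplier := (@heat_multiplier R d Phi).
Hypothesis heat_finite : forall t : R, 0 < t ->
  (\int[mu]_xi (expR (- (t * Phi (enorm xi ^+ 2))))%:E < +oo)%E.

Lemma measurable_heat_exp s :
  measurable_fun setT (fun xi : T => expR (- (s * Phi (enorm xi ^+ 2)))).
Proof.
rewrite (_ : (fun _ => _) = (fun xi : T =>
    if 0 < edot xi xi then heat_multiplier s xi else expR (- (s * Phi 0)))); last first.
  apply/funext => xi; rewrite enorm_sqr /heat_multiplier symbolE; case: (ltP 0 (edot xi xi)) => // x0.
  rewrite (_ : edot xi xi = 0)//; apply/eqP; by rewrite eq_le x0 edot_ge0.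
apply: measurable_fun_ifT => //; last exact: measurable_heat_multiplier.
by apply: measurable_fun_ltr => //; exact: measurable_edot.
Qed.

Lemma heat_multiplier_integrable s : 0 < s -> mu.-integrable setT (EFin \o heat_multiplier s).
Proof.
move=> s0; apply/integrableP; split.
  by apply/measurable_EFinP; exact: measurable_heat_multiplier.
rewrite (_ : (\int[mu]_x _)%E = (\int[mu]_xi (expR (- (s * Phi (enorm xi ^+ 2))))%:E)%E).
  exact: heat_finite.
apply: ge0_ae_eq_integral => //.
- by apply/measurableT_comp => //; apply/measurable_EFinP; exact: measurable_heat_multiplier.
- by apply/measurable_EFinP; exact: measurable_heat_exp.
- apply: filterS (heat_multiplier_ae d_gt0 Phi s) => xi + _ /=.
  by rewrite ger0_norm ?expR_ge0// => ->.
Qed.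

Lemma cos_heat_integrable (x : T) s : 0 < s ->
  mu.-integrable setT (EFin \o (fun xi : T => cos (edot x xi) * heat_multiplier s xi)).
Proof.
move=> s0; apply: (integrable_dominated _ (heat_multiplier_integrable s0)).
  apply: measurable_funM; [exact: measurable_cos_edot|exact: measurable_heat_multiplier].
move=> xi; rewrite normrM -[leRHS]mul1r [X in _ * X]ger0_norm ?expR_ge0//.
by rewrite ler_wpM2r ?expR_ge0// cos_max.
Qed.

Lemma heat_kernelE s (x : T) : heat_kernel Phi s x =
  (2 * pi) ^- d * \int[mu]_xi (cos (edot x xi) * heat_multiplier s xi).
Proof.
congr (_ * fine _); apply: ae_eq_integral => //.
- apply/measurable_EFinP; apply: measurable_funM; last exact: measurable_heat_exp.
  exact: measurable_cos_edot.
- apply/measurable_EFinP; apply: measurable_funM; last exact: measurable_heat_multiplier.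
  exact: measurable_cos_edot.
- by apply: filterS (heat_multiplier_ae d_gt0 Phi s) => xi -> _.
Qed.

Lemma kernel_factor_gt0 : 0 < (2 * pi : R) ^- d.
Proof. by rewrite invr_gt0 exprn_gt0// mulr_gt0// pi_gt0. Qed.

(** The damping is removed by dominated convergence, the multiplier being
    integrable. *)
Lemma heat_kernel_ge0 s (x : T) : 0 < s -> 0 <= heat_kernel Phi s x.
Proof.
move=> s0; rewrite heat_kernelE mulr_ge0 ?(ltW kernel_factor_gt0)//; apply: fine_ge0.
pose w (a : R) xi := (cos (edot x xi) * heat_multiplier s xi * expR (- (a * edot xi xi)))%:E : \bar R.
pose w0 xi := (cos (edot x xi) * heat_multiplier s xi)%:E : \bar R.
have mc : measurable_fun setT (fun xi : T => cos (edot x xi) * heat_multiplier s xi).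
  by apply: measurable_funM; [exact: measurable_cos_edot|exact: measurable_heat_multiplier].
have [_ _ lim] : [/\ mu.-integrable setT w0,
    [sequence \int[mu]_xi `|w (k.+1%:R^-1)%R xi - w0 xi|]_k @ \oo --> 0 &
    [sequence \int[mu]_xi w (k.+1%:R^-1)%R xi]_k @ \oo --> \int[mu]_xi w0 xi]%E.
  apply: (@dominated_convergence _ _ _ mu setT measurableT (fun k => w k.+1%:R^-1) w0
    (fun xi => (heat_multiplier s xi)%:E)) => //.
  - by move=> k; apply/measurable_EFinP; apply: measurable_funM => //; exact: measurable_gauss.
  - exact/measurable_EFinP.
  - apply: aeW => xi _; apply: cvg_EFin; first exact: nearW.
    rewrite -[X in _ --> X]mulr1; apply: cvgM; first exact: cvg_cst.
    have e0 : - (k.+1%:R^-1 * edot xi xi) @[k --> \oo] --> - (0 * edot xi xi).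
      by apply: cvgN; apply: cvgM; [exact: cvg_harmonic|exact: cvg_cst].
    have := cvg_comp _ _ e0 (@continuous_expR R _).
    by rewrite mul0r oppr0 expR0.
  - exact: heat_multiplier_integrable.
  - apply: aeW => xi k _; rewrite /w lee_fin normrM.
    rewrite -[leRHS]mulr1; apply: ler_pM => //.
      rewrite normrM -[leRHS]mul1r; apply: ler_pM => //; first exact: cos_max.
      by rewrite ger0_norm ?expR_ge0.
    by rewrite ger0_norm ?expR_ge0// -expR0 ler_expR oppr_le0 mulr_ge0 ?edot_ge0.
rewrite -/(w0) -(cvg_lim (@ereal_hausdorff R) lim).
apply: lime_ge; first by apply/cvg_ex; eexists; exact: lim.
apply: nearW => k; apply: (heat_multiplier_wave_nonneg d_gt0 Phi_B0 x s0).
by rewrite invr_gt0.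
Qed.

Lemma edot_cvg0 (x_ : nat -> T) xi :
  (forall n, enorm (x_ n) < n.+1%:R^-1) -> edot (x_ n) xi @[n --> \oo] --> 0.
Proof.
move=> x_lt; apply/norm_cvg0P.
have b0 : n.+1%:R^-1 * (\sum_(i < d) `|xi ord0 i|) @[n --> \oo] --> 0.
  rewrite -[X in _ --> X](mul0r (\sum_(i < d) `|xi ord0 i|)).
  by apply: cvgM; [exact: cvg_harmonic|exact: cvg_cst].
apply: (squeeze_cvgr _ (cvg_cst 0) b0); apply: nearW => n; rewrite normr_ge0 /=.
rewrite (le_trans (ler_norm_sum _ _ _))// big_distrr /=; apply: ler_sum => i _.
by rewrite normrM ler_wpM2r// (le_trans (coord_le_enorm _ _))// ltW.
Qed.

(** Continuity at 0 of the Fourier integral, by dominated convergence along a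
    sequence of counterexamples. *)
Lemma oscillation_small (e : R) : 0 < e -> exists2 del : R, 0 < del &
  forall x, enorm x < del -> \int[mu]_xi ((1 - cos (edot x xi)) * heat_multiplier 1 xi) <= e.
Proof.
move=> e0; apply: contrapT => no.
have /choice[x_ x_P] : forall n, exists x : T, enorm x < n.+1%:R^-1 /\
    e < \int[mu]_xi ((1 - cos (edot x xi)) * heat_multiplier 1 xi).
  move=> n; apply: contrapT => nx; apply: no; exists n.+1%:R^-1; first by rewrite invr_gt0.
  by move=> x xn; rewrite leNgt; apply/negP => ex; apply: nx; exists x.
pose f n xi := ((1 - cos (edot (x_ n) xi)) * heat_multiplier 1 xi)%:E : \bar R.
have [_ _ lim] : [/\ mu.-integrable setT (cst 0),
    [sequence \int[mu]_xi `|f k xi - 0|]_k @ \oo --> 0 &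
    [sequence \int[mu]_xi f k xi]_k @ \oo --> \int[mu]_xi 0]%E.
  apply: (@dominated_convergence _ _ _ mu setT measurableT f (cst 0)
    (fun xi => (2%:E * (heat_multiplier 1 xi)%:E)))%E => //.
  - move=> k; apply/measurable_EFinP; apply: measurable_funM; last exact: measurable_heat_multiplier.
    by apply: measurable_funB => //; exact: measurable_cos_edot.
  - apply: aeW => xi _; apply: cvg_EFin; first exact: nearW.
    rewrite -(mul0r (heat_multiplier 1 xi)); apply: cvgM; last exact: cvg_cst.
    have e1 : edot (x_ n) xi @[n --> \oo] --> 0.
      by apply: edot_cvg0 => n; have [] := x_P n.
    have := cvgB (cvg_cst (1 : R)) (cvg_comp _ _ e1 (@continuous_cos R _)).
    by rewrite cos0 subrr; apply.
  - exact: (integrableZl measurableT 2 (heat_multiplier_integrable ltr01)).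
  - apply: aeW => xi k _; rewrite /f -EFinM lee_fin normrM [X in _ * X <= _]ger0_norm ?expR_ge0//.
    rewrite ler_wpM2r ?expR_ge0//; apply: le_trans (ler_normB _ _) _.
    by rewrite normr1 -[leRHS]/(1 + 1) lerD2l cos_max.
rewrite integral0 in lim.
have /= lim' : (fun k => fine (\int[mu]_xi f k xi)%E) @ \oo --> (0 : R) by exact: (fine_cvg lim).
have [n _ /(_ n (leqnn n))/=] := (@cvgrPdist_lt _ _ _ _ _ _ _).1 lim' _ e0.
by rewrite sub0r normrN => /(le_lt_trans (ler_norm _)); have [_ /lt_trans h /h] := x_P n; rewrite ltxx.
Qed.

Lemma heat_mass_gt0 : 0 < \int[mu]_xi heat_multiplier 2 xi.
Proof.
have I0 : (0 <= \int[mu]_xi (heat_multiplier 2 xi)%:E)%E.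
  by apply: integral_ge0 => xi _; rewrite lee_fin expR_ge0.
have Ioo := integrable_fin_num measurableT (heat_multiplier_integrable (ltr0n R 2)).
rewrite lt0r fine_ge0// andbT; apply/eqP => i0.
have : (\int[mu]_xi `|(heat_multiplier 2 xi)%:E| = 0)%E.
  under eq_integral do rewrite gee0_abs ?lee_fin ?expR_ge0//.
  by rewrite -(fineK Ioo) /= -[RHS]/(0%:E) -i0.
move=> /ae_eq_integral_abs -/(_ measurableT).
case; first by apply/measurable_EFinP; exact: measurable_heat_multiplier.
move=> N [mN N0 sN]; have := @lebesgue_rV_setT_gt0 R d.
rewrite (_ : setT = N) ?N0 ?ltxx//; apply/seteqP; split => // xi _; apply: sN => /= /(_ I) /eqP.
by rewrite eqe gt_eqF// expR_gt0.
Qed.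

(** Up to the constant factor, the heat kernel at time [t] is the integral of the
    multiplier minus that of [(1 - cos) * multiplier]. The multipliers decrease in
    time, so for [t] between 1 and 2 the first is at least its value [J > 0] at time 2
    and the second at most its value at time 1, which is small near the origin. *)
Lemma heat_kernel_lower : exists kap del : R, [/\ 0 < kap, 0 < del &
  forall (x : T) t, enorm x < del -> 1 <= t -> t <= 2 -> kap <= heat_kernel Phi t x].
Proof.
set J := \int[mu]_xi heat_multiplier 2 xi.
have J0 : 0 < J := heat_mass_gt0.
have [del del0 delP] := @oscillation_small (J / 2) ltac:(by rewrite divr_gt0).
exists ((2 * pi) ^- d * (J / 2)), del; split => //.
  by rewrite mulr_gt0 ?kernel_factor_gt0 ?divr_gt0.
move=> x t xd t1 t2; have t0 : 0 < t by exact: lt_le_trans t1.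
rewrite heat_kernelE ler_wpM2l ?(ltW kernel_factor_gt0)//.
have mH s : measurable_fun setT (heat_multiplier s) by exact: measurable_heat_multiplier.
have mono s s' xi : s <= s' -> heat_multiplier s' xi <= heat_multiplier s xi.
  by move=> ss; rewrite ler_expR lerN2 ler_wpM2r// symbol_ge0.
have c1 xi : 0 <= 1 - cos (edot x xi) by rewrite subr_ge0 cos_le1.
have Iosc : mu.-integrable setT (EFin \o (fun xi => (1 - cos (edot x xi)) * heat_multiplier 1 xi)).
  rewrite (_ : EFin \o _ = ((EFin \o heat_multiplier 1) \-
      (EFin \o (fun xi : T => (cos (edot x xi) * heat_multiplier 1 xi)%R)))%E).
    by apply: integrableB => //; [exact: heat_multiplier_integrable|exact: cos_heat_integrable].
  by apply/funext => xi /=; rewrite -EFinB mulrBl mul1r.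
apply: (@le_trans _ _ (J - \int[mu]_xi ((1 - cos (edot x xi)) * heat_multiplier 1 xi))).
  by have := delP x xd; lra.
rewrite -RintegralB//; last exact: heat_multiplier_integrable.
apply: le_Rintegral => //.
- rewrite (_ : EFin \o _ = ((EFin \o heat_multiplier 2) \-
      (EFin \o (fun xi => ((1 - cos (edot x xi)) * heat_multiplier 1 xi)%R)))%E)//.
  by apply: integrableB => //; exact: heat_multiplier_integrable.
- exact: cos_heat_integrable.
move=> xi _; rewrite lerBlDr.
have h1 := mono _ _ xi t2; have h2 := ler_wpM2l (c1 xi) (mono _ _ xi t1).
apply: le_trans h1 _; rewrite -lerBlDl; apply: le_trans h2.
by rewrite mulrBl mul1r.
Qed.

End heat_kernel_near_zero.

(** * Local integrability of Kato potentials *)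

Section kato_locally_integrable.
Context {R : realType} {d : nat}.
Hypothesis d_gt0 : (0 < d)%N.
Variable Phi : R -> R.
Hypothesis Phi_B0 : B0 Phi.
Local Notation T := 'rV[R]_d.
Local Notation mu := (lebesgue_rV d : {measure set 'rV[R]_d -> \bar R}).
Local Notation leb := (@lebesgue_measure R).
Hypothesis heat_finite : forall t : R, 0 < t ->
  (\int[mu]_xi (expR (- (t * Phi (enorm xi ^+ 2))))%:E < +oo)%E.

(** Keep only the times between 1 and 2; positivity of the heat kernel at the other
    times is essential here. *)
Lemma green1_lower : exists kap del : R, [/\ 0 < kap, 0 < del &
  forall x : T, enorm x < del -> (kap%:E <= green1 Phi x)%E].
Proof.
have [kap [del [kap0 del0 low]]] := heat_kernel_lower d_gt0 Phi_B0 heat_finite.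
exists (expR (- 2) * kap), del; split => //; first by rewrite mulr_gt0// expR_gt0.
move=> x xd; pose c := expR (- 2) * kap.
have c0 : 0 <= c by rewrite mulr_ge0 ?expR_ge0 ?ltW.
have -> : (expR (- 2) * kap)%:E =
    (\int[leb]_(t in `]0%R, +oo[) (c%:E * (\1_(`[1, 2]%classic : set R) t)%:E))%E.
  rewrite ge0_integralZl//; last by apply/measurable_EFinP; exact: measurable_indic.
  rewrite integral_indic//= setIidl; last first.
    by move=> t /=; rewrite !in_itv/= andbT => /andP[t1 _]; exact: lt_le_trans t1.
  rewrite lebesgue_measure_itv/= lte_fin ltr1n -EFinD.
  by rewrite (_ : 2 - 1 = 1 :> R) ?mule1//; lra.
apply: le_ge0_integral => t /=; rewrite in_itv/= andbT => t0; first by rewrite -EFinM lee_fin mulr_ge0.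
rewrite -EFinM lee_fin indicE; case: (boolP (t \in _)) => [|_]; last first.
  by rewrite mulr0 mulr_ge0 ?expR_ge0// heat_kernel_ge0.
rewrite inE /= in_itv/= => /andP[t1 t2]; rewrite mulr1; apply: ler_pM => //; first exact: ltW.
- by rewrite ler_expR lerN2.
- exact: low.
Qed.

Definition eball (x : T) (r : R) : set T := [set y | enorm (x - y) < r].

Lemma measurable_eball x r : measurable (eball x r).
Proof.
rewrite -[eball x r]setTI (_ : _ `&` _ = setT `&`
  ((fun y : T => enorm (x - y)) @^-1` `]-oo, r[%classic)); last first.
  by apply/seteqP; split => y /= [_]; rewrite ?in_itv/= => h; split => //; rewrite ?in_itv.
have mf : measurable_fun setT (fun y : T => enorm (x - y)).
  apply: (@measurableT_comp _ _ _ _ _ _ (@enorm R d) setT (fun y : T => x - y)); first exact: measurable_enorm.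
  apply: measurable_fun_rV => i.
  rewrite (_ : _ \o _ = fun y => x ord0 i - rV_coord i y); last first.
    by apply/funext => y; rewrite /rV_coord /= !mxE.
  by apply: measurable_funB => //; exact: measurable_rV_coord.
by apply: mf.
Qed.

(** Near the diagonal the Green kernel is bounded below, so the Kato condition
    bounds the integrals of [V] over balls of one fixed radius. *)
Lemma kato_eball (V : T -> \bar R) : kato Phi V -> exists2 r : R, 0 < r &
  forall x, (\int[mu]_(y in eball x r) V y < +oo)%E.
Proof.
move=> [mV V0 lim]; have [kap [del [kap0 del0 low]]] := green1_lower.
have nlim := lim _ (open_ereal_lt' (lte01 : (0%E < 1%E :> \bar R)%E)).
move: nlim => [e /= e0 eP].
pose r := Num.min (e / 2) del.
have r0 : 0 < r by rewrite lt_min del0 divr_gt0.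
exists r => // x.
have small : (\int[mu]_(y in eball x r) (green1 Phi (x - y)%R * V y) < 1)%E.
  apply: le_lt_trans (eP r _ r0).
    by apply: ereal_sup_ubound; exists x.
  rewrite /= sub0r normrN gtr0_norm// /r; apply: le_lt_trans (_ : e / 2 < e).
    by rewrite ge_min lexx.
  by lra.
have : (kap%:E * \int[mu]_(y in eball x r) V y < 1)%E.
  rewrite -ge0_integralZl//; [|exact: measurable_eball|exact: measurable_funTS|exact: ltW].
  apply: le_lt_trans small; apply: le_ge0_integral => y /= yr.
    by rewrite mule_ge0// lee_fin ltW.
  apply: lee_wpmul2r => //; apply: low.
  by apply: lt_le_trans yr _; rewrite ge_min lexx orbT.
case: (\int[mu]_(y in eball x r) V y)%E => [y| |] //=; rewrite ?ltry//.
by rewrite gt0_muley// lte_fin.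
Qed.

Lemma cube_compact (r : R) : compact (cube r : set T).
Proof.
rewrite (_ : cube r = [set v : T | forall i, (`[- r, r]%classic : set R) (v ord0 i)]).
  apply: (@rV_compact _ _ (fun=> `[- r, r]%classic)) => _; exact: segment_compact.
by apply/seteqP; split => v /= h i; have := h i; rewrite /= in_itv/= ler_norml.
Qed.

(** The topology of row vectors is that of the sup norm. *)
Lemma edot_lt_sup_ball (x y : T) (r : R) : 0 < r ->
  ball x (r / d.+1%:R) y -> enorm (x - y) < r.
Proof.
move=> r0 [_ xy]; have d0 : 0 < d.+1%:R :> R by [].
rewrite -(@ltr_pXn2r _ 2)// ?nnegrE ?sqrtr_ge0// ?ltW// enorm_sqr.
apply: (@le_lt_trans _ _ (d%:R * (r / d.+1%:R) ^+ 2)).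
  rewrite mulr_natl -[leRHS](_ : \sum_(i < d) (r / d.+1%:R) ^+ 2 = _); last first.
    by rewrite sumr_const card_ord.
  apply: ler_sum => i _; rewrite -expr2 -real_normK ?num_real//.
  by rewrite ler_pXn2r ?nnegrE//; [rewrite !mxE; exact/ltW/xy|rewrite divr_ge0// ltW].
rewrite expr_div_n mulrA ltr_pdivrMr ?exprn_gt0// mulrC ltr_pM2l ?exprn_gt0//.
by rewrite -natrX ltr_nat; nia.
Qed.

(** A cube is covered by finitely many of the balls of [kato_eball]. *)
Lemma kato_cube (V : T -> \bar R) (N : R) : kato Phi V ->
  (\int[mu]_(x in cube N) V x < +oo)%E.
Proof.
move=> kV; have [mV V0 _] := kV; have [r r0 rP] := kato_eball kV.
have := @cube_compact N; rewrite compact_cover.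
move=> /(_ T (cube N) (fun x => (ball x (r / d.+1%:R))^°)) [].
- by move=> x _; exact: open_interior.
- move=> x Nx; exists x => //; rewrite /interior; apply: nbhsx_ballx.
  by rewrite divr_gt0.
move=> D _ cov.
pose nu := density_measureT mu mV V0.
have seq_fin (s : seq T) : (nu (\bigcup_(x in [set` s]) eball x r) < +oo)%E.
  elim: s => [|x s IH]; first by rewrite set_nil bigcup_set0 measure0.
  rewrite (_ : [set` x :: s] = x |` [set` s]) ?bigcup_setU1; last first.
    apply/seteqP; split => y /=; rewrite in_cons; first by case/orP => [/eqP|]; [left|right].
    by case=> [->|->]; rewrite ?eqxx ?orbT.
  apply: le_lt_trans (lte_add_pinfty (rP x) IH).
  apply: measureU2; first exact: measurable_eball.
  by apply: fin_bigcup_measurable => // y _; exact: measurable_eball.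
have Dfin := seq_fin (finmap.enum_fset D).

apply: le_lt_trans Dfin; apply: (@le_measure _ _ _ nu).
- by rewrite inE; exact: measurable_cube.
- by rewrite inE; apply: fin_bigcup_measurable => // y _; exact: measurable_eball.
- move=> x /cov [y yD xy]; exists y => //=.
  by apply: edot_lt_sup_ball => //; exact: interior_subset xy.
Qed.

End kato_locally_integrable.

(** * Strong resolvent convergence *)

Section lifted_potential.
Context {R : realType} {d : nat}.
Hypothesis d_gt0 : (0 < d)%N.
Variable Phi : R -> R.
Hypothesis Phi_B0 : B0 Phi.
Local Notation T := 'rV[R]_d.
Local Notation mu := (lebesgue_rV d : {measure set 'rV[R]_d -> \bar R}).
Hypothesis heat_finite : forall t : R, 0 < t ->
  (\int[mu]_xi (expR (- (t * Phi (enorm xi ^+ 2))))%:E < +oo)%E.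

Lemma Lnorm_oo_ae (f : T -> \bar R) (c : R) : ('N[mu]_+oo [f] <= c%:E)%E ->
  \forall x \ae mu, (`|f x| <= c%:E)%E.
Proof. by rewrite unlock lebesgue_rV_setT_gt0 => /ess_sup_inf.ess_supP. Qed.

Lemma cube_cover (x : T) : \forall N \near \oo, cube N%:R x.
Proof.
exists (Num.bound (enorm x)) => // N /= h i.
apply: le_trans (coord_le_enorm x i) _; apply: le_trans (ltW (unstable.ltr_bound _)) _.
by rewrite ler_nat.
Qed.

Variables (V : T -> \bar R) (c : R).
Hypothesis V_kato : kato_dec Phi V.
Hypothesis V_lower : \forall x \ae mu, (V^\- x <= c%:E)%E.
Hypothesis c0 : 0 <= c.

Lemma measurable_kato_pos : measurable_fun setT (V^\+)%E.
Proof.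
apply: (@emeasurable_fun_cvg _ _ R setT (fun (N : nat) x => (\1_(cube N%:R) x)%:E * V^\+ x)%E).
  by move=> N; have [] := V_kato.2 _ (@cube_compact R d N%:R).
move=> x _; apply: cvg_near_cst; apply: filterS (cube_cover x) => N xN.
by rewrite indicE mem_set// mul1e.
Qed.

Lemma measurable_kato : measurable_fun setT V.
Proof.
rewrite (funeposneg V); apply: emeasurable_funB; first exact: measurable_kato_pos.
by have [[]] := V_kato.
Qed.

Lemma kato_pos_cube (N : nat) : (\int[mu]_(x in cube N%:R) (V^\+ x)%E < +oo)%E.
Proof.
have := kato_cube d_gt0 Phi_B0 heat_finite N%:R (V_kato.2 _ (@cube_compact R d N%:R)).
rewrite (eq_integral (V^\+)%E)// => x xN.
by rewrite indicE xN mul1e.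
Qed.

(** A real-valued, everywhere non-negative version of [V + c]. *)
Definition lifted_potential (x : T) : R := Num.max 0 (fine (V x) + c).

Lemma lifted_potential_ge0 x : 0 <= lifted_potential x.
Proof. by rewrite le_max lexx. Qed.

Lemma measurable_lifted_potential : measurable_fun setT lifted_potential.
Proof.
apply: measurable_maxr => //; apply: measurable_funD => //.
exact: (measurableT_comp _ measurable_kato).
Qed.

(** [V] is finite almost everywhere: below because of the bound on its negative
    part, above because its positive part is locally integrable. *)
Lemma lifted_potentialE : \forall x \ae mu, V x = (lifted_potential x - c)%:E.
Proof.
have pos_fin : \forall x \ae mu, forall N : nat, cube N%:R x -> (V^\+ x)%E \is a fin_num.
  apply: ae_foralln => N; apply: (integrable_ae (measurable_cube _)).
  apply/integrableP; split; first exact: measurable_funTS measurable_kato_pos.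
  by under eq_integral do rewrite gee0_abs ?funepos_ge0//; exact: kato_pos_cube.
apply: filterS2 pos_fin V_lower => x xfin.
have [N _ /(_ N (leqnn N))/= /xfin] := cube_cover x.
rewrite funeposE funenegE /lifted_potential.
case: (V x) => [v| |] /= h; rewrite ?maxye// ?maxeNy//.
  rewrite -EFin_max lee_fin ge_max c0 andbT => vc.
  by rewrite (max_r (_ : 0 <= v + c)) ?addrK// -lerBlDr sub0r lerNl.
Qed.

Lemma lifted_potential_cube (N : nat) : (\int[mu]_(x in cube N%:R) (lifted_potential x)%:E < +oo)%E.
Proof.
have mc := @measurable_cube R d N%:R.
apply: (@le_lt_trans _ _ (\int[mu]_(x in cube N%:R) (V^\+ x + c%:E))%E).
  apply: le_ge0_integral => x _; first by rewrite lee_fin lifted_potential_ge0.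
  rewrite funeposE /lifted_potential; case: (V x) => [v| |] /=.
  - rewrite -EFin_max -EFinD lee_fin ge_max addr_ge0 ?le_max ?lexx ?orbT//=.
    by rewrite lerD2r le_max lexx.
  - by rewrite addye// leey.
  - by rewrite maxNye add0e lee_fin add0r ge_max c0 lexx.
rewrite ge0_integralD//; last exact: measurable_funTS measurable_kato_pos.
by rewrite lte_add_pinfty ?kato_pos_cube// integral_cst// lte_mul_pinfty// cube_lty.
Qed.

End lifted_potential.

Unset Implicit Arguments.

Theorem theorem3p1 (R : realType) (d : nat) (d_gt0 : (0 < d)%N)
  (Phi : R -> R) (s : R)
  (V_ : nat -> 'rV[R]_d -> \bar R) (V : 'rV[R]_d -> \bar R)
  (Phi_B0 : B0 Phi) (s_gt0 : 0 < s) (s_lt1 : s < 1)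
  (heat_finite : forall t : R, 0 < t ->
    (\int[lebesgue_rV d]_xi (expR (- (t * Phi (enorm xi ^+ 2))))%:E < +oo)%E)
  (kernel_lower : exists2 C : R, 0 < C & forall r : R, 0 < r -> r <= 1 ->
    ((C * r `^ (- d%:R - 2 * s))%:E <= jump_kernel d Phi r)%E)
  (V_kato : forall k, kato_dec Phi (V_ k))
  (V_inf_kato : kato_dec Phi V)
  (neg_bounded :
    (Order.max
       (ereal_sup (range (fun k => 'N[lebesgue_rV d]_+oo [(V_ k)^\-])))
       ('N[lebesgue_rV d]_+oo [V^\-]) < +oo)%E)
  (V_cvg : \forall x \ae lebesgue_rV d, V_ k x @[k --> \oo] --> V x)
  (V_limsup : forall u : L2 (lebesgue_rV d), form_dom Phi V u ->
    (limn_esup (fun k => \int[lebesgue_rV d]_x (V_ k x * (u x ^+ 2)%:E)) <=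
     \int[lebesgue_rV d]_x (V x * (u x ^+ 2)%:E))%E) :
  strong_resolvent_cvg (fun k => schrodinger Phi (V_ k)) (schrodinger Phi V).
Proof.
have [c c0 [Vc Vc_]] : exists2 c : R, 0 <= c &
    (\forall x \ae lebesgue_rV d, (V^\- x <= c%:E)%E) /\
    forall k, \forall x \ae lebesgue_rV d, ((V_ k)^\- x <= c%:E)%E.
  move: neg_bounded; set M := Order.max _ _ => Moo.
  have M0 : (0 <= M)%E by rewrite le_max Lnorm_ge0 orbT.
  have ME : M = (fine M)%:E by rewrite fineK// ge0_fin_numE.
  exists (fine M); first exact: fine_ge0.
  have abs (f : 'rV[R]_d -> \bar R) : ('N[lebesgue_rV d]_+oo [f^\-] <= M)%E ->
      \forall x \ae lebesgue_rV d, (f^\- x <= (fine M)%:E)%E.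
    rewrite ME => /Lnorm_oo_ae; apply: filterS => x.
    by rewrite gee0_abs ?funeneg_ge0.
  split=> [|k]; apply: abs; rewrite le_max; apply/orP; [right => //|left].
  by apply: ereal_sup_ubound; exists k.
pose W := lifted_potential V c; pose W_ k := lifted_potential (V_ k) c.
have mV := measurable_kato V_inf_kato.
have mV_ k := measurable_kato (V_kato k).
have mW : measurable_fun setT W := measurable_lifted_potential c V_inf_kato.
have mW_ k : measurable_fun setT (W_ k) := measurable_lifted_potential c (V_kato k).
have W0 : forall x, 0 <= W x by exact: lifted_potential_ge0.
have W0_ k : forall x, 0 <= W_ k x by exact: lifted_potential_ge0.
have VE := lifted_potentialE d_gt0 Phi_B0 heat_finite V_inf_kato Vc c0.
have VE_ k := lifted_potentialE d_gt0 Phi_B0 heat_finite (V_kato k) (Vc_ k) c0.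
have W_loc := lifted_potential_cube d_gt0 Phi_B0 heat_finite V_inf_kato c0.
have W_loc_ k := lifted_potential_cube d_gt0 Phi_B0 heat_finite (V_kato k) c0.
have W_cvg : \forall x \ae lebesgue_rV d, W_ n x @[n --> \oo] --> W x.
  apply: filterS3 (ae_foralln VE_) VE V_cvg => x E_ E.
  rewrite E (_ : V_ ^~ x = fun k => (W_ k x - c)%:E); last by apply/funext => k; exact: E_.
  move=> /fine_cvg/= Wc.
  have : W_ k x - c + c @[k --> \oo] --> W x - c + c by apply: cvgD Wc _; exact: cvg_cst.
  by rewrite subrK; under eq_fun do rewrite subrK.
have dense := form_domain_dense Phi_B0 mW W0 W_loc.
have dense_ k := form_domain_dense Phi_B0 (mW_ k) (W0_ k) (W_loc_ k).
split.
- by move=> k; apply: (schrodinger_self_adjoint Phi_B0 (mW_ k) (W0_ k) (mV_ k) (VE_ k) (dense_ k)).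
- exact: (schrodinger_self_adjoint Phi_B0 mW W0 mV VE dense).
exists (- (c + 1)), (fun k f => - form_solve (form_closed Phi_B0 (mW_ k)) f),
  (fun f => - form_solve (form_closed Phi_B0 mW) f); split.
- by move=> k; apply: (schrodinger_resolvent Phi_B0 (mW_ k) (W0_ k) (mV_ k) (VE_ k)).
- exact: (schrodinger_resolvent Phi_B0 mW W0 mV VE).
move=> f _.
have := schrodinger_resolvent_cvg Phi_B0 mW_ W0_ mV_ VE_ mW W0 mV VE W_cvg V_limsup f.
by under eq_fun do rewrite -L2normN opprD.
Qed.
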